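(* There exists $\varepsilon>0$ with the following property: if an integer $n\ge 1$ and $p\in[0,1]$ are such that $$\mathbb{P}_p(E(n,n))>1-\varepsilon,$$ then $\theta(p)>0$.
   Context: The vertex set is $S=\mathbb{Z}^2\times\{0,1\}$, and two vertices of $S$ are neighbors if they are at (three-dimensional) Euclidean distance one from each other (equivalently $\|v-w\|_1=1$). A configuration is $\omega\in\{0,1\}^S$; a vertex $v$ is open if $\omega(v)=1$ and closed otherwise. $\mathbb{P}_p$ is the product measure on $\{0,1\}^S$ with $\mathbb{P}_p(\omega(v)=1)=p=1-\mathbb{P}_p(\omega(v)=0)$ for each $v\in S$. An open path from $v$ to $w$ is a sequence $(v_0,\dots,v_k)$ of vertices with $v_0=v$, $v_k=w$, $\|v_i-v_{i+1}\|_1=1$ for $i=0,\dots,k-1$, and all $v_i$ open. The event $\{v\to\infty\}$ is that $v$ is part of an infinite open path (equivalently, the open cluster of $v$ is infinite). $\vec 0=(0,0,0)$ and $\theta(p)=\mathbb{P}_p(\vec 0\to\infty)$. For integers $n,m\ge1$, $E(n,m)$ is the left-right crossing event that there exists a vertex in $\{-n\}\times[-m,m]\times\{0,1\}$ connected to a vertex in $\{n\}\times[-m,m]\times\{0,1\}$ by an open path which stays in the box $[-n,n]\times[-m,m]\times\{0,1\}$ (intervals denote sets of integers here). *)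

(* Defs.v *)
From mathcomp Require Import all_boot all_order all_algebra.
From mathcomp Require Import all_classical all_reals all_analysis.

Set Implicit Arguments.
Unset Strict Implicit.
Unset Printing Implicit Defensive.

Import Order.TTheory GRing.Theory Num.Theory.

Local Open Scope classical_set_scope.
Local Open Scope ring_scope.

(* The slab Z^2 x {0, 1}; the third coordinate is a bool, read as 0 or 1
   through the coercion bool >-> nat. *)
Definition vertex : Type := (int * int * bool)%type.

Definition origin : vertex := (0, 0, false).

Definition l1dist (v w : vertex) : nat :=
  (`|v.1.1 - w.1.1| + `|v.1.2 - w.1.2| + `|(v.2 : nat)%:Z - (w.2 : nat)%:Z|)%N.

Definition adj : rel vertex := fun v w => l1dist v w == 1%N.

Definition coordinate_events : set (set (vertex -> bool)) :=
  [set A | exists v, A = [set w | w v = true]].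

(* {0, 1}^S with the product sigma-algebra; w v = true means that v is open. *)
Notation config := (g_sigma_algebraType coordinate_events).

(* P is the product over all vertices of the law giving mass p to 1 and 1 - p
   to 0. Prescribing the values on finite cylinders determines P, since these
   form a pi-system generating the sigma-algebra; such a P exists for every p
   in [0, 1] by Kolmogorov's extension theorem. *)
Definition is_product_measure (R : realType) (p : R) (P : probability config R)
    : Prop :=
  forall (s : seq vertex) (a : vertex -> bool), uniq s ->
    P [set w : config | forall v, v \in s -> w v = a v] =
    (\prod_(v <- s) (if a v then p else 1 - p))%:E.

(* There is an open path from v to v' all of whose vertices lie in B. *)
Definition connected_in (B : pred vertex) (w : config) (v v' : vertex) : Prop :=
  exists s : seq vertex,
    [/\ path adj v s, last v s = v', all w (v :: s) & all B (v :: s)].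

Definition box (n m : nat) : pred vertex := fun v =>
  (- n%:Z <= v.1.1 <= n%:Z) && (- m%:Z <= v.1.2 <= m%:Z).

Definition crossing (n m : nat) : set config :=
  [set w | exists v v' : vertex,
    [/\ v.1.1 = - n%:Z /\ - m%:Z <= v.1.2 <= m%:Z,
        v'.1.1 = n%:Z /\ - m%:Z <= v'.1.2 <= m%:Z
      & connected_in (box n m) w v v']].

(* An infinite path is required to be self-avoiding: otherwise going back and
   forth along a single edge would count as one. *)
Definition to_infinity (v : vertex) : set config :=
  [set w | exists g : nat -> vertex,
    [/\ injective g, forall i, adj (g i) (g i.+1), forall i, w (g i)
      & exists k, g k = v]].

Definition theta (R : realType) (P : probability config R) : \bar R :=
  P (to_infinity origin).

(* Main.v *)
Require Import Defs.
From mathcomp Require Import all_boot all_order all_algebra.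
From mathcomp Require Import all_classical all_reals all_analysis.
From mathcomp Require Import zify ring lra.

(* In a slab of thickness two, two open vertices in the same column are equal or
   adjacent, so two open paths whose projections to the plane cross are connected. Hence
   crossings of overlapping rectangles can be glued as in planar percolation.

   The heart of the matter is a Russo-Seymour-Welsh estimate. If a big square is crossed
   with probability close to one, the square root trick shows that some rectangle of
   ratio 5/4 is crossed the long way with probability close to one, or that a rectangle
   of ratio 4/3 is so crossed the short way. In the second case one explores the faces
   that can be reached from the left of that rectangle without passing through an open
   edge; a crossing starting in the left half of the bottom side keeps the exploration
   away from the right. A horizontal crossing of the square has to come next to the
   explored region or to its reflection in the horizontal axis of the square, and a
   column of two open vertices there would connect it to the bottom side. Given the
   exploration, the columns next to it are fresh. Closing such a column costs
   (1 - p)^2, not opening it completely costs 1 - p^2, and a power of the latter is at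
   most the former when p is bounded away from 0; Jensen's inequality thus bounds a
   power of the probability that no connection arises by the probability that there is
   no crossing. The connection and its reflection in the vertical axis of the small
   rectangle glue to a long horizontal crossing.

   From a rectangle of ratio 2 crossed with failure probability at most 1/98, the
   failure probabilities at doubled scales satisfy phi_(k+1) <= 49 phi_k^2, hence decay
   geometrically. With probability at least 1/2 crossings exist at all scales and are
   connected to each other, so that an infinite path meets a fixed finite box.

   Probabilities of local events are computed by the recursion [Ex] over a finite list
   of vertices, and are only at the end identified with those of the product measure. *)

Set Implicit Arguments.
Unset Strict Implicit.
Unset Printing Implicit Defensive.

Import Order.TTheory GRing.Theory Num.Theory.

Local Open Scope classical_set_scope.
Local Open Scope ring_scope.

(** * Finite product expectations *)

Definition cfg := vertex -> bool.

Definition upd (w : cfg) (v : vertex) (b : bool) : cfg :=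
  fun u => if u == v then b else w u.

Definition agree (X : pred vertex) (w w' : cfg) : Prop := forall v, X v -> w v = w' v.

Definition depends_on (T : Type) (X : pred vertex) (f : cfg -> T) : Prop :=
  forall w w', agree X w w' -> f w = f w'.

Definition Ind (R : nzRingType) (Q : Prop) : R := (`[< Q >])%:R.

Section Expectation.
Variables (R : realType) (p : R).
Hypothesis p01 : 0 <= p <= 1.

(** Averages over the sites of [s] independently and takes all other sites from [w]. A repeated site
    is harmless: the innermost update wins, so the outer average is over equal values. *)
Fixpoint Ex (s : seq vertex) (f : cfg -> R) (w : cfg) : R :=
  if s is v :: s' then p * Ex s' f (upd w v true) + (1 - p) * Ex s' f (upd w v false)
  else f w.

Let p0 : 0 <= p. Proof. by case/andP: p01. Qed.
Let q0 : 0 <= 1 - p. Proof. by rewrite subr_ge0; case/andP: p01. Qed.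

Lemma updC w v u b c : v != u -> upd (upd w v b) u c = upd (upd w u c) v b.
Proof.
move=> vu; apply/funext => x; rewrite /upd.
by case: (x =P v) => [->|//]; rewrite (negbTE vu).
Qed.

Lemma Ex_cat s t f w : Ex (s ++ t) f w = Ex s (Ex t f) w.
Proof. by elim: s w => //= v s IH w; rewrite !IH. Qed.

(* Only the values off [s] of the base configuration are visible to [f]. *)
Lemma eq_Ex s f g w :
  (forall w', agree (fun v => v \notin s) w w' -> f w' = g w') -> Ex s f w = Ex s g w.
Proof.
elim: s w => [|v s IH] w fg /=; first by apply: fg.
by congr (_ * _ + _ * _); apply: IH => w' ww'; apply: fg => u;
  rewrite in_cons negb_or => /andP[uv us]; rewrite -ww' // /upd (negbTE uv).
Qed.

Lemma Ex_swap v u s f w : Ex (v :: u :: s) f w = Ex (u :: v :: s) f w.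
Proof.
have [->//|vu] := eqVneq v u.
by rewrite /= !(updC _ _ _ vu); ring.
Qed.

Lemma Ex_rem v s f w : v \in s -> Ex s f w = Ex (v :: rem v s) f w.
Proof.
elim: s w => // u s IH w; rewrite in_cons /=.
have [->//|vu] /= := eqVneq v u => vs; rewrite !IH //.
exact: (Ex_swap u v).
Qed.

Lemma Ex_perm s t f w : perm_eq s t -> Ex s f w = Ex t f w.
Proof.
elim: s t w => [|v s IH] t w; first by rewrite perm_sym => /perm_nilP ->.
move=> st; have vt : v \in t by rewrite -(perm_mem st) mem_head.
have st' : perm_eq s (rem v t).
  by rewrite -(perm_cons v); apply: (perm_trans st); exact: perm_to_rem.
by rewrite (Ex_rem _ _ vt) /= !(IH (rem v t)).
Qed.

Lemma Ex_cst s c w : Ex s (fun=> c) w = c.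
Proof. by elim: s w => //= v s IH w; rewrite !IH; ring. Qed.

Lemma Ex_mono s f g w :
  (forall w', agree (fun v => v \notin s) w w' -> f w' <= g w') -> Ex s f w <= Ex s g w.
Proof.
elim: s w => [|v s IH] w fg /=; first by apply: fg.
by apply: lerD; apply: ler_wpM2l => //; apply: IH => w' ww'; apply: fg => u;
  rewrite in_cons negb_or => /andP[uv us]; rewrite -ww' // /upd (negbTE uv).
Qed.

Lemma ler_Ex s f g w : (forall w', f w' <= g w') -> Ex s f w <= Ex s g w.
Proof. by move=> fg; apply: Ex_mono. Qed.

Lemma Ex_ge0 s f w : (forall w', 0 <= f w') -> 0 <= Ex s f w.
Proof. by move=> f0; rewrite -(Ex_cst s 0 w); exact: ler_Ex. Qed.

Lemma ExD s f g w : Ex s (fun w => f w + g w) w = Ex s f w + Ex s g w.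
Proof. by elim: s w => //= v s IH w; rewrite !IH; ring. Qed.

Lemma ExZ s c f w : Ex s (fun w => c * f w) w = c * Ex s f w.
Proof. by elim: s w => //= v s IH w; rewrite !IH; ring. Qed.

Lemma Ex_sum I (r : seq I) s (F : I -> cfg -> R) w :
  Ex s (fun w => \sum_(i <- r) F i w) w = \sum_(i <- r) Ex s (F i) w.
Proof.
elim: r => [|i r IH]; first by under eq_Ex do rewrite big_nil; rewrite Ex_cst big_nil.
by under eq_Ex do rewrite big_cons; rewrite ExD IH big_cons.
Qed.

Lemma Ex_pull X s f g w : depends_on X f -> (forall v, v \in s -> ~~ X v) ->
  Ex s (fun w => f w * g w) w = f w * Ex s g w.
Proof.
move=> fX sX; rewrite -ExZ; apply: eq_Ex => w' ww'; congr (_ * _); apply: fX => v Xv.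
by rewrite ww' //; apply/negP => /sX; rewrite Xv.
Qed.

Lemma Ex_free X s f w : depends_on X f -> (forall v, v \in s -> ~~ X v) -> Ex s f w = f w.
Proof.
move=> fX sX; rewrite -[RHS](Ex_cst s _ w); apply: eq_Ex => w' ww'; apply: fX => v Xv.
by rewrite ww' //; apply/negP => /sX; rewrite Xv.
Qed.

Lemma Ex_base X s f w w' : depends_on X f -> (forall v, X v -> v \notin s -> w v = w' v) ->
  Ex s f w = Ex s f w'.
Proof.
move=> fX; elim: s w w' => [|v s IH] w w' ww' /=; first by apply: fX => v Xv; exact: ww'.
by congr (_ * _ + _ * _); apply: IH => u Xu us; rewrite /upd; case: eqP => // /eqP uv;
  apply: ww' => //; rewrite in_cons negb_or uv.
Qed.

Lemma filter_perm (T : eqType) (a : pred T) (s : seq T) :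
  perm_eq s ([seq x <- s | a x] ++ [seq x <- s | ~~ a x]).
Proof. by rewrite perm_sym; apply/permPl; exact: perm_filterC. Qed.

Lemma Ex_filter X s f w : depends_on X f -> Ex s f w = Ex [seq v <- s | X v] f w.
Proof.
move=> fX; rewrite (Ex_perm _ _ (filter_perm X s)) Ex_cat.
apply: eq_Ex => w' _; apply: (Ex_free _ fX) => v.
by rewrite mem_filter => /andP[].
Qed.

(** Only the sites on which [f] depends matter, neither the enclosing list nor the base
    configuration. This lets one event be measured in different boxes. *)
Lemma Ex_dep X s t f w w' : depends_on X f -> uniq s -> uniq t ->
  (forall v, X v -> v \in s) -> (forall v, X v -> v \in t) -> Ex s f w = Ex t f w'.
Proof.
move=> fX us ut Xs Xt; rewrite (Ex_filter s _ fX) (Ex_filter t _ fX).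
rewrite (@Ex_perm [seq v <- s | X v] [seq v <- t | X v]); last first.
  apply: uniq_perm; rewrite ?filter_uniq // => v; rewrite !mem_filter.
  by case Xv : (X v) => //=; rewrite Xs ?Xt.
by apply: (Ex_base fX) => v Xv; rewrite mem_filter Xv Xt.
Qed.

Lemma Ex_map (h h' : vertex -> vertex) s f w : cancel h h' -> cancel h' h ->
  Ex (map h s) f w = Ex s (fun u => f (u \o h')) (w \o h).
Proof.
move=> hK h'K; elim: s w => [|v s IH] w /=.
  by congr f; apply/funext => x /=; rewrite h'K.
by congr (_ * _ + _ * _); rewrite IH; congr (Ex s _ _); apply/funext => x; rewrite /upd /= (can_eq hK).
Qed.

Lemma Ex_sym X (h h' : vertex -> vertex) s t f w w' : cancel h h' -> cancel h' h ->
  depends_on X f -> uniq s -> uniq t ->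
  (forall v, X v -> v \in s) -> (forall v, X (h v) -> v \in t) ->
  Ex s f w = Ex t (fun u => f (u \o h')) w'.
Proof.
move=> hK h'K fX us ut Xs Xt.
rewrite (@Ex_dep X s (map h t) f w (w' \o h')) //; last 2 first.
- by rewrite (map_inj_uniq (can_inj hK)).
- by move=> v Xv; rewrite -(h'K v) map_f // Xt // h'K.
by rewrite (Ex_map _ _ _ hK h'K); congr Ex; apply/funext => x /=; rewrite hK.
Qed.

Lemma Ex_indep X Y s f g w : depends_on X f -> depends_on Y g -> (forall v, X v -> ~~ Y v) ->
  Ex s (fun w => f w * g w) w = Ex s f w * Ex s g w.
Proof.
move=> fX gY XY.
rewrite (Ex_perm _ _ (filter_perm X s)) Ex_cat.
rewrite (@eq_Ex _ _ (fun w => f w * Ex s g w)); last first.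
  move=> w' ww'; rewrite (Ex_pull _ _ fX); last by move=> v; rewrite mem_filter => /andP[].
  congr (_ * _); rewrite [RHS](@Ex_perm _ _ _ _ (filter_perm X s)) Ex_cat.
  rewrite -[LHS](Ex_cst [seq v <- s | X v] _ w'); apply: eq_Ex => w2 w2w.
  apply: (Ex_base gY) => v Yv _; apply: w2w; rewrite mem_filter.
  by apply/negP => /andP[/XY]; rewrite Yv.
have gc : forall w', agree (fun v => v \notin [seq v <- s | X v]) w w' -> Ex s g w' = Ex s g w.
  move=> w' ww'; apply: (Ex_base gY) => v Yv _; rewrite ww' // mem_filter.
  by apply/negP => /andP[/XY]; rewrite Yv.
rewrite (@eq_Ex _ _ (fun w' => Ex s g w * f w')); last by move=> w' /gc ->; rewrite mulrC.
by rewrite ExZ mulrC (Ex_filter s _ fX).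
Qed.

(** * Correlation and convexity inequalities *)

Definition antitone (f : cfg -> R) := forall w w' : cfg, (forall v, w v -> w' v) -> f w' <= f w.

Lemma Ex_antitone s f : antitone f -> antitone (Ex s f).
Proof.
move=> af; elim: s => //= v s IH w w' ww'.
by apply: lerD; apply: ler_wpM2l => //; apply: IH => u; rewrite /upd; case: eqP => // _; exact: ww'.
Qed.

Lemma upd_le w v : forall u, upd w v false u -> upd w v true u.
Proof. by move=> u; rewrite /upd; case: eqP. Qed.

(** Induction on the sites: the covariance is the average of the covariances given the first site
    plus p (1 - p) times the product of the increments of [f] and [g] at that site, which have the
    same sign. *)
Lemma harris s f g w : antitone f -> antitone g ->
  Ex s f w * Ex s g w <= Ex s (fun w => f w * g w) w.
Proof.
move=> af ag; elim: s w => //= v s IH w.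
have := IH (upd w v true); have := IH (upd w v false).
have := Ex_antitone s af (@upd_le w v); have := Ex_antitone s ag (@upd_le w v).
move: (Ex s f (upd w v true)) (Ex s f (upd w v false)) (Ex s g (upd w v true))
  (Ex s g (upd w v false)) (Ex s (fun w => f w * g w) (upd w v true))
  (Ex s (fun w => f w * g w) (upd w v false)).
move=> f1 f0 g1 g0 a1 a0 gg ff h0 h1.
have k1 : 0 <= p * (a1 - f1 * g1) by rewrite mulr_ge0 // subr_ge0.
have k0 : 0 <= (1 - p) * (a0 - f0 * g0) by rewrite mulr_ge0 // subr_ge0.
have k2 : 0 <= p * (1 - p) * ((f0 - f1) * (g0 - g1)).
  by rewrite !mulr_ge0 // subr_ge0.
nra.
Qed.

Lemma Ex_sqr s f w : (Ex s f w) ^+ 2 <= Ex s (fun w => f w ^+ 2) w.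
Proof.
elim: s w => //= v s IH w.
have := IH (upd w v true); have := IH (upd w v false).
move: (Ex s f (upd w v true)) (Ex s f (upd w v false))
  (Ex s (fun w => f w ^+ 2) (upd w v true))
  (Ex s (fun w => f w ^+ 2) (upd w v false)) => f1 f0 a1 a0 h0 h1.
have k1 : 0 <= p * (a1 - f1 ^+ 2) by rewrite mulr_ge0 // subr_ge0.
have k0 : 0 <= (1 - p) * (a0 - f0 ^+ 2) by rewrite mulr_ge0 // subr_ge0.
have k2 : 0 <= p * (1 - p) * (f0 - f1) ^+ 2 by apply: mulr_ge0; [exact: mulr_ge0|exact: sqr_ge0].
nra.
Qed.

Lemma jensen j s f w : (forall w, 0 <= f w) ->
  (Ex s f w) ^+ (2 ^ j) <= Ex s (fun w => f w ^+ (2 ^ j)) w.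
Proof.
move=> f0; elim: j => [|j IH]; first by rewrite expn0 expr1; apply: ler_Ex => w'; rewrite expr1.
rewrite expnS mulnC exprM.
apply: (@le_trans _ _ ((Ex s (fun w => f w ^+ (2 ^ j)) w) ^+ 2)).
  rewrite ler_pXn2r // nnegrE ?exprn_ge0 ?Ex_ge0 // => w'; exact: exprn_ge0.
apply: (le_trans (Ex_sqr _ _ _)); apply: ler_Ex => w'; by rewrite exprM.
Qed.

Lemma indic_ge0 Q : 0 <= Ind R Q.
Proof. exact: ler0n. Qed.

Lemma indic_le1 Q : Ind R Q <= 1.
Proof. by rewrite /Ind; case: asboolP. Qed.

Lemma indic_T (Q : Prop) : Q -> Ind R Q = 1.
Proof. by move=> q; rewrite /Ind asboolT. Qed.

Lemma indic_F (Q : Prop) : ~ Q -> Ind R Q = 0.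
Proof. by move=> q; rewrite /Ind asboolF. Qed.

Lemma indic_mono (Q Q' : Prop) : (Q -> Q') -> Ind R Q <= Ind R Q'.
Proof.
move=> QQ'; rewrite {1}/Ind; case: asboolP => [/QQ' q|_]; last exact: indic_ge0.
by rewrite indic_T.
Qed.

Lemma indic_and Q Q' : Ind R (Q /\ Q') = Ind R Q * Ind R Q'.
Proof. by rewrite /Ind asbool_and -natrM mulnb. Qed.

Lemma indic_or (Q Q' : Prop) : Ind R (Q \/ Q') <= Ind R Q + Ind R Q'.
Proof.
rewrite {1}/Ind; case: asboolP => [[q|q]|_]; last by rewrite addr_ge0 ?indic_ge0.
- by rewrite (indic_T q) lerDl indic_ge0.
- by rewrite (indic_T q) lerDr indic_ge0.
Qed.

Lemma indic_not Q : Ind R (~ Q) = 1 - Ind R Q.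
Proof. by rewrite /Ind asbool_neg; case: asboolP => _ /=; rewrite ?subrr ?subr0. Qed.

Lemma eq_indic (Q Q' : Prop) : (Q <-> Q') -> Ind R Q = Ind R Q'.
Proof. by move=> /propext ->. Qed.

Definition increasing (Q : cfg -> Prop) :=
  forall w w' : cfg, (forall v, w v -> w' v) -> Q w -> Q w'.

Lemma antitone_indic Q : increasing Q -> antitone (fun w => Ind R (~ Q w)).
Proof. by move=> iQ w w' ww'; apply: indic_mono => nQ /(iQ _ _ ww'). Qed.

(** The square root trick for failure probabilities: if [n] increasing events cover a likely event,
    they cannot all have a large failure probability. *)
Lemma harris_prod n (Q : nat -> cfg -> Prop) s w : (forall i, increasing (Q i)) ->
  \prod_(i < n) Ex s (fun w => Ind R (~ Q i w)) w <=
  Ex s (fun w => Ind R (forall i, (i < n)%N -> ~ Q i w)) w.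
Proof.
move=> iQ; elim: n => [|n IH].
  rewrite big_ord0 -(Ex_cst s 1 w); apply: ler_Ex => w'; by rewrite indic_T.
rewrite big_ord_recr /=.
apply: (@le_trans _ _ (Ex s (fun w => Ind R (forall i, (i < n)%N -> ~ Q i w)) w * Ex s (fun w => Ind R (~ Q n w)) w)).
  by apply: ler_wpM2r => //; apply: Ex_ge0 => w'; exact: indic_ge0.
apply: (le_trans (harris _ _ _ _)).
- move=> u u' uu'; apply: indic_mono => h i il Qi; exact: (h i il (iQ i _ _ uu' Qi)).
- exact: antitone_indic.
apply: ler_Ex => w'; rewrite -indic_and; apply: indic_mono => -[h hn] i.
by rewrite ltnS leq_eqVlt => /orP[/eqP ->|/h].
Qed.

(* The values of the sites in [X w] are known to depend only on themselves (a
   stopping set): conditionally on them, the other sites are fresh. *)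
Lemma Ex_stop (X : cfg -> pred vertex) s f w d :
  uniq s -> 0 <= d ->
  (forall u u', agree (X u) u u' -> X u' = X u) ->
  (forall u, Ex [seq v <- s | ~~ X u v] f u <= d) ->
  Ex s f w <= d.
Proof.
move=> us d0 stop H.
(* The space is split according to the set of revealed sites of [s]; [subs] lists its possible
   values, as subsequences given by bit masks. *)
pose part (t : seq vertex) (u : cfg) : R := ([seq v <- s | X u v] == t)%:R.
pose subs : seq (seq vertex) := undup [seq mask (val m) s | m : (size s).-tuple bool].
have part1 u : \sum_(t <- subs) part t u = 1.
  have : [seq v <- s | X u v] \in subs.
    rewrite mem_undup; apply/mapP.
    have sz : size (map (X u) s) == size s by rewrite size_map.
    exists (Tuple sz); rewrite ?mem_enum //=.
    by rewrite filter_mask.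
  move=> tin; rewrite (bigD1_seq _ tin) ?undup_uniq //= /part eqxx.
  by rewrite big1 ?addr0 // => t; rewrite eq_sym => /negbTE ->.
rewrite (@eq_Ex _ _ (fun u => \sum_(t <- subs) part t u * f u)); last first.
  by move=> u _; rewrite -mulr_suml part1 mul1r.
rewrite Ex_sum -[leRHS]mulr1.
have -> : d * 1 = \sum_(t <- subs) d * Ex s (part t) w.
  by rewrite -mulr_sumr -Ex_sum; congr (_ * _); rewrite -[LHS](Ex_cst s 1 w); apply: eq_Ex => u _; rewrite part1.
apply: ler_sum => t _.
rewrite -ExZ.
rewrite !(Ex_perm _ _ (filter_perm (mem t) s)) !Ex_cat; apply: ler_Ex => u.
(* By the stopping property, resampling the sites outside [t] cannot change whether [t] is the
   revealed set. *)
have key u' : agree (fun v => v \notin [seq x <- s | ~~ mem t x]) u u' -> part t u' = part t u.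
  move=> uu'; rewrite /part; congr (nat_of_bool _)%:R.
  have aux a b : (forall v, v \notin [seq x <- s | ~~ mem t x] -> a v = b v) ->
     [seq v <- s | X a v] == t -> [seq v <- s | X b v] == t.
    move=> ab /eqP e; suff -> : X b = X a by rewrite e.
    apply: stop => v Xv; apply: ab; rewrite mem_filter /= negb_and negbK.
    by case vs: (v \in s); rewrite ?orbT //= -e mem_filter Xv vs.
  by apply/idP/idP; apply: aux => v hv; rewrite ?uu'.
rewrite (@eq_Ex _ _ (fun u' => part t u * f u')); last by move=> u' /key ->.
rewrite [leRHS](@eq_Ex _ _ (fun u' => d * part t u)); last by move=> u' /key ->.
rewrite ExZ Ex_cst [leRHS]mulrC /part; case: eqP => [e|_]; last by rewrite !mul0r.
rewrite !mul1r; apply: le_trans (H u); rewrite le_eqVlt; apply/orP; left; apply/eqP.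
congr (Ex _ f u); apply: eq_in_filter => v vs /=.
by rewrite -e mem_filter vs andbT.
Qed.

End Expectation.

(** * Crossing paths in the plane *)

Notation column := (int * int)%type.

(* The steps of the projection of a slab path. *)
Definition ladj (c d : column) : bool :=
  ((c.1 == d.1) && ((c.2 == d.2) || (c.2 == d.2 + 1) || (d.2 == c.2 + 1))) ||
  ((c.2 == d.2) && ((c.1 == d.1 + 1) || (d.1 == c.1 + 1))).

(** The step runs along an edge of abscissa at most [i] between the rows [j] and [j + 1]. Thus
    [vcount] is the parity of the intersections of the path with the horizontal ray going left from
    the face (i, j). *)
Definition vstep (i j : int) (c d : column) : bool :=
  [&& c.1 == d.1, c.1 <= i & ((c.2 == j) && (d.2 == j + 1)) || ((d.2 == j) && (c.2 == j + 1))].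

Fixpoint vcount (i j : int) (c : column) (s : seq column) : bool :=
  if s is d :: s' then vstep i j c d (+) vcount i j d s' else false.

Definition halfrow (i j : int) (c : column) : bool := (c.2 == j) && (c.1 <= i).

Definition is_hedge (i j : int) (c d : column) : bool :=
  [&& c.2 == j, d.2 == j & ((c.1 == i) && (d.1 == i + 1)) || ((d.1 == i) && (c.1 == i + 1))].

Definition is_vedge (i j : int) (c d : column) : bool :=
  [&& c.1 == i, d.1 == i & ((c.2 == j) && (d.2 == j + 1)) || ((d.2 == j) && (c.2 == j + 1))].

Fixpoint avoids (e : column -> column -> bool) (c : column) (s : seq column) : bool :=
  if s is d :: s' then ~~ e c d && avoids e d s' else true.

Lemma ladjP c d : ladj c d ->
  d = c \/ d = (c.1, c.2 + 1) \/ d = (c.1, c.2 - 1) \/ d = (c.1 + 1, c.2) \/ d = (c.1 - 1, c.2).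
Proof.
case: c d => [c1 c2] [d1 d2]; rewrite /ladj /=.
move=> /orP[/andP[/eqP -> /orP[/orP[/eqP->|/eqP->]|/eqP->]]|/andP[/eqP -> /orP[/eqP ->|/eqP ->]]];
  rewrite ?addrK; tauto.
Qed.

(** The half row of ordinate [j] up to abscissa [i] can be entered or left only from the row below,
    from the row above, or through the edge at its end, which is excluded. *)
Lemma vstep_vert (i j : int) (c d : column) : ladj c d -> ~~ is_hedge i j c d ->
  vstep i (j - 1) c d (+) vstep i j c d = halfrow i j c (+) halfrow i j d.
Proof.
move=> /ladjP; case: c => [x y] /=; rewrite /is_hedge /vstep /halfrow.
have sx : (x == x + 1) = false by lia.
have px : (x == x - 1) = false by lia.
move=> [->|[->|[->|[->|->]]]] /=; rewrite ?sx ?px ?eqxx /=.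
- have no (a b : int) : (a == b) && (a == b + 1) = false by case: eqP => //= ->; lia.
  by rewrite !no !addbb !andbF.
- have up (a : int) : ((y == a) && (y + 1 == a + 1)) || ((y + 1 == a) && (y == a + 1)) = (y == a).
    by have [->|ya] := eqVneq y a; rewrite ?eqxx //=; case: eqP => //= <-; lia.
  rewrite !up; have -> : (y + 1 == j) = (y == j - 1) by lia.
  by case: (x <= i); rewrite ?andbF // !andbT addbC.
- have down (a : int) : ((y == a) && (y - 1 == a + 1)) || ((y - 1 == a) && (y == a + 1)) = (y == a + 1).
    by have [->|ya] := eqVneq y (a + 1); rewrite ?addrK ?eqxx ?andbT ?orbT ?andbF ?orbF //=; case: eqP => //= ->; lia.
  rewrite !down subrK; have -> : (y - 1 == j) = (y == j + 1) by lia.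
  by case: (x <= i); rewrite ?andbF // !andbT.
- by case: (y == j) => //=; lia.
- by case: (y == j) => //=; lia.
Qed.

Lemma vcount_vert (i j : int) (c : column) (s : seq column) : path ladj c s -> avoids (is_hedge i j) c s ->
  vcount i (j - 1) c s (+) vcount i j c s = halfrow i j c (+) halfrow i j (last c s).
Proof.
elim: s c => [|d s IH] c /=; first by rewrite addbb.
move=> /andP[cd ds] /andP[ncd nds].
rewrite addbACA (vstep_vert cd ncd) (IH _ ds nds).
by rewrite -addbA addKb.
Qed.

(** The two rays differ only by the edge from (i, j) to (i, j + 1), which the path does not use. *)
Lemma vcount_hor (i j : int) (c : column) (s : seq column) : avoids (is_vedge i j) c s ->
  vcount (i - 1) j c s = vcount i j c s.
Proof.
elim: s c => [//|d s IH] c /= /andP[ncd nds]; rewrite (IH _ nds); congr (_ (+) _).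
case: c d ncd {nds} => [x y] [x' y']; rewrite /is_vedge /vstep /=.
move: (_ || _) => e; case: (x =P x') => [<-|] //=.
case: e; rewrite ?andbF ?andbT // => ne; apply/idP/idP; lia.
Qed.

Lemma vcount_left (i j : int) (c : column) (s : seq column) : all (fun d : column => i < d.1) (c :: s) -> vcount i j c s = false.
Proof.
elim: s c => [//|d s IH] c /= /andP[ci ds]; rewrite IH // addbF /vstep; case: c d {ds} ci => [? ?] [? ?] /=; lia.
Qed.

(** Every passage between the rows [j] and [j + 1] is counted, so the parity tells whether the two
    ends lie on different sides of this level. *)
Lemma vcount_right (i j : int) (c : column) (s : seq column) : path ladj c s -> all (fun d : column => d.1 <= i) (c :: s) ->
  vcount i j c s = (c.2 <= j) (+) ((last c s).2 <= j).
Proof.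
elim: s c => [|d s IH] c /=; first by rewrite addbb.
move=> /andP[cd ds] /andP[ci Hs]; rewrite IH // addbA; congr (_ (+) _).
move: (ladjP cd) ci; case: c {cd} => [x y]; rewrite /vstep /=.
by move=> [->|[->|[->|[->|->]]]] /=; lia.
Qed.

Lemma avoids_notin (e : column -> column -> bool) c s (u : column) :
  (forall a b, e a b -> (a == u) || (b == u)) -> u \notin c :: s -> avoids e c s.
Proof.
move=> eu; elim: s c => //= d s IH c; rewrite !in_cons !negb_or => /and3P[uc ud us].
rewrite IH ?in_cons ?negb_or ?ud // andbT; apply/negP => /eu.
by rewrite eq_sym (negbTE uc) eq_sym (negbTE ud).
Qed.

Definition side (b0 : column) (b : seq column) (c : column) : bool :=
  vcount (c.1 - 1) c.2 b0 b.

Lemma side_hor (b0 : column) (b : seq column) (x y : int) : (x, y) \notin b0 :: b -> side b0 b (x, y) = side b0 b (x + 1, y).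
Proof.
move=> nc; rewrite /side /= addrK; apply: vcount_hor; apply: avoids_notin nc.
by move=> [p1 p2] [q1 q2]; rewrite /is_vedge !xpair_eqE /=; lia.
Qed.

Lemma side_vert (b0 : column) (b : seq column) (x y : int) : path ladj b0 b -> (x, y + 1) \notin b0 :: b ->
  b0.2 <= y -> y + 1 < (last b0 b).2 -> side b0 b (x, y) = side b0 b (x, y + 1).
Proof.
move=> pb nd b0y bly; rewrite /side /=.
have av : avoids (is_hedge (x - 1) (y + 1)) b0 b.
  apply: avoids_notin nd => -[p1 p2] [q1 q2].
  by rewrite /is_hedge !xpair_eqE /=; lia.
have := vcount_vert pb av; rewrite addrK /halfrow.
have -> : (b0.2 == y + 1) = false by lia.
have -> : ((last b0 b).2 == y + 1) = false by lia.
by case: vcount; case: vcount.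
Qed.

Lemma side_step (b0 : column) (b : seq column) (c d : column) : path ladj b0 b -> ladj c d -> c \notin b0 :: b -> d \notin b0 :: b ->
  b0.2 <= c.2 -> b0.2 <= d.2 -> c.2 < (last b0 b).2 -> d.2 < (last b0 b).2 ->
  side b0 b c = side b0 b d.
Proof.
move=> pb /ladjP; case: c => x y /= [->|[->|[->|[->|->]]]] //= nc nd h1 h2 h3 h4.
- exact: side_vert.
- by rewrite -[in LHS](subrK 1 y); apply/esym/side_vert; rewrite ?subrK.
- exact: side_hor.
- by rewrite -[in LHS](subrK 1 x); apply/esym/side_hor; rewrite ?subrK.
Qed.

(* The number of edges of [b] to the left of [c], just above the row of [c], has
   constant parity when [c] moves off [b]. *)
Lemma planar_crossing (a0 : column) (a : seq column) (b0 : column) (b : seq column) (x1 x2 y1 y2 : int) :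
  path ladj a0 a -> path ladj b0 b ->
  all (fun c : column => y1 <= c.2 <= y2) (a0 :: a) -> a0.1 <= x1 -> x2 <= (last a0 a).1 ->
  all (fun c : column => x1 <= c.1 <= x2) (b0 :: b) -> b0.2 <= y1 -> y2 < (last b0 b).2 ->
  exists2 c, c \in a0 :: a & c \in b0 :: b.
Proof.
move=> pa pb /allP ya a0x alx xb b0y bly.
apply: contrapT => nocom.
have ab c : c \in a0 :: a -> c \notin b0 :: b by move=> ca; apply/negP => cb; apply: nocom; exists c.
have cst c s : path ladj c s -> {subset c :: s <= a0 :: a} -> side b0 b c = side b0 b (last c s).
  elim: s c => [//|d s IH] c /= /andP[cd pd] sub.
  have sub' : {subset d :: s <= a0 :: a} by move=> z zs; apply: sub; rewrite in_cons zs orbT.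
  rewrite -(IH d pd sub').
  have [ca da] : c \in a0 :: a /\ d \in a0 :: a by split; [apply: sub|apply: sub']; exact: mem_head.
  apply: side_step => //; try exact: ab.
  - by have := ya _ ca; clear - b0y; lia.
  - by have := ya _ da; clear - b0y; lia.
  - by have := ya _ ca; clear - bly; lia.
  - by have := ya _ da; clear - bly; lia.
(* At the start of [a] all of [b] lies to the right and the parity is even. At the end of [a] all of
   [b] lies to the left, with one end below and the other above, and the parity is odd. *)
have := cst _ _ pa (fun=> id); rewrite /side vcount_left; last first.
  by apply: sub_all xb => c; clear - a0x; lia.
have yl : y1 <= (last a0 a).2 <= y2 by apply: ya; exact: mem_last.
set l := last a0 a in alx yl *; set bl := last b0 b in bly *.
have -> : vcount (l.1 - 1) l.2 b0 b = vcount l.1 l.2 b0 b.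
  apply: vcount_hor; apply: avoids_notin (ab l (mem_last _ _)).
  by clear; case: l => i j [p1 p2] [q1 q2]; rewrite /is_vedge !xpair_eqE /=; lia.
rewrite vcount_right //; last by apply: sub_all xb => c; clear - alx; lia.
have -> : b0.2 <= l.2 by case/andP: yl => yl _; exact: le_trans yl.
suff -> : ((last b0 b).2 <= l.2) = false by [].
by apply/negbTE; rewrite -ltNge; case/andP: yl => _ yl; exact: le_lt_trans yl bly.
Qed.

(** * Connections and crossings in the slab *)

Lemma adjE (u v : vertex) :
  adj u v = (u.1 == v.1) && (u.2 != v.2) || (u.2 == v.2) && ladj u.1 v.1 && (u.1 != v.1).
Proof.
case: u v => [[x y] b] [[x' y'] b']; rewrite /adj /l1dist /ladj !xpair_eqE /=.
by case: b; case: b' => /=; rewrite ?subrr ?andbF ?orbF ?andbT ?orFb /=; lia.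
Qed.

Lemma adj_sym : symmetric adj.
Proof. by move=> u v; rewrite /adj /l1dist; congr (_ == _); lia. Qed.

Lemma adj_ladj u v : adj u v -> ladj u.1 v.1.
Proof.
rewrite adjE => /orP[/andP[/eqP -> _]|/andP[/andP[]]//].
by rewrite /ladj !eqxx.
Qed.

Lemma adj_col (c : column) b b' : b != b' -> adj (c, b) (c, b').
Proof. by move=> bb'; rewrite adjE /= eqxx bb'. Qed.

Lemma adj_hor (c d : column) b : ladj c d -> c != d -> adj (c, b) (d, b).
Proof. by move=> h n; rewrite adjE /= h n eqxx orbT. Qed.

Lemma ladj_sym : symmetric ladj.
Proof. by move=> [a b] [c d]; rewrite /ladj /=; lia. Qed.

Lemma path_ladj v s : path adj v s -> path ladj v.1 (map fst s).
Proof. by elim: s v => //= u s IH v /andP[/adj_ladj -> /IH]. Qed.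

Section Connected.
Implicit Types (B C : pred vertex) (w : cfg) (u v : vertex).

Lemma cin_refl B w v : w v -> B v -> connected_in B w v v.
Proof. by move=> wv Bv; exists [::]; rewrite /= wv Bv. Qed.

Lemma cin_ends B w u v : connected_in B w u v -> [/\ w u, B u, w v & B v].
Proof.
case=> s [_ <- ws Bs]; split.
- by case/andP: ws.
- by case/andP: Bs.
- exact: (allP ws) (mem_last _ _).
- exact: (allP Bs) (mem_last _ _).
Qed.

Lemma cin_trans B w v u u' : connected_in B w u v -> connected_in B w v u' -> connected_in B w u u'.
Proof.
move=> [s [ps ls ws Bs]] [t [pt lt wt Bt]]; exists (s ++ t).
move: wt Bt; rewrite /= => /andP[_ wt] /andP[_ Bt].
by rewrite cat_path last_cat ls ps pt lt !all_cat !andbA; split=> //; rewrite ?wt ?Bt andbT.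
Qed.

Lemma cin_edge B w u v : adj u v -> w u -> w v -> B u -> B v -> connected_in B w u v.
Proof. by move=> a wu wv Bu Bv; exists [:: v]; rewrite /= a wu wv Bu Bv. Qed.

Lemma cin_sym B w u v : connected_in B w u v -> connected_in B w v u.
Proof.
case=> s; elim: s u => [|x s IH] u [] /=.
  by move=> _ -> wu Bu; apply: cin_refl; [case/andP: wu|case/andP: Bu].
move=> /andP[ux ps] ls /and3P[wu wx ws] /and3P[Bu Bx Bs].
apply: cin_trans (IH x _) _; first by split=> //; rewrite /= ?wx ?Bx.
by apply: cin_edge => //; rewrite adj_sym.
Qed.

Lemma cin_mono B C w w' u v : (forall x, B x -> C x) -> (forall x, B x -> w x -> w' x) ->
  connected_in B w u v -> connected_in C w' u v.
Proof.
move=> BC ww' [s [ps ls ws Bs]]; exists s; split=> //; last exact: sub_all BC _ Bs.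
by apply/allP => x xs; apply: ww'; [exact: (allP Bs)|exact: (allP ws)].
Qed.

Lemma cin_col B w u v : u.1 = v.1 -> w u -> w v -> B u -> B v -> connected_in B w u v.
Proof.
case: u v => [c b] [c' b'] /= <- wu wv Bu Bv.
have [E|n] := eqVneq b b'; first by rewrite -E; exact: cin_refl.
by apply: cin_edge => //; exact: adj_col.
Qed.

Lemma cin_mem B w u s x : path adj u s -> all w (u :: s) -> all B (u :: s) -> x \in u :: s ->
  connected_in B w u x.
Proof.
elim: s u => [|y s IH] u /=; first by rewrite !andbT inE => _ wu Bu /eqP ->; exact: cin_refl.
move=> /andP[uy ps] /and3P[wu wy ws] /and3P[Bu By Bs]; rewrite inE => /orP[/eqP->|xs].
  exact: cin_refl.
apply: cin_trans (cin_edge uy wu wy Bu By) (IH y ps _ _ xs); by rewrite /= ?wy ?By.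
Qed.

Lemma cin_map (h : vertex -> vertex) B C w u v : {homo h : x y / adj x y} ->
  (forall x, B x -> C (h x)) -> connected_in B (w \o h) u v -> connected_in C w (h u) (h v).
Proof.
move=> ha BC [s [ps ls ws Bs]]; exists (map h s); split.
- by apply: homo_path ps.
- by rewrite last_map ls.
- by rewrite -map_cons all_map.
- by rewrite -map_cons all_map; apply: sub_all Bs.
Qed.

End Connected.

Definition rect (a b c d : int) : pred vertex :=
  fun v => (a <= v.1.1 <= b) && (c <= v.1.2 <= d).

Definition hcross (a b c d : int) (w : cfg) : Prop :=
  exists v v', [/\ v.1.1 = a, v'.1.1 = b & connected_in (rect a b c d) w v v'].

Definition vcross (a b c d : int) (w : cfg) : Prop :=
  exists v v', [/\ v.1.2 = c, v'.1.2 = d & connected_in (rect a b c d) w v v'].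

Lemma crossing_glue (B B' C : pred vertex) (w : cfg) (u u' v v' : vertex) (x1 x2 y1 y2 : int) :
  connected_in B w u u' -> connected_in B' w v v' ->
  (forall x, B x -> C x) -> (forall x, B' x -> C x) ->
  (forall x, B x -> y1 <= x.1.2 <= y2) -> u.1.1 <= x1 -> x2 <= u'.1.1 ->
  (forall x, B' x -> x1 <= x.1.1 <= x2) -> v.1.2 <= y1 -> y2 <= v'.1.2 ->
  connected_in C w u v.
Proof.
move=> [s [ps ls ws Bs]] [t [pt lt wt Bt]] BC B'C By ux u'x B'x vy v'y.
(* [planar_crossing] wants the vertical path to end strictly above the horizontal one. The extra
   column on top achieves this and is too high to be the meeting point. *)
pose top : column := (v'.1.1, v'.1.2 + 1).
have [||||||||c] := @planar_crossing u.1 (map fst s) v.1 (rcons (map fst t) top) x1 x2 y1 y2.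
- exact: path_ladj.
- by rewrite rcons_path path_ladj // last_map lt /= /ladj /top /= !eqxx orbT.
- by rewrite -map_cons all_map; apply: sub_all Bs.
- by [].
- by rewrite last_map ls.
- rewrite -rcons_cons all_rcons -map_cons all_map; apply/andP; split; last by apply: sub_all Bt.
  by rewrite /top /=; apply: B'x; rewrite -lt; exact: (allP Bt) (mem_last _ _).
- by [].
- by rewrite last_rcons /top /= ltzD1.
rewrite -map_cons => /mapP[x xs ->{c}].
rewrite -rcons_cons mem_rcons inE -map_cons => /orP[/eqP xt|/mapP[x' x't xx']].
  have := By x (allP Bs _ xs); rewrite xt /top /= => /andP[_ h].
  by have := le_trans h v'y; rewrite leNgt ltzD1 lexx.
have ux' := cin_mono BC (fun _ _ h => h) (cin_mem ps ws Bs xs).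
have vx' := cin_mono B'C (fun _ _ h => h) (cin_mem pt wt Bt x't).
apply: (cin_trans ux'); apply: (cin_trans _ (cin_sym vx')).
have [_ _ ? ?] := cin_ends ux'; have [_ _ ? ?] := cin_ends vx'.
exact: cin_col.
Qed.

Lemma adj_x (u v : vertex) : adj u v -> v.1.1 <= u.1.1 + 1 /\ u.1.1 - 1 <= v.1.1.
Proof. move=> /adj_ladj /ladjP; move: u.1 v.1 => [x y] [x' y'] /=.
by move=> [[-> _]|[[-> _]|[[-> _]|[[-> _]|[-> _]]]]]; lia. Qed.

Lemma sub_hcross_prefix (B : pred vertex) (w : cfg) (v : vertex) (s : seq vertex) (a b c d : int) :
  (forall x, B x -> c <= x.1.2 <= d) -> a <= v.1.1 <= b ->
  path adj v s -> all w (v :: s) -> all B (v :: s) -> all (fun x : vertex => a <= x.1.1) s ->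
  b <= (last v s).1.1 -> exists2 v' : vertex, v'.1.1 = b & connected_in (rect a b c d) w v v'.
Proof.
move=> By; elim: s v => [|u s IH] v vb /=.
  rewrite !andbT => _ wv Bv _ h; exists v; first by apply/eqP; rewrite eq_le h; case/andP: vb => _ ->.
  by apply: cin_refl => //; rewrite /rect vb By.
move=> /andP[vu ps] /andP[wv ws] /andP[Bv Bs] /andP[au as'] h.
have rv : rect a b c d v by rewrite /rect vb By.
have [e|n] := eqVneq v.1.1 b; first by exists v => //; exact: cin_refl.
have ub : a <= u.1.1 <= b by have [] := adj_x vu; clear - au n vb; lia.
have [v' e r] := IH u ub ps ws Bs as' h; exists v' => //.
have [wu ru _ _] := cin_ends r.
exact: cin_trans (cin_edge vu wv wu rv ru) r.
Qed.

(** The crossing runs from the last vertex of abscissa at most [a], which has abscissa [a] because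
    steps change it by at most one, to the next visit of abscissa [b]. *)
Lemma sub_hcross (B : pred vertex) (w : cfg) (v v' : vertex) (a b c d : int) :
  connected_in B w v v' -> (forall x, B x -> c <= x.1.2 <= d) ->
  v.1.1 <= a -> b <= v'.1.1 -> a <= b -> hcross a b c d w.
Proof.
move=> [s [ps ls ws Bs]] By va v'b ab.
rewrite -ls in v'b.
have : has (fun x : vertex => x.1.1 <= a) (v :: s) by rewrite /= va.
elim: s v {va ls} ps ws Bs v'b => [|u s IH] v ps ws Bs v'b.
  rewrite /= orbF => va.
  have e : v.1.1 = a by apply/eqP; rewrite eq_le va (le_trans ab v'b).
  have vb : a <= v.1.1 <= b by rewrite e lexx.
  by have [r rb h] := sub_hcross_prefix By vb ps ws Bs isT v'b; exists v, r.
case: (boolP (has (fun x : vertex => x.1.1 <= a) (u :: s))) => [hu _|hu].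
  by case/andP: ps => _ ps; case/andP: ws => _ ws; case/andP: Bs => _ Bs; exact: (IH u).
move=> /orP[va|hu']; last by rewrite -/(has _ (u :: s)) in hu'; rewrite hu' in hu.
have au : all (fun x : vertex => a < x.1.1) (u :: s).
  by apply/allP => x xs; rewrite ltNge; apply: contra hu => h; apply/hasP; exists x.
have e : v.1.1 = a.
  case/andP: (ps) => /adj_x[h _] _; case/andP: au => au _; clear - va h au; lia.
have vb : a <= v.1.1 <= b by rewrite e lexx.
have au' : all (fun x : vertex => a <= x.1.1) (u :: s) by apply: sub_all au => x /ltW.
by have [r rb h] := sub_hcross_prefix By vb ps ws Bs au' v'b; exists v, r.
Qed.

(** * Symmetries, monotonicity and locality of crossings *)

Definition swapv (v : vertex) : vertex := (v.1.2, v.1.1, v.2).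

Definition shiftv (t : column) (v : vertex) : vertex := (v.1.1 + t.1, v.1.2 + t.2, v.2).

Definition flipx (t : int) (v : vertex) : vertex := (t - v.1.1, v.1.2, v.2).

Definition flipy (t : int) (v : vertex) : vertex := (v.1.1, t - v.1.2, v.2).

Lemma swapvK : involutive swapv. Proof. by case=> [[]]. Qed.
Lemma shiftvK t : cancel (shiftv t) (shiftv (- t.1, - t.2)).
Proof. by case=> [[x y] b]; rewrite /shiftv /= !addrK. Qed.
Lemma shiftvKV t : cancel (shiftv (- t.1, - t.2)) (shiftv t).
Proof. by case=> [[x y] b]; rewrite /shiftv /= !subrK. Qed.
Lemma flipxK t : involutive (flipx t).
Proof. by case=> [[x y] b]; rewrite /flipx /= !subKr. Qed.
Lemma flipyK t : involutive (flipy t).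
Proof. by case=> [[x y] b]; rewrite /flipy /= !subKr. Qed.

Lemma adj_swapv : {homo swapv : x y / adj x y}.
Proof. by move=> u v; rewrite /adj /l1dist /= => /eqP <-; apply/eqP; lia. Qed.
Lemma adj_shiftv t : {homo shiftv t : x y / adj x y}.
Proof. by move=> u v; rewrite /adj /l1dist /= => /eqP <-; apply/eqP; lia. Qed.
Lemma adj_flipx t : {homo flipx t : x y / adj x y}.
Proof. by move=> u v; rewrite /adj /l1dist /= => /eqP <-; apply/eqP; lia. Qed.
Lemma adj_flipy t : {homo flipy t : x y / adj x y}.
Proof. by move=> u v; rewrite /adj /l1dist /= => /eqP <-; apply/eqP; lia. Qed.

Lemma hcross_swap a b c d w : hcross a b c d (w \o swapv) <-> vcross c d a b w.
Proof.
split=> -[v [v' [va vb h]]]; exists (swapv v), (swapv v'); split=> //.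
  by apply: cin_map h; [exact: adj_swapv|move=> x; rewrite /rect /= andbC].
apply: (@cin_map swapv (rect c d a b)); [exact: adj_swapv|by move=> x; rewrite /rect /= andbC|].
by congr (connected_in _ _ _ _): h; apply/funext => x /=; rewrite swapvK.
Qed.

Lemma hcross_shift a b c d t w :
  hcross a b c d (w \o shiftv t) <-> hcross (a + t.1) (b + t.1) (c + t.2) (d + t.2) w.
Proof.
split=> -[v [v' [va vb h]]].
  exists (shiftv t v), (shiftv t v'); split; rewrite /= ?va ?vb //.
  by apply: cin_map h; [exact: adj_shiftv|move=> x; rewrite /rect /= !lerD2r].
exists (shiftv (- t.1, - t.2) v), (shiftv (- t.1, - t.2) v'); split; rewrite /= ?va ?vb ?addrK //.
apply: (@cin_map _ (rect (a + t.1) (b + t.1) (c + t.2) (d + t.2))); [exact: adj_shiftv| |].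
  by move=> x; rewrite /rect /= !lerBrDr !lerBlDr.
by congr (connected_in _ _ _ _): h; apply/funext => x /=; rewrite shiftvKV.
Qed.

Lemma increasing_cin B u v : increasing (fun w => connected_in B w u v).
Proof. by move=> w w' ww'; apply: cin_mono => // x _; exact: ww'. Qed.

Lemma increasing_hcross a b c d : increasing (hcross a b c d).
Proof.
by move=> w w' ww' [v [v' [va vb h]]]; exists v, v'; split=> //; exact: increasing_cin ww' h.
Qed.

Lemma increasing_vcross a b c d : increasing (vcross a b c d).
Proof.
by move=> w w' ww' [v [v' [va vb h]]]; exists v, v'; split=> //; exact: increasing_cin ww' h.
Qed.

Lemma agree_sym X w w' : agree X w w' -> agree X w' w.
Proof. by move=> h v Xv; rewrite h. Qed.

Lemma depends_Prop (X : pred vertex) (Q : cfg -> Prop) :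
  (forall w w', agree X w w' -> Q w -> Q w') -> depends_on X Q.
Proof. by move=> h w w' ww'; apply/propext; split; apply: h => //; exact: agree_sym. Qed.

Lemma depends_indic (R : nzRingType) (X : pred vertex) (Q : cfg -> Prop) :
  depends_on X Q -> depends_on X (fun w => Ind R (~ Q w)).
Proof. by move=> h w w' /h ->. Qed.

Lemma depends_cin B u v : depends_on B (fun w => connected_in B w u v).
Proof. by apply: depends_Prop => w w' ww'; apply: cin_mono => // x /ww' ->. Qed.

Lemma depends_hcross a b c d : depends_on (rect a b c d) (hcross a b c d).
Proof.
apply: depends_Prop => w w' ww' [v [v' [va vb h]]]; exists v, v'; split=> //.
by rewrite -(depends_cin _ _ ww').
Qed.

Lemma depends_vcross a b c d : depends_on (rect a b c d) (vcross a b c d).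
Proof.
apply: depends_Prop => w w' ww' [v [v' [va vb h]]]; exists v, v'; split=> //.
by rewrite -(depends_cin _ _ ww').
Qed.

(** * Inequalities between crossing probabilities *)

Definition columns (a c : int) (l m : nat) : seq column :=
  [seq (a + i%:Z, c + j%:Z) | i <- iota 0 l.+1, j <- iota 0 m.+1].

Definition sites (a c : int) (l m : nat) : seq vertex :=
  [seq (z, b) | z <- columns a c l m, b <- [:: false; true]].

Lemma mem_columns a c l m (z : column) :
  (z \in columns a c l m) = (a <= z.1 <= a + l%:Z) && (c <= z.2 <= c + m%:Z).
Proof.
apply/allpairsP/idP => [[[i j] [+ + ->]]|].
  by rewrite !mem_iota /=; lia.
case: z => x y /= h.
have h1 : `|x - a|%N \in iota 0 l.+1 by rewrite mem_iota; lia.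
have h2 : `|y - c|%N \in iota 0 m.+1 by rewrite mem_iota; lia.
exists (`|x - a|%N, `|y - c|%N); split=> //=.
by congr (_, _); lia.
Qed.

Lemma uniq_columns a c l m : uniq (columns a c l m).
Proof.
apply: allpairs_uniq; rewrite ?iota_uniq //.
by move=> [i j] [i' j'] _ _ /= [] h1 h2; congr (_, _); lia.
Qed.

Lemma mem_sites a c l m v : (v \in sites a c l m) = rect a (a + l%:Z) c (c + m%:Z) v.
Proof.
rewrite /rect -mem_columns; apply/allpairsP/idP => [[[z b] [zc _ ->]]|vc] //.
by exists v; split=> //; [case: (v.2)|case: v {vc}].
Qed.

Lemma uniq_sites a c l m : uniq (sites a c l m).
Proof.
by apply: allpairs_uniq => //; [exact: uniq_columns|move=> [z b] [z' b'] _ _ /= [-> ->]].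
Qed.

Section Fail.
Variables (R : realType) (p : R).
Hypothesis p01 : 0 <= p <= 1.

(** Failure probabilities are convenient: they add under intersections of events and multiply under
    independent or positively correlated unions. For events determined by [s] the base configuration
    is immaterial. *)
Definition fail (s : seq vertex) (Q : cfg -> Prop) : R :=
  Ex p s (fun w => Ind R (~ Q w)) (fun=> false).

Definition fH (l m : nat) : R := fail (sites 0 0 l m) (hcross 0 l%:Z 0 m%:Z).

Lemma fail_ge0 s Q : 0 <= fail s Q.
Proof. by apply: Ex_ge0 => // w; exact: indic_ge0. Qed.

Lemma fH_ge0 l m : 0 <= fH l m. Proof. exact: fail_ge0. Qed.

Lemma fail_mono s (Q Q' : cfg -> Prop) : (forall w, Q w -> Q' w) -> fail s Q' <= fail s Q.
Proof. by move=> QQ'; apply: ler_Ex => // w; apply: indic_mono => nQ /QQ'. Qed.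

Lemma fail_and s Q Q' : fail s (fun w => Q w /\ Q' w) <= fail s Q + fail s Q'.
Proof.
rewrite -ExD; apply: ler_Ex => // w; apply: le_trans (indic_or _ _ _); apply: indic_mono.
by move/not_andP.
Qed.

Lemma fail_or s Q Q' : increasing Q -> increasing Q' ->
  fail s Q * fail s Q' <= fail s (fun w => Q w \/ Q' w).
Proof.
move=> iQ iQ'; apply: le_trans (harris p01 _ _ (antitone_indic R iQ) (antitone_indic R iQ')) _.
by apply: ler_Ex => // w; rewrite -indic_and; apply: indic_mono => -[h h'] [].
Qed.

Lemma fail_dep X s t Q : depends_on X Q -> uniq s -> uniq t ->
  (forall v, X v -> v \in s) -> (forall v, X v -> v \in t) -> fail s Q = fail t Q.
Proof. by move=> QX us ut Xs Xt; exact: (Ex_dep p _ _ (depends_indic R QX) us ut Xs Xt). Qed.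

Lemma fail_sym X (h h' : vertex -> vertex) s t Q Q' : cancel h h' -> cancel h' h ->
  depends_on X Q -> uniq s -> uniq t ->
  (forall v, X v -> v \in s) -> (forall v, X (h v) -> v \in t) ->
  (forall w, Q (w \o h') <-> Q' w) -> fail s Q = fail t Q'.
Proof.
move=> hK h'K QX us ut Xs Xt QQ'.
rewrite /fail (Ex_sym p (fun=> false) (fun=> false) hK h'K (depends_indic R QX) us ut Xs Xt).
by congr Ex; apply/funext => w; apply: eq_indic; split=> n q; apply: n; apply/QQ'.
Qed.

Lemma fail_hcross s (a b c d : int) (l m : nat) : uniq s -> b = a + l%:Z -> d = c + m%:Z ->
  (forall v, rect a b c d v -> v \in s) -> fail s (hcross a b c d) = fH l m.
Proof.
move=> us -> -> Xs.
apply: (@fail_sym _ (shiftv (a, c)) (shiftv (- a, - c)) _ _ _ _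
  (@shiftvK (a, c)) (@shiftvKV (a, c)) (@depends_hcross a _ c _)) => //; first exact: uniq_sites.
  by move=> v; rewrite mem_sites /rect /=; lia.
move=> w; rewrite hcross_shift /= !subrr; rewrite ![_ + _ - _]addrAC !subrr !add0r; tauto.
Qed.

Lemma fail_vcross s (a b c d : int) (l m : nat) : uniq s -> d = c + l%:Z -> b = a + m%:Z ->
  (forall v, rect a b c d v -> v \in s) -> fail s (vcross a b c d) = fH l m.
Proof.
move=> us dc ba Xs.
have -> : fail s (vcross a b c d) = fail (map swapv s) (hcross c d a b).
  apply: (@fail_sym _ swapv swapv _ _ _ _ swapvK swapvK (@depends_vcross a b c d)) => //.
  - by rewrite map_inj_uniq //; exact: (can_inj swapvK).
  - by move=> v /Xs h; rewrite -(swapvK v) map_f.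
  - move=> w; rewrite -hcross_swap; have -> // : (w \o swapv) \o swapv = w.
    by apply/funext => x /=; rewrite swapvK.
apply: fail_hcross => //; first by rewrite map_inj_uniq //; exact: (can_inj swapvK).
move=> v h; rewrite -(swapvK v) map_f // Xs //; by move: h; rewrite /rect /= andbC.
Qed.

Lemma fH_mono l l' m m' : (l' <= l)%N -> (m <= m')%N -> fH l' m' <= fH l m.
Proof.
move=> ll mm.
rewrite -(@fail_hcross (sites 0 0 l m') 0 l'%:Z 0 m'%:Z l' m') ?uniq_sites ?add0r //; last first.
  by move=> v; rewrite mem_sites /rect; lia.
rewrite -(@fail_hcross (sites 0 0 l m') 0 l%:Z 0 m%:Z l m) ?uniq_sites ?add0r //; last first.
  by move=> v; rewrite mem_sites /rect; lia.
apply: fail_mono => w [v [v' [va vb h]]].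
apply: (sub_hcross h); rewrite ?va ?vb //; try lia.
by move=> x; rewrite /rect; lia.
Qed.

(** The two rectangles overlap in a square of side [m]; a vertical crossing of this square meets
    both horizontal crossings and joins them. *)
Lemma fH_glue l1 l2 m : (m <= l1)%N -> (m <= l2)%N ->
  fH (l1 + l2 - m) m <= fH l1 m + fH l2 m + fH m m.
Proof.
move=> ml1 ml2; pose L := (l1 + l2 - m)%N; pose s := sites 0 0 L m.
rewrite -/L -(@fail_hcross s 0 L%:Z 0 m%:Z L m) ?uniq_sites ?add0r //; last first.
  by move=> v; rewrite mem_sites /rect; lia.
rewrite -(@fail_hcross s 0 l1%:Z 0 m%:Z l1 m) ?uniq_sites ?add0r //; last first.
  by move=> v; rewrite mem_sites /rect; lia.
rewrite -(@fail_hcross s (l1%:Z - m%:Z) L%:Z 0 m%:Z l2 m) ?uniq_sites ?add0r //; [|lia|]; last first.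
  by move=> v; rewrite mem_sites /rect; lia.
rewrite -(@fail_vcross s (l1%:Z - m%:Z) l1%:Z 0 m%:Z m m) ?uniq_sites ?add0r //; [|lia|]; last first.
  by move=> v; rewrite mem_sites /rect; lia.
apply: le_trans (lerD (fail_and _ _ _) (lexx _)).
apply: le_trans (fail_and _ _ _); apply: fail_mono => w [[]].
move=> [u [u' [u0 u1 h1]]] [t [t' [t0 t1 h2]]] [v [v' [v0 v1 hv]]].
exists u, t'; split=> //.
have uv : connected_in (rect 0 L%:Z 0 m%:Z) w u v.
  apply: (crossing_glue (x1 := l1%:Z - m%:Z) (x2 := l1%:Z) (y1 := 0) (y2 := m%:Z) h1 hv);
    rewrite ?u0 ?u1 ?v0 ?v1 //; try (by move=> x; rewrite /rect; lia); lia.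
have tv : connected_in (rect 0 L%:Z 0 m%:Z) w t v.
  apply: (crossing_glue (x1 := l1%:Z - m%:Z) (x2 := l1%:Z) (y1 := 0) (y2 := m%:Z) h2 hv);
    rewrite ?t0 ?t1 ?v0 ?v1 //; try (by move=> x; rewrite /rect; lia); lia.
apply: (cin_trans uv); apply: (cin_trans (cin_sym tv)).
by apply: cin_mono h2 => // x; rewrite /rect; lia.
Qed.

(** Two disjoint strips of m + 1 rows each fill the 2 m + 2 rows of a rectangle of height 2 m + 1,
    and their crossings fail independently. *)
Lemma fH_stack l m : fH l (m + m).+1 <= fH l m ^+ 2.
Proof.
pose s := sites 0 0 l (m + m).+1.
have e1 : fail s (hcross 0 l%:Z 0 m%:Z) = fH l m.
  apply: fail_hcross; rewrite ?uniq_sites ?add0r // => v; rewrite mem_sites /rect; lia.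
have e2 : fail s (hcross 0 l%:Z m.+1%:Z (m + m).+1%:Z) = fH l m.
  apply: fail_hcross; [exact: uniq_sites|by rewrite add0r| |].
    by rewrite -addSn PoszD.
  by move=> v; rewrite mem_sites /rect; lia.
rewrite expr2 -{1}e1 -e2.
rewrite -(@Ex_indep _ p (rect 0 l%:Z 0 m%:Z) (rect 0 l%:Z m.+1%:Z (m + m).+1%:Z)); last 3 first.
- exact/depends_indic/depends_hcross.
- exact/depends_indic/depends_hcross.
- by move=> v; rewrite /rect; lia.
apply: ler_Ex => // w; rewrite -indic_and; apply: indic_mono => n; split=> -[v [v' [v0 v1 h]]]; apply: n;
  exists v, v'; split=> //; apply: cin_mono h => // x; rewrite /rect; lia.
Qed.

(** Gluing two copies raises the ratio from 5/4 to 6/4 and then to 8/4; the failure terms add up to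
    3 and then to 3 + 3 + 1. *)
Lemma fH_54 b : fH (8 * b) (4 * b) <= 7 * fH (5 * b) (4 * b).
Proof.
set g := fH (5 * b) _.
have g4 : fH (4 * b) (4 * b) <= g by apply: fH_mono; lia.
have h6 : fH (6 * b) (4 * b) <= 3 * g.
  have -> : (6 * b = 5 * b + 5 * b - 4 * b)%N by lia.
  by apply: le_trans (fH_glue _ _) _; [lia|lia|rewrite -/g; lra].
have -> : (8 * b = 6 * b + 6 * b - 4 * b)%N by lia.
by apply: le_trans (fH_glue _ _) _; [lia|lia|lra].
Qed.

Lemma fH_longer M (f := fH (2 * M) M) : fH (3 * M) M <= 3 * f /\ fH (5 * M) M <= 7 * f.
Proof.
have g1 : fH M M <= f by apply: fH_mono; lia.
have h3 : fH (3 * M) M <= 3 * f.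
  have -> : (3 * M = 2 * M + 2 * M - M)%N by lia.
  by apply: le_trans (fH_glue _ _) _; [lia|lia|rewrite -/f; lra].
split=> //.
have h4 : fH (4 * M) M <= 5 * f.
  have -> : (4 * M = 3 * M + 2 * M - M)%N by lia.
  by apply: le_trans (fH_glue _ _) _; [lia|lia|rewrite -/f; lra].
have -> : (5 * M = 4 * M + 2 * M - M)%N by lia.
by apply: le_trans (fH_glue _ _) _; [lia|lia|rewrite -/f; lra].
Qed.

(** Two strips of height [M] are stacked. Their length 4 M + 2 is at most 5 M since M is at least 2,
    so each fails with at most 7 times the old probability. *)
Lemma fH_double M : (2 <= M)%N -> fH (2 * (M + M).+1) (M + M).+1 <= 49 * fH (2 * M) M ^+ 2.
Proof.
move=> M2; apply: le_trans (fH_stack _ _) _.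
have [_ h] := fH_longer M.
have h' : fH (2 * (M + M).+1) M <= 7 * fH (2 * M) M.
  by apply: le_trans h; apply: fH_mono; lia.
rewrite (_ : 49 * _ = (7 * fH (2 * M) M) ^+ 2); last by ring.
by rewrite ler_pXn2r // nnegrE ?mulr_ge0 ?fH_ge0.
Qed.

(* The two cases are those of a crossing of large or small horizontal extent. *)
Lemma vcross_cases (a : nat) w : (0 < a)%N -> vcross 0 (48 * a)%N%:Z 0 (24 * a)%N%:Z w ->
  exists i, (i < 50)%N /\
   (hcross (i * a)%N%:Z ((i + 30) * a)%N%:Z 0 (24 * a)%N%:Z w \/
    vcross (i * a)%N%:Z ((i + 32) * a)%N%:Z 0 (24 * a)%N%:Z w).
Proof.
move=> a0 [v [v' [v0 v1 [s [ps ls ws Bs]]]]].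
pose above j := all (fun x : vertex => (j * a)%N%:Z <= x.1.1) (v :: s).
have above0 : above 0%N.
  by apply: sub_all Bs => x; rewrite /rect mul0n => /andP[/andP[]].
have above49 : ~~ above 49%N.
  apply/negP => /andP[h _]; case/andP: Bs => /andP[hv _] _; move: h hv; clear -a0; lia.
(* [j] locates the leftmost abscissa of the path up to [a]. If the path also reaches abscissa (j +
   31) a, it contains a crossing of length 30 a; otherwise it fits into a rectangle of width 32
   a. *)
have [j [j49 aj naj]] : exists j, [/\ (j < 49)%N, above j & ~~ above j.+1].
  apply: contrapT => no; have : forall j, (j <= 49)%N -> above j.
    elim=> [//|j IH] jl; apply: contrapT => /negP n; apply: no; exists j; split=> //.
    exact/IH/ltnW.
  by move=> /(_ 49%N (leqnn _)); rewrite (negbTE above49).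
have [x xs xlt] : exists2 x, x \in v :: s & x.1.1 < (j.+1 * a)%N%:Z.
  apply: contrapT => no; case/negP: naj; apply/allP => x xs; rewrite leNgt; apply/negP => h.
  by apply: no; exists x.
have [[y ys yge]|no] := pselect (exists2 y, y \in v :: s & ((j.+1 + 30) * a)%N%:Z <= y.1.1).
  exists j.+1; split; first by [].
  left; apply: (@sub_hcross (rect 0 (48 * a)%N%:Z 0 (24 * a)%N%:Z) w x y) => //.
  - exact: cin_trans (cin_sym (cin_mem ps ws Bs xs)) (cin_mem ps ws Bs ys).
  - by move=> z /andP[].
  - exact: ltW.
  - by rewrite lez_nat leq_mul2r leq_addr orbT.
exists j; split; first by lia.
right; exists v, v'; split=> //; exists s; split=> //.
apply/allP => x' x's; have := allP Bs _ x's; rewrite /rect => /andP[_ ->].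
rewrite andbT (allP aj _ x's) /= leNgt; apply/negP => h; apply: no; exists x' => //.
by apply: le_trans (ltW h); rewrite lez_nat leq_mul2r addSnnS leq_add2l orbT.
Qed.

(** Harris' inequality for the hundred events of [vcross_cases], fifty of each kind. If all fail,
    the rectangle of size 48 a by 24 a is not crossed the short way. *)
Lemma fH_dichotomy a : (0 < a)%N ->
  fH (30 * a) (24 * a) ^+ 50 * fH (24 * a) (32 * a) ^+ 50 <= fH (47 * a) (48 * a).
Proof.
move=> a0; pose s := sites 0 0 (100 * a) (24 * a).
pose Qh i := hcross (i * a)%N%:Z ((i + 30) * a)%N%:Z 0 (24 * a)%N%:Z.
pose Qv i := vcross (i * a)%N%:Z ((i + 32) * a)%N%:Z 0 (24 * a)%N%:Z.
pose Q i := if (i < 50)%N then Qh i else Qv (i - 50)%N.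
have eH i : (i < 50)%N -> fail s (Qh i) = fH (30 * a) (24 * a).
  move=> i50; apply: fail_hcross; rewrite ?uniq_sites //; first lia.
  by move=> v; rewrite mem_sites /rect; nia.
have eV i : (i < 50)%N -> fail s (Qv i) = fH (24 * a) (32 * a).
  move=> i50; apply: fail_vcross; rewrite ?uniq_sites //; first lia.
  by move=> v; rewrite mem_sites /rect; nia.
have eW : fail s (vcross 0 (48 * a)%N%:Z 0 (24 * a)%N%:Z) = fH (24 * a) (48 * a).
  by apply: fail_vcross; rewrite ?uniq_sites ?add0r // => v; rewrite mem_sites /rect; lia.
have incQ i : increasing (Q i).
  by rewrite /Q; case: ifP => _; [exact: increasing_hcross|exact: increasing_vcross].
move: s eH eV eW => s eH eV eW.
have := harris_prod p01 (50 + 50) s (fun=> false) incQ.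
rewrite -[X in X <= _]/(\prod_(i < 50 + 50) fail s (Q i)) big_split_ord /=.
rewrite (eq_bigr (fun=> fH (30 * a) (24 * a))); last first.
  by move=> [i i50] _ /=; rewrite /Q i50 eH.
rewrite [X in _ * X](eq_bigr (fun=> fH (24 * a) (32 * a))); last first.
  by move=> [i i50] _ /=; rewrite /Q ltnNge leq_addr /= addKn eV.
rewrite !prodr_const !card_ord => h; apply: le_trans h _.
apply: (@le_trans _ _ (fH (24 * a) (48 * a))); last by apply: fH_mono; lia.
rewrite -eW; apply: ler_Ex => // w; apply: indic_mono => no hv.
have [i [i50 [h|h]]] := vcross_cases a0 hv.
  by apply: (no i); [lia|rewrite /Q i50].
by apply: (no (50 + i)%N); [lia|rewrite /Q ltnNge leq_addr /= addKn].
Qed.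

End Fail.

(** * The dual exploration of a rectangle *)

Lemma max_succ (x : int) : Num.max x (x + 1) = x + 1.
Proof. by apply/max_idPr; rewrite lerDl. Qed.

Lemma max_pred (x : int) : Num.max x (x - 1) = x.
Proof. by apply/max_idPl; rewrite gerBl. Qed.

Lemma eq_succ (x : int) : (x == x + 1) = false.
Proof. lia. Qed.

Lemma eq_pred (x : int) : (x == x - 1) = false.
Proof. lia. Qed.

Section Exploration.
Variables (k h : nat).
Hypothesis h_gt0 : (0 < h)%N.

Implicit Types (w : cfg) (f g c d z : column).

Definition inS c : bool := ((0 : int) <= c.1 <= (k + k)%N%:Z) && ((0 : int) <= c.2 <= h%:Z).

(* The face with lower left corner [f]. The column of faces of abscissa [-1] lies
   to the left of the rectangle, that of abscissa [2 k] to its right, and the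
   faces of ordinate [-1] lie below the right half of its bottom side. *)
Definition face f : bool :=
  ((-1 : int) <= f.1 <= (k + k)%N%:Z) && ((0 : int) <= f.2 < h%:Z) || (f.2 == (-1 : int)) && (k%:Z <= f.1 <= (k + k)%N%:Z).

(** An edge obstructs the exploration when it is open in at least one layer, so that dual steps
    never cross the projection of an open path of the rectangle. *)
Definition bond w c d : bool :=
  [&& inS c, inS d & (w (c, false) && w (d, false)) || (w (c, true) && w (d, true))].

(* End points of the edge separating two neighbouring faces. *)
Definition edge1 f g : column := (Num.max f.1 g.1, Num.max f.2 g.2).
Definition edge2 f g : column :=
  if f.2 == g.2 then (Num.max f.1 g.1, f.2 + 1) else (f.1 + 1, Num.max f.2 g.2).

Definition separated w f g : bool := bond w (edge1 f g) (edge2 f g).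

Definition dual_step w f g : bool := [&& face g, ladj f g & ~~ separated w f g].

Definition lowerleft : column := (-1, 0).
Definition target : column := ((k + k)%N%:Z, 0).

Definition explored w f : Prop :=
  exists s, path (dual_step w) lowerleft s /\ last lowerleft s = f.

Definition corner f c : bool :=
  ((f.1 == c.1) || (f.1 + 1 == c.1)) && ((f.2 == c.2) || (f.2 + 1 == c.2)).

Definition revealed w c : Prop := inS c /\ exists2 f, explored w f & corner f c.

Definition revealed_site w : pred vertex := fun v => `[< revealed w v.1 >].

Lemma bondC w c d : bond w c d = bond w d c.
Proof. by rewrite /bond andbCA; congr (_ && (_ && _)); rewrite andbC [w (c, true) && _]andbC. Qed.

Lemma edgeC f g : f.2 = g.2 \/ f.1 = g.1 -> edge1 f g = edge1 g f /\ edge2 f g = edge2 g f.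
Proof.
rewrite /edge1 /edge2 [Num.max f.1 _]maxC [Num.max f.2 _]maxC eq_sym.
by case: eqP => [->//|n] [e|->]//; case: n.
Qed.

Lemma ladj_dir f g : ladj f g -> f.2 = g.2 \/ f.1 = g.1.
Proof. by move=> /ladjP[->|[->|[->|[->|->]]]] /=; tauto. Qed.

Lemma separatedC w f g : ladj f g -> separated w f g = separated w g f.
Proof. by move=> /ladj_dir /edgeC [e1 e2]; rewrite /separated e1 e2. Qed.

Lemma face_lowerleft : face lowerleft.
Proof. by rewrite /face /lowerleft /=; lia. Qed.

Lemma explored0 w : explored w lowerleft.
Proof. by exists [::]. Qed.

Lemma exploredS w f g : explored w f -> dual_step w f g -> explored w g.
Proof.
by move=> [s [ps <-]] fg; exists (rcons s g); rewrite rcons_path ps fg last_rcons.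
Qed.

Lemma explored_face w f : explored w f -> face f.
Proof.
case=> s; elim/last_ind: s => [[_ <-]|s g _ []]; first exact: face_lowerleft.
by rewrite rcons_path last_rcons => /andP[_ /and3P[? _ _]] <-.
Qed.

Lemma explored_ind w (Q : column -> Prop) : Q lowerleft ->
  (forall f g, explored w f -> Q f -> dual_step w f g -> Q g) -> forall f, explored w f -> Q f.
Proof.
move=> Q0 QS f [s]; elim/last_ind: s f => [|s g IH] f; first by case=> _ <-.
rewrite rcons_path last_rcons => -[/andP[ps sg] <-].
by apply: QS sg; [exists s|exact: IH].
Qed.

Section CrossingBlocks.
Variables (w : cfg) (v : vertex) (s : seq vertex).
Hypotheses (ps : path adj v s) (ws : all w (v :: s)) (Ss : all (fun u : vertex => inS u.1) (v :: s)).

Lemma avoids_bond (e : column -> column -> bool) :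
  (forall c d, e c d -> (c != d) && ~~ bond w c d) -> avoids e v.1 (map fst s).
Proof.
move=> eP; elim: s v ps ws Ss => //= u t IH x /andP[xu pt] /and3P[wx wu wt] /and3P[Sx Su St].
rewrite IH ?wu ?Su // andbT; apply/negP => /eP /andP[ne /negP]; apply.
move: xu; rewrite adjE (negbTE ne) /= andbT => /andP[/eqP e2 _].
move: wx wu e2; rewrite /bond Sx Su; clear; case: x u => [c b] [d b'] /= + + e2.
by rewrite -e2; case: b {e2} => -> ->; rewrite ?orbT.
Qed.

Hypotheses (v0 : v.1.2 = 0) (vk : v.1.1 <= k%:Z) (lh : (last v s).1.2 = h%:Z).

(** The projected path is prolonged down to row -1. The added edge has abscissa at most [k], and the
    square to its left in row -1 is not a face, so no dual step crosses it. *)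
Let b0 : column := (v.1.1, -1).
Let b : seq column := v.1 :: map fst s.
Let st f := vcount f.1 f.2 b0 b.

Lemma pathb : path ladj b0 b.
Proof. by rewrite /= path_ladj // andbT /ladj /b0 /= v0 eqxx !orbT. Qed.

Lemma blocked_right x y : face (x, y) -> face (x + 1, y) -> ~~ separated w (x, y) (x + 1, y) ->
  st (x, y) = st (x + 1, y).
Proof.
move=> Ff Fg ns; have := @vcount_hor (x + 1) y b0 b; rewrite addrK; apply.
rewrite /b /=; apply/andP; split.
  apply/negP; rewrite /is_vedge /b0 /= v0; move: Ff vk; rewrite /face /=; clear; lia.
apply: avoids_bond => -[cx cy] [dx dy] /and3P[/= /eqP -> /eqP ->] e.
move: ns; rewrite /separated /edge1 /edge2 /= eqxx maxxx.
rewrite max_succ.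
by move: e => /orP[] /andP[/eqP -> /eqP ->] ns; rewrite ?[bond _ (_, y + 1) _]bondC ns andbT xpair_eqE eqxx /=; clear; lia.
Qed.

Lemma blocked_up x y : face (x, y) -> face (x, y + 1) -> ~~ separated w (x, y) (x, y + 1) ->
  st (x, y) = st (x, y + 1).
Proof.
move=> Ff Fg ns.
have av : avoids (is_hedge x (y + 1)) b0 b.
  rewrite /b /=; apply/andP; split.
    apply/negP; rewrite /is_hedge /b0 /= v0; clear; lia.
  apply: avoids_bond => -[cx cy] [dx dy] /and3P[/= /eqP -> /eqP ->] e.
  move: ns; rewrite /separated /edge1 /edge2 /=.
  rewrite eq_succ max_succ maxxx; by move: e => /orP[] /andP[/eqP -> /eqP ->] ns; rewrite ?[bond _ (x + 1, _) _]bondC ns andbT xpair_eqE eqxx ?andbT /=; clear; lia.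
have := vcount_vert pathb av; rewrite addrK /st /halfrow.
have -> : (b0.2 == y + 1) = false by move: Ff; rewrite /face /b0 /=; clear; lia.
have -> : ((last b0 b).2 == y + 1) = false.
  by rewrite /b /= last_map lh; move: Fg; rewrite /face /=; clear; lia.
by case: vcount; case: vcount.
Qed.

(** The parity [st] is constant along dual steps. It is even at [lowerleft], which has the path to
    its right, and odd at [target], which has it to its left with one end below and one above. *)
Lemma crossing_blocks : ~ explored w target.
Proof.
have S0 : forall u : vertex, u \in v :: s -> inS u.1.
  by move=> u us; exact: (allP Ss).
have cst f : explored w f -> st f = false.
  move: f; apply: (@explored_ind w).
    apply: (@vcount_left (-1) 0 b0 b); rewrite /= all_map.
    have /andP[/andP[h0 _] _] := S0 v (mem_head _ _).
    have h1 : (-1 : int) < v.1.1 by clear -h0; lia.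
    apply/and3P; split=> //.
    by apply/allP => /= u us; have := S0 u; rewrite inE us orbT => /(_ isT); rewrite /inS; clear; lia.
  move=> f g ef <- /and3P[Fg fg ns]; have Ff := explored_face ef.
  case: f {ef} Ff fg ns => x y Ff fg; case: (ladjP fg) => [->//|[E|[E|[E|E]]]]; move: fg Fg; rewrite E /= => fg Fg ns.
  - exact/esym/blocked_up.
  - by have := @blocked_up x (y - 1); rewrite subrK => -> //; rewrite -separatedC.
  - exact/esym/blocked_right.
  - by have := @blocked_right (x - 1) y; rewrite subrK => -> //; rewrite -separatedC.
have all2k : all (fun d : column => d.1 <= (k + k)%N%:Z) (b0 :: b).
  rewrite /= all_map; have /andP[/andP[_ h0] _] := S0 v (mem_head _ _).
  apply/and3P; split=> //; apply/allP => u us /=.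
  by have := S0 u; rewrite inE us orbT => /(_ isT); rewrite /inS => /andP[/andP[]].
move=> /cst; rewrite -[st _]/(vcount (k + k)%N%:Z 0 b0 b) (vcount_right _ pathb all2k).
by rewrite /b /= last_map lh; move: h_gt0; clear; lia.
Qed.

End CrossingBlocks.

Lemma corner_edge f g : ladj f g -> corner f (edge1 f g) /\ corner f (edge2 f g).
Proof.
move=> /ladjP; case: f => x y /=; rewrite /corner /edge1 /edge2 => -[->|[->|[->|[->|->]]]] /=;
  rewrite ?maxxx ?max_succ ?max_pred ?eq_succ ?eq_pred ?eqxx /=; clear; lia.
Qed.

(** A step from an explored face consults only the ends of the edge to be crossed. These are corners
    of that face, hence revealed if they lie in the rectangle, so both explorations proceed
    alike. *)
Lemma explored_agree w w' f : agree (revealed_site w) w w' -> explored w' f <-> explored w f.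
Proof.
move=> ww'.
have step f0 g : explored w f0 -> dual_step w' f0 g = dual_step w f0 g.
  move=> ef; rewrite /dual_step; case fg : (ladj f0 g); rewrite ?andbF //=.
  congr (_ && ~~ _); rewrite /separated /bond; have [c1 c2] := corner_edge fg.
  case S1 : (inS _) => //=; case S2 : (inS _) => //=.
  have r1 b : revealed_site w (edge1 f0 g, b) by apply/asboolP; split=> //; exists f0.
  have r2 b : revealed_site w (edge2 f0 g, b) by apply/asboolP; split=> //; exists f0.
  by rewrite !ww'.
suff H s f0 : explored w f0 -> path (dual_step w') f0 s = path (dual_step w) f0 s.
  by split=> -[s [ps ls]]; exists s; split=> //; move: ps; rewrite (H s _ (explored0 w)).
elim: s f0 => //= g s IH f0 e0; rewrite step //.
by case E : dual_step => //=; apply: IH; exact: exploredS E.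
Qed.

Lemma revealed_stop w w' : agree (revealed_site w) w w' -> revealed_site w' = revealed_site w.
Proof.
move=> ww'; have ee f := explored_agree f ww'.
apply/funext => v; apply/asbool_equiv_eq; split=> -[Sv [f ef fv]]; split=> //; exists f => //; exact/ee.
Qed.

(** * The dry region and its boundary *)

Section Boundary.
Variable w : cfg.
Hypothesis open_side : ~ explored w target.

Definition dry_step : rel column := fun f g => [&& face g, ladj f g & `[< ~ explored w g >]].

(** The component of [target] among the unexplored faces. Other components may be enclosed by the
    explored region; only the boundary of this one is studied. *)
Definition dry f : Prop := exists s, path dry_step target s /\ last target s = f.

Lemma dry0 : dry target.
Proof. by exists [::]. Qed.

Lemma dryS f g : dry f -> face g -> ladj f g -> ~ explored w g -> dry g.
Proof.
move=> [s [ps <-]] Fg fg ng; exists (rcons s g).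
by rewrite rcons_path ps last_rcons /dry_step Fg fg; split=> //; apply/asboolP.
Qed.

Lemma dry_ind (Q : column -> Prop) : Q target ->
  (forall f g, dry f -> Q f -> dry_step f g -> Q g) -> forall f, dry f -> Q f.
Proof.
move=> Q0 QS f [s]; elim/last_ind: s f => [|s g IH] f; first by case=> _ <-.
rewrite rcons_path last_rcons => -[/andP[ps sg] <-].
by apply: QS sg; [exists s|exact: IH].
Qed.

Lemma face_target : face target.
Proof. by rewrite /face /target /=; move: h_gt0; clear; lia. Qed.

Lemma dryP f : dry f -> face f /\ ~ explored w f.
Proof.
move: f; apply: dry_ind; first by split=> //; exact: face_target.
by move=> f g _ _ /and3P[Fg _ /asboolP].
Qed.

Lemma explored_free f g : explored w f -> face g -> ladj f g -> ~~ inS (edge1 f g) || ~~ inS (edge2 f g) ->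
  explored w g.
Proof.
move=> ef Fg fg nS; apply: (exploredS ef); rewrite /dual_step Fg fg /separated /bond /=.
by case/orP: nS => /negbTE ->; rewrite ?andbF.
Qed.

Lemma left_explored (j : nat) : (j < h)%N -> explored w (-1, j%:Z).
Proof.
elim: j => [|j IH] jh; first exact: explored0.
apply: (explored_free (IH _)); [lia|by rewrite /face /=; clear -jh; lia| |].
  by rewrite /ladj /=; clear; lia.
by apply/orP; left; rewrite /edge1 /= ?maxxx /inS /=; clear; lia.
Qed.

(** Steps between faces to the right of the rectangle cross none of its edges, so one explored face
    there would make [target] explored. *)
Lemma right_dry (j : nat) : (j < h)%N -> dry ((k + k)%N%:Z, j%:Z).
Proof.
have nex i : (i < h)%N -> ~ explored w ((k + k)%N%:Z, i%:Z).
  elim: i => [_|i IH] ih; first exact: open_side.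
  move=> /explored_free e; apply: IH; first lia; apply: e.
  - by rewrite /face /=; clear -ih; lia.
  - by rewrite /ladj /=; clear; lia.
  - apply/orP; right; rewrite /edge2 /=; have -> : (i.+1%:Z == i%:Z) = false by clear; lia.
    by rewrite /inS /=; clear; lia.
elim: j => [|j IH] jh; first exact: dry0.
apply: (dryS (IH _)); [lia|by rewrite /face /=; clear -jh; lia| |exact: nex].
by rewrite /ladj /=; clear; lia.
Qed.

Lemma bottom_dry (i : nat) : (i <= k)%N -> dry ((k + k - i)%N%:Z, -1).
Proof.
have nex j : (j <= k)%N -> ~ explored w ((k + k - j)%N%:Z, -1).
  elim: j => [|j IH] jk; move=> /explored_free e.
    apply: open_side; apply: e.
    - exact: face_target.
    - by rewrite /ladj /=; clear; lia.
    - by apply/orP; right; rewrite /edge2 /inS /=; clear; lia.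
  apply: IH; first lia; apply: e.
  - by rewrite /face /=; clear -jk; lia.
  - by rewrite /ladj /=; clear -jk; lia.
  - by apply/orP; left; rewrite /edge1 /= ?maxxx /inS /=; clear; lia.
elim: i => [|i IH] ik.
  apply: (dryS dry0); [by rewrite /face /=; clear; lia|by rewrite /ladj /=; clear; lia|exact: nex].
apply: (dryS (IH _)); [lia|by rewrite /face /=; clear -ik; lia| |exact: nex].
by rewrite /ladj /=; clear -ik; lia.
Qed.

Lemma wet_neighbour f g : dry f -> face g -> ladj f g -> ~ dry g -> explored w g.
Proof. by move=> df Fg fg ng; apply: contrapT => ne; apply: ng; exact: (dryS df). Qed.

Lemma separated_boundary f g : dry f -> explored w g -> ladj f g -> separated w f g.
Proof.
move=> df eg fg; have [Ff nf] := dryP df; apply/negPn/negP => ns; apply: nf.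
apply: (exploredS eg); rewrite /dual_step Ff ladj_sym fg /=.
by rewrite -separatedC.
Qed.

(** Faces with a common corner are equal, adjacent or diagonal. In the diagonal case the region of
    faces, although not a rectangle, contains one of the two squares completing the block of
    four. *)
Lemma around f g z : face f -> face g -> corner f z -> corner g z ->
  exists m, [/\ face m, corner m z, ladj f m & ladj m g].
Proof.
move=> Ff Fg /andP[fz1 fz2] /andP[gz1 gz2].
have near (a b c : int) : (a == c) || (a + 1 == c) -> (b == c) || (b + 1 == c) ->
    (a == b) || (a == b + 1) || (b == a + 1).
  move=> /orP[] /eqP <- /orP[] /eqP E; apply/orP.
  - by left; rewrite E eqxx.
  - by left; rewrite E eqxx orbT.
  - by right; rewrite E eqxx.
  - by left; move/addIr: E => ->; rewrite eqxx.
have col (a b b' : int) : (b == b') || (b == b' + 1) || (b' == b + 1) -> ladj (a, b) (a, b').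
  by rewrite /ladj /= eqxx => ->.
have row (a a' b : int) : (a == a') || (a == a' + 1) || (a' == a + 1) -> ladj (a, b) (a', b).
  by rewrite /ladj /= eqxx => /orP[/orP[] ->|->]; rewrite ?orbT ?eqxx.
case: f g z Ff Fg fz1 fz2 gz1 gz2 => [f1 f2] [g1 g2] [z1 z2] /= Ff Fg fz1 fz2 gz1 gz2.
have fg1 := near _ _ _ fz1 gz1; have fg2 := near _ _ _ fz2 gz2.
suff : face (f1, g2) \/ face (g1, f2).
  case=> Fm; [exists (f1, g2)|exists (g1, f2)]; split=> //; rewrite /corner /= ?fz1 ?gz1 //.
  - exact: col.
  - exact: row.
  - exact: row.
  - exact: col.
move: Ff Fg; rewrite /face /= => /orP[/andP[a b]|/andP[b a]] /orP[/andP[c d]|/andP[d c]].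
- by left; rewrite a d.
- by right; rewrite b andbT; apply/orP; left; move: c; clear; lia.
- by left; rewrite d andbT; apply/orP; left; move: a; clear; lia.
- by left; rewrite a d orbT.
Qed.

Lemma around_dry f g z : (forall e, corner e z -> ~ explored w e) ->
  dry f -> corner f z -> face g -> corner g z -> dry g.
Proof.
move=> ne df fz Fg gz; have [Ff _] := dryP df.
have [m [Fm mz fm mg]] := around Ff Fg fz gz.
exact: (dryS (dryS df Fm fm (ne _ mz)) Fg mg (ne _ gz)).
Qed.

(** A diagonal contact is replaced by an adjacent one: the intermediate face is itself dry or
    explored. *)
Lemma around_boundary f g z : explored w f -> dry g -> corner f z -> corner g z ->
  exists f' g', [/\ explored w f', dry g', ladj g' f', corner f' z & corner g' z].
Proof.
move=> ef dg fz gz; have [Fg _] := dryP dg; have Ff := explored_face ef.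
have [m [Fm mz gm mf]] := around Fg Ff gz fz.
have [dm|nm] := pselect (dry m); first by exists f, m.
by exists m, g; split=> //; exact: (wet_neighbour dg).
Qed.

Definition isdry f : bool := `[< dry f >].

(* Boundary edges of the dry region, from (i, j) to (i + 1, j) and to (i, j + 1). *)
Definition hbd (i j : int) : bool :=
  [&& face (i, j - 1), face (i, j) & isdry (i, j - 1) (+) isdry (i, j)].
Definition vbd (i j : int) : bool :=
  [&& face (i - 1, j), face (i, j) & isdry (i - 1, j) (+) isdry (i, j)].

Definition bd_step : rel column := fun c d =>
  [|| (d == (c.1 + 1, c.2)) && hbd c.1 c.2, (c == (d.1 + 1, d.2)) && hbd d.1 d.2,
      (d == (c.1, c.2 + 1)) && vbd c.1 c.2 | (c == (d.1, d.2 + 1)) && vbd d.1 d.2].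

Lemma dry_or_explored f g : face f -> face g -> ladj f g -> isdry f (+) isdry g ->
  (dry f /\ explored w g) \/ (dry g /\ explored w f).
Proof.
move=> Ff Fg fg; rewrite /isdry; case: asboolP => df; case: asboolP => dg //= _; [left|right]; split=> //.
  exact: (wet_neighbour df).
by apply: (wet_neighbour dg) => //; rewrite ladj_sym.
Qed.

(** Were the edge not open, the exploration would continue into the dry face. Its ends are corners
    of the explored face, hence revealed. *)
Lemma bd_separated f g : face f -> face g -> ladj f g -> isdry f (+) isdry g ->
  [/\ bond w (edge1 f g) (edge2 f g), revealed w (edge1 f g) & revealed w (edge2 f g)].
Proof.
move=> Ff Fg fg x; have gf : ladj g f by rewrite ladj_sym.
have s : separated w f g.
  have [[df eg]|[dg ef]] := dry_or_explored Ff Fg fg x; first exact: separated_boundary.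
  by rewrite separatedC //; exact: separated_boundary.
split=> //; split; try by case/and3P: s.
- have [[df eg]|[dg ef]] := dry_or_explored Ff Fg fg x.
    by exists g => //; have [-> _] := edgeC (ladj_dir fg); have [] := corner_edge gf.
  by exists f => //; have [] := corner_edge fg.
- have [[df eg]|[dg ef]] := dry_or_explored Ff Fg fg x.
    by exists g => //; have [_ ->] := edgeC (ladj_dir fg); have [] := corner_edge gf.
  by exists f => //; have [] := corner_edge fg.
Qed.

Lemma hbd_bond i j : hbd i j -> [/\ bond w (i, j) (i + 1, j), revealed w (i, j) & revealed w (i + 1, j)].
Proof.
move=> /and3P[Ff Fg x]; have fg : ladj (i, j - 1) (i, j) by rewrite /ladj /=; clear; lia.
have := bd_separated Ff Fg fg x; rewrite /edge1 /edge2 /=.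
have -> : (j - 1 == j) = false by clear; lia.
by rewrite maxxx maxC max_pred.
Qed.

Lemma vbd_bond i j : vbd i j -> [/\ bond w (i, j) (i, j + 1), revealed w (i, j) & revealed w (i, j + 1)].
Proof.
move=> /and3P[Ff Fg x]; have fg : ladj (i - 1, j) (i, j) by rewrite /ladj /=; clear; lia.
have := bd_separated Ff Fg fg x; rewrite /edge1 /edge2 /= eqxx.
by rewrite maxxx maxC max_pred.
Qed.

Lemma bd_step_bond c d : bd_step c d -> [/\ bond w c d, revealed w c & revealed w d].
Proof.
case: c d => [c1 c2] [d1 d2]; rewrite /bd_step /=.
move=> /or4P[] /andP[/eqP[-> ->]] b /=.
- exact: hbd_bond.
- by have [? ? ?] := hbd_bond b; rewrite bondC.
- exact: vbd_bond.
- by have [? ? ?] := vbd_bond b; rewrite bondC.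
Qed.

Lemma bd_step_sym : symmetric bd_step.
Proof.
by move=> c d; rewrite /bd_step; do 4 case: (_ && _).
Qed.

(* A finite form of the fact that the boundary between two connected regions of
   the plane is connected: a piece of the boundary of the dry region which does
   not meet the left half of the bottom side of the rectangle would be the jump
   set of a function with values in F_2, equal to [false] on both regions. *)
Section Potential.
Variable z : column.

Definition cluster c : bool := `[< exists s, path bd_step z s /\ last z s = c >].

Lemma cluster0 : cluster z.
Proof. by apply/asboolP; exists [::]. Qed.

Lemma clusterS c d : bd_step c d -> cluster c = cluster d.
Proof.
have H a b : bd_step a b -> cluster a -> cluster b.
  move=> ab /asboolP[s [ps e]]; rewrite -e in ab; apply/asboolP; exists (rcons s b).
  by rewrite rcons_path ps ab last_rcons.
by move=> cd; apply/idP/idP; apply: H => //; rewrite bd_step_sym.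
Qed.

Definition hjump i j := hbd i j && cluster (i, j).
Definition vjump i j := vbd i j && cluster (i, j).

Lemma hjump_end i j : hjump i j = hbd i j && cluster (i + 1, j).
Proof.
rewrite /hjump; case b : (hbd i j) => //=; apply: clusterS.
by rewrite /bd_step /= eqxx b.
Qed.

Lemma vjump_end i j : vjump i j = vbd i j && cluster (i, j + 1).
Proof.
rewrite /vjump; case b : (vbd i j) => //=; apply: clusterS.
by rewrite /bd_step /= eqxx b !orbT.
Qed.

(** Discrete closedness: the four edges at (i, j) belong to the cluster together or not at all, and
    around a vertex the dry status changes an even number of times. *)
Lemma star i j : face (i - 1, j - 1) -> face (i, j - 1) -> face (i - 1, j) -> face (i, j) ->
  hjump (i - 1) j (+) vjump i j (+) vjump i (j - 1) = hjump i j.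
Proof.
move=> F1 F2 F3 F4; rewrite hjump_end [vjump i (j - 1)]vjump_end !subrK /hjump /vjump.
case: (cluster (i, j)); rewrite ?andbF // !andbT /hbd /vbd F1 F2 F3 F4 /=.
by do 4 case: (isdry _).
Qed.

(** The value at the face (n - 1, j), obtained by summing the jumps along row [j] from the face of
    abscissa -1, where it is [false]. *)
Fixpoint potential (n : nat) (j : int) : bool :=
  if n is n'.+1 then vjump n'%:Z j (+) potential n' j else false.

(** Induction along the row by [star]. It starts at abscissa -1, where the faces are explored and
    hence not separated by boundary edges. *)
Lemma jump_row (j : int) (n : nat) : (1 : int) <= j < h%:Z -> (n <= (k + k).+1)%N ->
  potential n j (+) potential n (j - 1) = hjump (n%:Z - 1) j.
Proof.
move=> jh; elim: n => [_|n IH nk].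
  rewrite /= /hjump /hbd /isdry sub0r.
  have H (i : int) : (0 : int) <= i < h%:Z -> `[< dry (-1, i) >] = false.
    move=> ih; apply/asboolF => /dryP[_]; apply.
    have -> : i = (absz i)%:Z by clear -ih; lia.
    by apply: left_explored; clear -ih; lia.
  by rewrite !H ?andbF //; clear -jh; lia.
have -> : n.+1%:Z - 1 = n%:Z by clear; lia.
rewrite /= addbACA (IH (ltnW nk)) -[RHS]star; last 4 first.
- by rewrite /face /=; clear -jh nk; lia.
- by rewrite /face /=; clear -jh nk; lia.
- by rewrite /face /=; clear -jh nk; lia.
- by rewrite /face /=; clear -jh nk; lia.
by rewrite -(addbA (hjump _ _)) addbC.
Qed.

Lemma bottom_isdry (i : int) : face (i, -1) -> isdry (i, -1).
Proof.
move=> Fi; apply/asboolP.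
have -> : i = (k + k - (k + k - absz i))%N by move: Fi; rewrite /face /=; clear; lia.
by apply: bottom_dry; move: Fi; rewrite /face /=; clear; lia.
Qed.

Lemma potential_bottom n : potential n (-1) = false.
Proof.
elim: n => //= n ->; rewrite addbF /vjump /vbd.
case F1 : (face (_ - 1, _)) => //; case F2 : (face _) => //=.
by rewrite !bottom_isdry.
Qed.

Hypothesis no_end : forall x : nat, (x <= k)%N -> ~~ cluster (x%:Z, 0).

(** There are no faces below the left half of the bottom side, so [star] does not apply there; but
    by [no_end] row 0 has no jumps up to abscissa [k]. Further right the induction is that of
    [jump_row], the faces of row -1 being dry. *)
Lemma jump_row0 (n : nat) : (k < n <= (k + k).+1)%N -> potential n 0 = hjump (n%:Z - 1) 0.
Proof.
elim: n => [//|n IH] /andP[kn nk]; rewrite /= /vjump.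
have -> : n.+1%:Z - 1 = n%:Z by clear; lia.
have [kn'|nk'] := ltnP k n; last first.
  have -> : n = k by apply/eqP; rewrite eqn_leq nk' -ltnS kn.
  rewrite /hjump (negbTE (no_end (leqnn k))) !andbF /=.
  have : (k <= k)%N by []. elim: {1 3}k => //= m IHm mk.
  by rewrite IHm ?(ltnW mk) // /vjump (negbTE (no_end (ltnW mk))) andbF.
rewrite IH ?kn' ?(ltnW nk) // -[RHS]star; last 4 first.
- by rewrite /face /=; clear -kn' nk; lia.
- by rewrite /face /=; clear -kn' nk; lia.
- by rewrite /face /=; move: h_gt0; clear -kn' nk; lia.
- by rewrite /face /=; move: h_gt0; clear -kn' nk; lia.
rewrite /vjump sub0r addbC -addbA; congr (_ (+) _).
rewrite /vbd; case F1 : (face (_ - 1, -1)) => //=; last by rewrite addbF.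
by case F2 : (face (_, -1)) => //=; rewrite ?bottom_isdry ?addbF.
Qed.

Definition height f : bool := potential (absz (f.1 + 1)) f.2.

Lemma height_right x y : face (x, y) -> face (x + 1, y) ->
  height (x + 1, y) = vjump (x + 1) y (+) height (x, y).
Proof.
move=> Ff Fg; rewrite /height /=.
have x0 : (-1 : int) <= x by move: Ff; rewrite /face /=; clear; lia.
have -> : absz (x + 1 + 1) = (absz (x + 1)).+1 by clear -x0; lia.
by rewrite /=; congr (vjump _ _ (+) _); clear -x0; lia.
Qed.

Lemma height_up x y : face (x, y) -> face (x, y + 1) ->
  height (x, y + 1) = hjump x (y + 1) (+) height (x, y).
Proof.
move=> Ff Fg; rewrite /height /=.
have x0 : (-1 : int) <= x <= (k + k)%N%:Z by move: Ff; rewrite /face /=; clear; lia.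
have ex : x = (absz (x + 1))%:Z - 1 by clear -x0; lia.
have [e|ne] := eqVneq y (-1).
  rewrite e addNr potential_bottom addbF jump_row0 -?ex //.
  by move: Ff; rewrite e /face /=; clear -x0; lia.
rewrite {2}ex -jump_row ?addrK ?addbK //.
  by move: Ff Fg; rewrite /face /=; clear -ne; lia.
by clear -x0; lia.
Qed.

Lemma height_const f g : face f -> face g -> ladj f g -> isdry f = isdry g -> height f = height g.
Proof.
move=> Ff Fg fg; move: (ladjP fg) Ff Fg; case: f {fg} => x y /= [->//|[->|[->|[->|->]]]] Ff Fg e.
- by rewrite height_up // /hjump /hbd addrK e addbb !andbF.
- by rewrite -{1}(subrK 1 y) height_up ?subrK // /hjump /hbd e addbb !andbF.
- by rewrite height_right // /vjump /vbd addrK e addbb !andbF.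
- by rewrite -{1}(subrK 1 x) height_right ?subrK // /vjump /vbd e addbb !andbF.
Qed.

Lemma height_explored f : explored w f -> height f = false.
Proof.
move: f; apply: explored_ind => // f g ef <- /and3P[Fg fg s].
have eg : explored w g by apply: (exploredS ef); rewrite /dual_step Fg fg.
apply/esym/height_const => //; first exact: explored_face ef.
by rewrite /isdry !asboolF // => /dryP[].
Qed.

Lemma height_dry f : dry f -> height f = false.
Proof.
move: f; apply: dry_ind.
  have := @height_up (k + k)%N%:Z (-1); rewrite addNr => ->; last 2 first.
  - by rewrite /face /=; clear; lia.
  - exact: face_target.
  rewrite /height potential_bottom addbF /hjump /hbd sub0r bottom_isdry; last first.
    by rewrite /face /=; clear; lia.
  by rewrite /isdry asboolT ?andbF //; exact: dry0.
move=> f g df <- /and3P[Fg fg /asboolP ng].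
have dg := dryS df Fg fg ng.
apply/esym/height_const => //; first by case: (dryP df).
by rewrite /isdry !asboolT.
Qed.

(** The boundary edge between [f] and [g] ends at [z], so it belongs to the cluster of [z] and is a
    jump. *)
Lemma height_flip f g : face f -> face g -> ladj f g -> isdry f (+) isdry g ->
  corner f z -> corner g z -> height f != height g.
Proof.
have C c d : z = c \/ z = d -> bd_step c d -> cluster c.
  by move=> [<- _|<- /clusterS ->]; exact: cluster0.
have up x y : face (x, y) -> face (x, y + 1) -> isdry (x, y) (+) isdry (x, y + 1) ->
    corner (x, y) z -> corner (x, y + 1) z -> height (x, y) != height (x, y + 1).
  move=> Ff Fg d fz gz; rewrite height_up //.
  have b : hbd x (y + 1) by rewrite /hbd addrK Ff Fg d.
  have -> : hjump x (y + 1).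
    rewrite /hjump b; apply: (C _ (x + 1, y + 1)); last by rewrite /bd_step /= eqxx b.
    case: z fz gz => a c; rewrite /corner /= => h1 h2.
    have -> : c = y + 1 by clear -h1 h2; lia.
    by have [->|->] : a = x \/ a = x + 1; [clear -h1; lia|left|right].
  by case: height.
have right x y : face (x, y) -> face (x + 1, y) -> isdry (x, y) (+) isdry (x + 1, y) ->
    corner (x, y) z -> corner (x + 1, y) z -> height (x, y) != height (x + 1, y).
  move=> Ff Fg d fz gz; rewrite height_right //.
  have b : vbd (x + 1) y by rewrite /vbd addrK Ff Fg d.
  have -> : vjump (x + 1) y.
    rewrite /vjump b; apply: (C _ (x + 1, y + 1)); last by rewrite /bd_step /= eqxx b !orbT.
    case: z fz gz => a c; rewrite /corner /= => h1 h2.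
    have -> : a = x + 1 by clear -h1 h2; lia.
    by have [->|->] : c = y \/ c = y + 1; [clear -h1; lia|left|right].
  by case: height.
move=> Ff Fg fg; move: (ladjP fg) Ff Fg; case: f {fg} => x y /= [->|[->|[->|[->|->]]]] Ff Fg d fz gz.
- by rewrite addbb in d.
- exact: up.
- by rewrite eq_sym; have := @up x (y - 1); rewrite subrK; apply => //; rewrite addbC.
- exact: right.
- by rewrite eq_sym; have := @right (x - 1) y; rewrite subrK; apply => //; rewrite addbC.
Qed.

End Potential.

Lemma boundary_reaches_bottom f g z : inS z -> explored w f -> dry g -> corner f z -> corner g z ->
  exists x : nat, (x <= k)%N /\ cluster z (x%:Z, 0).
Proof.
move=> Sz ef dg fz gz; apply: contrapT => no.
have no_end (x : nat) : (x <= k)%N -> ~~ cluster z (x%:Z, 0).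
  by move=> xk; apply/negP => cx; apply: no; exists x.
have [f' [g' [ef' dg' gf fz' gz']]] := around_boundary ef dg fz gz.
have [Fg _] := dryP dg'; have Ff := explored_face ef'.
have := @height_flip z no_end g' f' Fg Ff gf _ gz' fz'.
rewrite height_dry // height_explored // eqxx /isdry asboolT // asboolF; last by move=> /dryP[].
by move=> /(_ isT).
Qed.

(** Each boundary edge is open in one of the layers. Where the layer changes, both sites of the
    column are open and connect the two edges. *)
Lemma boundary_connected f g z : inS z -> explored w f -> dry g -> corner f z -> corner g z ->
  exists u u' : vertex, [/\ u.1 = z, u'.1.2 = 0, (0 : int) <= u'.1.1 <= k%:Z & connected_in (revealed_site w) w u u'].
Proof.
move=> Sz ef dg fz gz.
have [x [xk /asboolP[s [ps ls]]]] := boundary_reaches_bottom Sz ef dg fz gz.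
have [u [uz wu ru]] : exists u, [/\ u.1 = z, w u & revealed_site w u].
  have [f' [g' [ef' dg' gf fz' gz']]] := around_boundary ef dg fz gz.
  have [Fg _] := dryP dg'; have Ff := explored_face ef'.
  have rz : revealed w z by split=> //; exists f.
  have [] := @bd_separated g' f' Fg Ff gf; first by rewrite /isdry asboolT // asboolF // => /dryP[].
  move=> /and3P[_ _ bw] _ _.
  have : z = edge1 g' f' \/ z = edge2 g' f'.
    have ng : g' != f' by apply/eqP => e; case: (dryP dg') => _; apply; rewrite e.
    move: (ladjP gf) fz' gz' ng; case: g' z {Sz fz gz ps ls rz dg' gf Fg bw} => x1 y1 [a b] /=.
    rewrite /corner /edge1 /edge2 => -[->|[->|[->|[->|->]]]] /=;
      rewrite ?maxxx ?max_succ ?max_pred ?eq_succ ?eq_pred ?eqxx //= => h1 h2 _.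
    - have -> : b = y1 + 1 by clear -h1 h2; lia.
      by have [->|->] : a = x1 \/ a = x1 + 1; [clear -h1 h2; lia|left|right].
    - have -> : b = y1 by clear -h1 h2; lia.
      by have [->|->] : a = x1 \/ a = x1 + 1; [clear -h1 h2; lia|left|right].
    - have -> : a = x1 + 1 by clear -h1 h2; lia.
      by have [->|->] : b = y1 \/ b = y1 + 1; [clear -h1 h2; lia|left|right].
    - have -> : a = x1 by clear -h1 h2; lia.
      by have [->|->] : b = y1 \/ b = y1 + 1; [clear -h1 h2; lia|left|right].
  move=> [E|E]; rewrite -E in bw; case/orP: bw => /andP[b1 b2];
    by [exists (z, false); split=> //; apply/asboolP|exists (z, true); split=> //; apply/asboolP].
suff : exists u', u'.1 = last z s /\ connected_in (revealed_site w) w u u'.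
  by move=> [u' [e cu]]; exists u, u'; split=> //; rewrite e ls //=; clear -xk; lia.
elim: s z u ps uz wu ru {Sz fz gz ls} => [|c s IH] z u /=.
  by move=> _ uz wu ru; exists u; split=> //; exact: cin_refl.
move=> /andP[zc ps] uz wu ru.
have [/and3P[_ _ bw] rz rc] := bd_step_bond zc.
have [b [wz wc]] : exists b, w (z, b) /\ w (c, b).
  by case/orP: bw => /andP[? ?]; [exists false|exists true].
have rcb : revealed_site w (c, b) by apply/asboolP.
have rzb : revealed_site w (z, b) by apply/asboolP.
have [u' [e cu]] := IH c (c, b) ps erefl wc rcb.
exists u'; split=> //; apply: cin_trans cu.
apply: (@cin_trans _ _ (z, b)); first exact: cin_col.
have [zc'|ne] := eqVneq z c; first by rewrite zc'; exact: cin_refl.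
apply: cin_edge => //; apply: adj_hor => //.
move: zc; rewrite /bd_step /ladj; clear; case: z c => [z1 z2] [c1 c2] /=.
by move=> /or4P[] /andP[/eqP[-> ->] _]; rewrite !eqxx ?orbT.
Qed.

(** No face around an unrevealed column [c] is explored, so a dry face at [c] makes all faces there
    dry, among them one with corner [d]. If [c] is outside the rectangle, then [d] is on the right
    side, whose outer faces are dry. *)
Lemma dry_spread c d : inS d -> ladj c d -> inS c \/ d.1 = (k + k)%N%:Z ->
  (inS c -> ~ revealed w c /\ exists2 g, dry g & corner g c) ->
  exists2 g, dry g & corner g d.
Proof.
move=> Sd cd; case Sc : (inS c); last first.
  (* The truncated predecessor selects the row of faces below [d], or the row above it when [d] is
     on the bottom side. *)
  case=> // d1 _; exists ((k + k)%N%:Z, (absz d.2).-1%:Z).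
    by apply: right_dry; move: Sd h_gt0; rewrite /inS; clear; lia.
  by move: Sd; rewrite /inS /corner /= d1; clear; lia.
move=> _ /(_ isT) [nc [g dg gc]].
have ne e : corner e c -> ~ explored w e by move=> ec ee; apply: nc; split=> //; exists e.
suff [f [Ff fc fd]] : exists f, [/\ face f, corner f c & corner f d].
  by exists f => //; exact: (around_dry ne dg gc Ff fc).
have [Fg _] := dryP dg.
move: (ladjP cd) Sc Sd gc; case: c {cd nc ne} => x y /= [->|[->|[->|[->|->]]]] Sc Sd gc.
- by exists g.
- exists (x, y); by move: Sc Sd; rewrite /inS /face /corner /=; clear; split; lia.
- exists (x, y - 1); by move: Sc Sd; rewrite /inS /face /corner /=; clear; split; lia.
- exists (x, (absz y).-1%:Z); by move: Sc Sd h_gt0; rewrite /inS /face /corner /=; clear; split; lia.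
- exists (x - 1, (absz y).-1%:Z); by move: Sc Sd h_gt0; rewrite /inS /face /corner /=; clear; split; lia.
Qed.

End Boundary.

End Exploration.

(** * Gluing a horizontal crossing to the explored region *)

Lemma first_hit (T : eqType) (U : pred T) (e : rel T) x (s : seq T) :
  path e x s -> ~~ U x -> U (last x s) ->
  exists t u, [/\ path e x (rcons t u), all (predC U) (x :: t), U u & {subset x :: rcons t u <= x :: s}].
Proof.
elim: s x => [|y s IH] x /=; first by move=> _ /negbTE ->.
move=> /andP[xy ps] nx Ul.
have [Uy|nUy] := boolP (U y).
  exists [::], y; split=> //=; rewrite ?xy ?nx //.
  by move=> z; rewrite !inE => /orP[->//|->]; rewrite orbT.
have [t [u [pt nt Uu sub]]] := IH y ps nUy Ul.
exists (y :: t), u; split=> //=; first by rewrite xy.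
  by rewrite nx; exact: nt.
move=> z; rewrite inE => /orP[/eqP->|/sub h]; first exact: mem_head.
by rewrite inE h orbT.
Qed.

Lemma mem_rcons_sub (T : eqType) (v x : T) (t : seq T) : {subset v :: t <= v :: rcons t x}.
Proof. by move=> z zt; rewrite -rcons_cons mem_rcons in_cons zt orbT. Qed.

(** * Independent columns *)

Section Columns.
Variables (R : realType) (p : R).
Hypothesis p01 : 0 <= p <= 1.

Definition mean2 (g : bool -> bool -> R) : R :=
  p * (p * g true true + (1 - p) * g true false) +
  (1 - p) * (p * g false true + (1 - p) * g false false).

Definition over (cs : seq column) : seq vertex :=
  flatten [seq [:: (c, false); (c, true)] | c <- cs].

Lemma mem_over cs v : (v \in over cs) = (v.1 \in cs).
Proof.
case: v => c b; apply/flatten_mapP/idP => [[d dcs]|ccs].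
  by rewrite !inE => /orP[] /eqP[-> _].
by exists c => //; rewrite !inE !xpair_eqE !eqxx; case: b {ccs}.
Qed.

Lemma uniq_over cs : uniq cs -> uniq (over cs).
Proof.
elim: cs => //= c cs IH /andP[nc /IH ucs]; rewrite -/(over cs) !inE !mem_over /= negb_or !nc ucs !andbT.
by rewrite xpair_eqE andbF.
Qed.

Lemma Ex_over cs (g : column -> bool -> bool -> R) w : uniq cs ->
  Ex p (over cs) (fun w => \prod_(c <- cs) g c (w (c, false)) (w (c, true))) w =
  \prod_(c <- cs) mean2 (g c).
Proof.
elim: cs w => [|c cs IH] w; first by rewrite /= !big_nil.
move=> /andP[nc ucs]; rewrite big_cons.
have key a b : Ex p (over cs) (fun w => \prod_(c <- c :: cs) g c (w (c, false)) (w (c, true)))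
   (upd (upd w (c, false) a) (c, true) b) = g c a b * \prod_(c <- cs) mean2 (g c).
  have -> : (fun w : cfg => \prod_(c <- c :: cs) g c (w (c, false)) (w (c, true))) =
     (fun w => g c (w (c, false)) (w (c, true)) * \prod_(c <- cs) g c (w (c, false)) (w (c, true))).
    by apply/funext => u; rewrite big_cons.
  rewrite (@Ex_pull _ _ (fun v => v.1 == c)); first last.
  - by move=> v; rewrite mem_over; apply: contraTN => /eqP ->.
  - by move=> u u' uu'; rewrite !uu' //=.
  by rewrite IH // /upd eqxx /= xpair_eqE andbF eqxx.
by rewrite /= -/(over cs) !key /mean2; ring.
Qed.

Lemma mean2_ge0 (g : bool -> bool -> R) : (forall a b, 0 <= g a b) -> 0 <= mean2 g.
Proof.
move=> g0; have /andP[p0 p1] := p01; have q0 : 0 <= 1 - p by rewrite subr_ge0.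
by apply: addr_ge0; apply: mulr_ge0 => //; apply: addr_ge0; exact: mulr_ge0.
Qed.

End Columns.

(** * Conditioning on the exploration *)

Section RSW.
Variables (R : realType) (p : R).
Hypothesis p01 : 0 <= p <= 1.
Variables (k h N : nat).
Hypotheses (h_gt0 : (0 < h)%N) (kN : (k + k < N)%N).

(** The explored rectangle is the lower left part of the big one, which is twice as high. The
    reflection in the line y = h maps it to the upper left part, and both together cover the left
    side. *)
Let H : int := (h + h)%N%:Z.
Let big := rect 0 N%:Z 0 H.
Let s := sites 0 0 N (h + h).

Definition bottom_to_right (w : cfg) : Prop :=
  exists v v' : vertex, [/\ v.1.2 = 0, (0 : int) <= v.1.1 <= k%:Z, v'.1.1 = N%:Z & connected_in big w v v'].

Section Fresh.
Variable u : cfg.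
Hypothesis dry_side : ~ explored k h u (target k).

Definition seen (c : column) : bool := `[< revealed k h u c >].
Definition mirror (c : column) : column := (c.1, H - c.2).
Definition fold (c : column) : column := if c.2 <= h%:Z then c else mirror c.
Definition barrier (c : column) : bool := seen c || seen (mirror c).

(** These columns avoid the barrier, hence are fresh, and they touch the explored region itself, not
    only its mirror image. *)
Definition layer (c : column) : bool :=
  [&& big (c, false), ~~ barrier c & `[< exists2 d, ladj c d & seen d >]].

Definition beyond : pred vertex := fun v => [&& big v, ~~ barrier v.1 & ~~ layer v.1].

Definition from_right (w : cfg) (x : vertex) : Prop :=
  exists2 v, v.1.1 = N%:Z & connected_in beyond w v x.

(** The state of [v] is not consulted, nor that of any site of the layer: candidates are determined
    by the sites [beyond], hence independent of the layer. *)
Definition candidate (w : cfg) (v : vertex) : Prop :=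
  layer v.1 /\ (v.1.1 = N%:Z \/ exists2 x, adj x v & from_right w x).

Definition hits (V : pred column) (w : cfg) : Prop :=
  exists v t x, [/\ path adj v (rcons t x), v.1.1 = N%:Z, all w (v :: rcons t x),
    all big (v :: rcons t x) & all (fun y : vertex => ~~ barrier y.1) (v :: t) && V x.1].

Lemma mirrorK : involutive mirror.
Proof. by case=> x y; rewrite /mirror /= subKr. Qed.

Lemma barrier_mirror c : barrier (mirror c) = barrier c.
Proof. by rewrite /barrier mirrorK orbC. Qed.

Lemma seen_inS c : seen c -> inS k h c.
Proof. by move=> /asboolP[]. Qed.

Lemma big_col c b b' : big (c, b) = big (c, b').
Proof. by []. Qed.

Lemma right_free (v : vertex) : v.1.1 = N%:Z -> ~~ barrier v.1.
Proof.
move=> vN; rewrite /barrier negb_or; apply/andP; split; apply/negP => /seen_inS;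
  by rewrite /inS /= vN; move: kN; clear; lia.
Qed.

Lemma left_seen (y : int) : (0 : int) <= y <= h%:Z -> seen (0, y).
Proof.
move=> yh; apply/asboolP; split; first by rewrite /inS /=; move: yh; clear; lia.
exists (-1, (absz y).-1%:Z).
  by apply: left_explored => //; move: yh h_gt0; clear; lia.
by rewrite /corner /=; move: yh; clear; lia.
Qed.

(** The barrier contains the left side, so a path from the right has a first vertex in it, which is
    seen or has a seen mirror image. *)
Lemma hcross_hits (w : cfg) : hcross 0 N%:Z 0 H w ->
  hits seen w \/ hits (seen \o mirror) w.
Proof.
move=> [v [v' [v0 v1 /cin_sym [t [pt lt wt Bt]]]]].
have nb : ~~ barrier v'.1 by exact: right_free.
have bl : barrier (last v' t).1.
  rewrite lt /barrier; have : big v by rewrite -lt; exact: (allP Bt) (mem_last _ _).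
  rewrite /big /rect /H => /andP[_ /andP[y0 y1]].
  case: v v0 y0 y1 {lt} => [[x y] b] /= -> y0 y1.
  have [yh|yh] := leP y h%:Z; first by rewrite left_seen // y0.
  by rewrite [X in _ || X]left_seen ?orbT //= subr_ge0 y1 /= /H; move: yh; clear; lia.
have [t' [x [pt' nt' bx sub]]] := first_hit (U := fun y : vertex => barrier y.1) pt nb bl.
have wt' : all w (v' :: rcons t' x) by apply/allP => y /sub; exact: (allP wt).
have Bt' : all big (v' :: rcons t' x) by apply/allP => y /sub; exact: (allP Bt).
move: bx; rewrite /barrier => /orP[bx|bx]; [left|right]; exists v', t', x; split=> //;
  by apply/andP; split.
Qed.

(** Just before it meets a seen column the path is in the layer; its first vertex in the layer is a
    candidate. *)
Lemma hits_candidate (w : cfg) : hits seen w -> exists2 v, candidate w v & w v.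
Proof.
move=> [v [t [x [pt vN wt Bt /andP[nt sx]]]]].
have lay : layer (last v t).1.
  have lin : last v t \in v :: t := mem_last _ _.
  apply/and3P; split.
  - have : big (last v t) by apply: (allP Bt); exact: mem_rcons_sub.
    by case: (last v t) => c b.
  - exact: (allP nt).
  - apply/asboolP; exists x.1 => //; apply: adj_ladj.
    by move: pt; rewrite rcons_path => /andP[].
have [lv|nlv] := boolP (layer v.1).
  by exists v; [split=> //; left|case/andP: wt].
have pt0 : path adj v t by move: pt; rewrite rcons_path => /andP[].
have [t' [y [pt' nt' ly sub]]] := first_hit (U := fun y : vertex => layer y.1) pt0 nlv lay.
have sub2 z : z \in v :: rcons t' y -> z \in v :: rcons t x.
  by move=> /sub; exact: mem_rcons_sub.
have wy : w y by apply: (allP wt); apply: sub2; rewrite -rcons_cons mem_rcons mem_head.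
exists y => //; split=> //; right.
move: pt'; rewrite rcons_path => /andP[pt' ly'].
exists (last v t') => //; exists v => //; exists t'; split=> //.
  by apply/allP => z zt; apply: (allP wt); apply: sub2; exact: mem_rcons_sub.
apply/allP => z zt; apply/and3P; split.
- by apply: (allP Bt); apply: sub2; exact: mem_rcons_sub.
- by apply: (allP nt); apply: sub; exact: mem_rcons_sub.
- exact: (allP nt').
Qed.

Lemma fold_ladj c d : ladj c d -> ladj (fold c) (fold d).
Proof.
move=> /ladjP; case: c => x y; rewrite /fold /mirror /ladj /= => -[->|[->|[->|[->|->]]]] /=;
  do ?case: ifP => ? /=; rewrite /H; lia.
Qed.

(* The side of the barrier facing the right side of the big rectangle. *)
Definition facing (c : column) : Prop :=
  inS k h (fold c) -> exists2 g, dry k h u g & corner g (fold c).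

Lemma facing_step c d : big (c, false) -> big (d, false) -> ~~ barrier c -> ladj c d -> facing c -> facing d.
Proof.
move=> Bc Bd nc cd fc Sd.
apply: (dry_spread h_gt0 dry_side Sd (fold_ladj cd)).
  have [Sc|nS] := boolP (inS k h (fold c)); [by left|right].
  have c1 : (fold c).1 = c.1 by rewrite /fold; case: ifP.
  have d1 : (fold d).1 = d.1 by rewrite /fold; case: ifP.
  have yc : (0 : int) <= (fold c).2 <= h%:Z.
    move: Bc; rewrite /big /rect /fold /mirror /H /= => /andP[_]; case: ifP => /=; clear; lia.
  have cdx : (d.1 <= c.1 + 1) && (c.1 - 1 <= d.1).
    by move: (ladjP cd); case: c d {Bc Bd nc fc nS Sd c1 d1 yc cd} => [x y] [x' y'] /=;
      move=> [[-> _]|[[-> _]|[[-> _]|[[-> _]|[-> _]]]]]; lia.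
  move: Bc nS Sd; rewrite /big /rect /inS c1 d1 yc andbT /= => /andP[xc _].
  by move: xc cdx; clear; lia.
move=> Sc; split; last exact: fc.
move=> rc; move: nc; rewrite /barrier /fold in rc *; case: ifP rc => _ rc; rewrite negb_or => /andP[/asboolP n1 /asboolP n2] //.
Qed.

Lemma facing_path (B : pred vertex) (w : cfg) (v x : vertex) : v.1.1 = N%:Z -> connected_in B w v x ->
  (forall y, B y -> big y && ~~ barrier y.1) -> facing x.1.
Proof.
move=> vN [t [pt <- _ Bt]] BB.
have fv : facing v.1.
  move=> /andP[/andP[_ h2] _]; exfalso; move: h2.
  by rewrite /fold; case: ifP => _ /=; rewrite vN; move: kN; clear; lia.
elim: t v pt Bt fv {vN} => //= y t IH v /andP[vy pt] /and3P[Bv By Bt] fv.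
apply: IH => //; first by rewrite By.
have /andP[b1 b2] := BB _ Bv; have /andP[b3 _] := BB _ By.
apply: facing_step (adj_ladj vy) fv => //.
Qed.

Definition glued (w : cfg) : Prop :=
  exists c, [/\ exists b, candidate w (c, b), w (c, false) & w (c, true)].

(** The open column [c] continues the path from the right in both layers. Its seen neighbour [d] is
    on the boundary between the explored and the dry region, so some open site over [d] is joined to
    the bottom side by revealed sites, and [c] is adjacent to it in its layer. *)
Lemma glued_bottom_to_right w : agree (revealed_site k h u) u w -> glued w -> bottom_to_right w.
Proof.
move=> uw [c [[b [lay cand]] w0 w1]].
have wc b' : w (c, b') by case: b'.
have /and3P[Bc nc /asboolP[d cd sd]] := lay.
have [v [vN vx fc]] : exists v, [/\ v.1.1 = N%:Z, connected_in big w v (c, b) & facing c].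
  case: cand => [cN|[x ax [v vN vx]]].
    exists (c, b); split=> //; first exact: cin_refl.
    by apply: (@facing_path (pred1 (c, b)) (fun=> true) (c, b) (c, b)) => //;
      [exists [::]; rewrite /= eqxx|move=> y /eqP -> /=; rewrite -(big_col c false) Bc].
  exists v; split=> //.
    apply: (@cin_trans _ _ x); first by apply: cin_mono vx => // y /and3P[].
    have [_ _ wx /and3P[Bx _ _]] := cin_ends vx.
    exact: cin_edge.
  have fx : facing x.1 by apply: facing_path vN vx _ => y /and3P[-> ->].
  have [_ _ wx /and3P[Bx nx _]] := cin_ends vx.
  exact: facing_step (adj_ladj ax) fx.
have Sd := seen_inS sd.
have Bd : big (d, false).
  by move: Sd kN; rewrite /inS /big /rect /H /=; clear; lia.
have fold_d : fold d = d.
  by rewrite /fold; move: Sd; rewrite /inS => /andP[_ /andP[_ ->]].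
have [g dg gd] : exists2 g, dry k h u g & corner g d.
  by have := facing_step Bc Bd nc cd fc; rewrite /facing fold_d; exact.
have [_ [f ef fd]] := asboolW sd.
have [z [z' [zd z0 zk zz']]] := boundary_connected h_gt0 dry_side Sd ef dg fd gd.
have bigr y : revealed_site k h u y -> big y.
  by move=> /asboolP[+ _]; move: kN; rewrite /inS /big /rect /H; clear; lia.
have zz'w : connected_in big w z z' by apply: cin_mono zz' => // y ry; rewrite uw.
have [wz Bz _ _] := cin_ends zz'w.
exists z', v; split=> //.
apply: cin_sym; apply: (cin_trans vx); apply: cin_trans zz'w.
apply: (@cin_trans _ _ (c, z.2)); first by apply: cin_col; rewrite ?wc // -(big_col c false).
apply: cin_edge; rewrite ?wc //.
case: z zd {z0 zk zz' wz Bz} => [z1 zb] /= ->; apply: adj_hor => //.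
by apply/eqP => e; move: nc; rewrite e /barrier sd.
Qed.

Lemma increasing_hits V : increasing (hits V).
Proof.
move=> w w' ww' [v [t [x [pt vN wt Bt nt]]]]; exists v, t, x; split=> //.
by apply: sub_all wt => y; exact: ww'.
Qed.

Lemma depends_hits V : depends_on big (hits V).
Proof.
apply: depends_Prop => w w' ww' [v [t [x [pt vN wt Bt nt]]]]; exists v, t, x; split=> //.
by apply/allP => y yt; rewrite -ww'; [exact: (allP wt)|exact: (allP Bt)].
Qed.

Lemma hits_mirror w : hits seen (w \o flipy H) <-> hits (seen \o mirror) w.
Proof.
have bm (y : vertex) : barrier (flipy H y).1 = barrier y.1 by case: y => [[y1 y2] b]; exact: (barrier_mirror (y1, y2)).
have gm (y : vertex) : big (flipy H y) = big y by rewrite /big /rect /=; clear; lia.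
have key V V' w' : (forall c, V' c = V (mirror c)) -> hits V (w' \o flipy H) -> hits V' w'.
  move=> VV' [v [t [x [pt vN wt Bt /andP[nt sx]]]]].
  exists (flipy H v), (map (flipy H) t), (flipy H x); split=> //.
  - by rewrite -map_rcons; apply: homo_path pt; exact: adj_flipy.
  - by rewrite -map_rcons -map_cons all_map.
  - by rewrite -map_rcons -map_cons all_map; apply: sub_all Bt => y; rewrite /= gm.
  - apply/andP; split; first by rewrite -map_cons all_map; apply: sub_all nt => y; rewrite /= bm.
    by rewrite VV'; case: x sx {pt wt Bt} => [c b]; rewrite /= mirrorK.
split; first exact: key.
move=> hw; apply: (key (seen \o mirror)) => [c|]; first by rewrite /= mirrorK.
by congr (hits _ _): hw; apply/funext => x; rewrite /= flipyK.
Qed.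

(** The reflection exchanges the two events of [hcross_hits], so they fail equally often, and by
    Harris' inequality the square is at most the probability that both fail. *)
Lemma fail_hits : fail p s (hits seen) ^+ 2 <= fH p N (h + h).
Proof.
have e : fail p s (hits (seen \o mirror)) = fail p s (hits seen).
  apply/esym/(@fail_sym _ _ big (flipy H) (flipy H)) => //; try exact: flipyK.
  - exact: depends_hits.
  - exact: uniq_sites.
  - exact: uniq_sites.
  - by move=> v; rewrite mem_sites !add0r.
  - by move=> v; rewrite mem_sites !add0r /big /rect /H /=; clear; lia.
  - exact: hits_mirror.
have := fail_or p01 s (@increasing_hits seen) (@increasing_hits (seen \o mirror)).
rewrite e -expr2 => le2; apply: le_trans le2 _.
by apply: fail_mono => // w; exact: hcross_hits.
Qed.

Let s2 := [seq v <- s | ~~ revealed_site k h u v].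
Let cs := [seq c <- columns 0 0 N (h + h) | layer c].
Let rest := [seq v <- s2 | ~~ layer v.1].

Lemma mem_cs c : (c \in cs) = layer c.
Proof.
rewrite mem_filter; case l : (layer c) => //=; rewrite mem_columns !add0r.
by move: l => /and3P[].
Qed.

Lemma layer_fresh v : layer v.1 -> v \in s2.
Proof.
move=> /and3P[Bv nb _]; rewrite mem_filter mem_sites !add0r (_ : rect _ _ _ _ v) ?andbT; last first.
  by case: v Bv {nb}.
by move: nb; rewrite /barrier negb_or => /andP[].
Qed.

Lemma beyond_fresh v : beyond v -> v \in rest.
Proof.
move=> /and3P[Bv nb nl]; rewrite !mem_filter nl mem_sites !add0r (_ : rect _ _ _ _ v) ?andbT //=.
by move: nb; rewrite /barrier negb_or => /andP[].
Qed.

Lemma perm_fresh : perm_eq s2 (rest ++ over cs).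
Proof.
have us : uniq s2 by rewrite filter_uniq // uniq_sites.
apply: uniq_perm => //.
  rewrite cat_uniq filter_uniq // uniq_over ?filter_uniq ?uniq_columns // andbT /=.
  by apply/hasPn => v; rewrite mem_over mem_cs /rest mem_filter => ->.
move=> v; rewrite mem_cat mem_over mem_cs [v \in rest]mem_filter.
by case l : (layer v.1) => /=; rewrite ?orbF //; exact: layer_fresh.
Qed.

Lemma candidate_agree w w' v : agree (fun x => x \notin over cs) w w' -> candidate w v <-> candidate w' v.
Proof.
move=> ww'; suff e x : from_right w x <-> from_right w' x.
  by split=> -[lv [vN|[x xv fx]]]; split=> //;
    [left|right; exists x => //; exact/e|left|right; exists x => //; exact/e].
have aw : agree beyond w w' by move=> y /and3P[_ _ nl]; apply: ww'; rewrite mem_over mem_cs.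
by split=> -[y yN yx]; exists y => //; move: yx; rewrite (depends_cin _ _ aw).
Qed.

Variable j : nat.
Hypothesis pj : (1 - p ^+ 2) ^+ (2 ^ j) <= (1 - p) ^+ 2.

(** With the candidates fixed by [w], [gA] says that the column does not glue and [gB] that it has
    no open candidate. Both depend on the two states in the column only. *)
Let gA w c (a b : bool) : R := Ind R ((exists b', candidate w (c, b')) -> ~ (a /\ b)).
Let gB w c (a b : bool) : R :=
  Ind R ((candidate w (c, false) -> ~ a) /\ (candidate w (c, true) -> ~ b)).

(** In a column with a candidate the first mean is 1 - p^2, and the second is at least (1 - p)^2
    because closing both sites suffices. Without a candidate both means are 1. *)
Lemma mean2_compare w c : mean2 p (gA w c) ^+ (2 ^ j) <= mean2 p (gB w c).
Proof.
have /andP[p0 p1] := p01; have q0 : 0 <= 1 - p by rewrite subr_ge0.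
have [ex|nex] := pselect (exists b', candidate w (c, b')).
  have -> : mean2 p (gA w c) = 1 - p ^+ 2.
    rewrite /mean2 /gA [Ind R (_ -> ~ (true /\ true))]indic_F; last by move=> /(_ ex); apply.
    by rewrite !indic_T; [ring|move=> _ []|move=> _ []|move=> _ []].
  apply: le_trans pj _; rewrite /mean2.
  have -> : gB w c false false = 1 by rewrite /gB indic_T //; split=> _.
  have g0 a b : 0 <= gB w c a b by exact: indic_ge0.
  have h1 : 0 <= p * (p * gB w c true true + (1 - p) * gB w c true false).
    by rewrite mulr_ge0 // addr_ge0 // mulr_ge0.
  have h2 : 0 <= (1 - p) * (p * gB w c false true) by rewrite !mulr_ge0.
  by rewrite mulr1; move: h1 h2; set x := gB _ _ _ _; set y := gB _ _ _ _; set t := gB _ _ _ _; lra.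
have -> : mean2 p (gA w c) = 1.
  by rewrite /mean2 /gA !indic_T //; ring.
have -> : mean2 p (gB w c) = 1.
  have gB1 a b : gB w c a b = 1.
    by rewrite /gB indic_T //; split=> cd; case: nex; eexists; exact: cd.
  by rewrite /mean2 !gB1; ring.
by rewrite expr1n.
Qed.

(** The layer is integrated first: given the sites beyond, probabilities factor over its columns and
    [mean2_compare] applies. Jensen's inequality then treats the sites beyond, and [fail_hits]
    doubles the exponent. *)
Lemma fresh_glue (d : R) : 0 <= d -> fH p N (h + h) <= d ^+ (2 ^ j.+1) ->
  Ex p s2 (fun w => Ind R (~ glued w)) u <= d.
Proof.
move=> d0 fd.
rewrite (Ex_perm _ _ _ perm_fresh) Ex_cat.
pose XA w := \prod_(c <- cs) mean2 p (gA w c).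
have XA0 w : 0 <= XA w.
  by apply: prodr_ge0 => c _; apply: mean2_ge0 => // a b; exact: indic_ge0.
have ucs : uniq cs by rewrite filter_uniq // uniq_columns.
have upper w : Ex p (over cs) (fun w => Ind R (~ glued w)) w <= XA w.
  rewrite /XA -(Ex_over p (gA w) w ucs); apply: Ex_mono => // w' ww'.
  have g01 c : 0 <= gA w c (w' (c, false)) (w' (c, true)) by exact: indic_ge0.
  rewrite {1}/Ind; case: asboolP => [ng|_]; last by apply: prodr_ge0 => c _.
  rewrite big1 // => c _; rewrite /gA indic_T // => -[b cand] [a0 a1].
  by apply: ng; exists c; split=> //; exists b; exact/(candidate_agree _ ww').
have lower w : \prod_(c <- cs) mean2 p (gB w c) <=
    Ex p (over cs) (fun w => Ind R (~ exists2 v, candidate w v & w v)) w.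
  rewrite -(Ex_over p (gB w) w ucs); apply: Ex_mono => // w' ww'.
  have [nc|/existsPNP nc] := pselect (forall c, c \in cs -> (candidate w (c, false) -> ~ w' (c, false)) /\ (candidate w (c, true) -> ~ w' (c, true))).
    rewrite indic_T; first by apply: Num.Theory.prodr_ile1 => c _; rewrite indic_ge0 indic_le1.
    move=> [[c b] cand wv]; have ccs : c \in cs by rewrite mem_cs; case: cand.
    have [n0 n1] := nc c ccs; move/(candidate_agree _ ww'): cand wv.
    by case: b => [/n1|/n0].
  move: nc => [c ccs nc]; rewrite (bigD1_seq c) //= /gB indic_F // mul0r; exact: indic_ge0.
have step1 : (Ex p rest XA u) ^+ (2 ^ j) <= fail p s (hits seen).
  apply: le_trans (jensen p01 _ _ _ XA0) _.
  apply: (@le_trans _ _ (Ex p rest (fun w => Ex p (over cs) (fun w => Ind R (~ exists2 v, candidate w v & w v)) w) u)).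
    apply: ler_Ex => // w; apply: le_trans (lower w); rewrite /XA -prodrXl.
    apply: ler_prod => c _; rewrite mean2_compare andbT exprn_ge0 //.
    by apply: mean2_ge0 => // a b; exact: indic_ge0.
  rewrite -Ex_cat -(Ex_perm _ _ _ perm_fresh).
  (* The absence of open candidates involves fresh sites only, so averaging over the fresh sites or
     over all sites gives the same. *)
  pose Y : pred vertex := fun v => beyond v || layer v.1.
  have Ys2 v : Y v -> v \in s2.
    by move=> /orP[/beyond_fresh|/layer_fresh //]; rewrite mem_filter => /andP[].
  rewrite (@Ex_dep _ p Y s2 s _ u (fun=> false)) //; last 4 first.
  - apply/depends_indic/depends_Prop => w w' ww' [v [lv cv] wv].
    exists v; last by rewrite -ww' // /Y lv orbT.
    split=> //; case: cv => [vN|[x xv [y yN yx]]]; [by left|right]; exists x => //; exists y => //.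
    by rewrite -(@depends_cin beyond y x w w') // => z bz; apply: ww'; rewrite /Y bz.
  - by rewrite filter_uniq // uniq_sites.
  - exact: uniq_sites.
  - by move=> v /Ys2; rewrite mem_filter => /andP[].
  by apply: ler_Ex => // w; apply: indic_mono => nc /hits_candidate.
apply: (@le_trans _ _ (Ex p rest XA u)); first exact: ler_Ex.
have E0 : 0 <= Ex p rest XA u by exact: Ex_ge0.
rewrite -(@ler_pXn2r _ (2 ^ j.+1)) ?nnegrE ?expn_gt0 //.
apply: le_trans fd; rewrite expnS mulnC exprM.
apply: le_trans fail_hits.
by rewrite ler_pXn2r // nnegrE ?exprn_ge0 // fail_ge0.
Qed.

End Fresh.

Lemma rsw_glue j (d : R) : (1 - p ^+ 2) ^+ (2 ^ j) <= (1 - p) ^+ 2 ->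
  0 <= d -> fH p N (h + h) <= d ^+ (2 ^ j.+1) ->
  Ex p s (fun w => Ind R (~ explored k h w (target k) /\ ~ bottom_to_right w)) (fun=> false) <= d.
Proof.
move=> pj d0 fd; apply: (@Ex_stop _ _ p01 (revealed_site k h)) => //; first exact: uniq_sites.
  by move=> u u'; exact: revealed_stop.
(* If the exploration of [u] reaches [target], so does that of every configuration with the same
   revealed sites, and the event is empty. *)
move=> u; have [dry_side|wet] := pselect (~ explored k h u (target k)); last first.
  rewrite (@eq_Ex _ _ _ _ (fun=> 0)) ?Ex_cst // => w uw; apply: indic_F => -[nw _]; apply: wet => eu.
  by apply: nw; apply/(@explored_agree k h u w) => // v rv; apply: uw; rewrite mem_filter rv.
apply: (@le_trans _ _ (Ex p [seq v <- s | ~~ revealed_site k h u v] (fun w => Ind R (~ glued u w)) u)); last first.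
  exact: (fresh_glue u pj d0 fd).
apply: Ex_mono => // w uw; apply: indic_mono => -[_ nb] g.
apply: nb; apply: (glued_bottom_to_right dry_side _ g) => v rv; apply: uw.
by rewrite mem_filter rv.
Qed.

End RSW.

(** * The Russo-Seymour-Welsh estimate *)

Lemma hline (n : nat) (x y : int) : exists t : seq column,
  [/\ path ladj (x, y) t, last (x, y) t = (x + n%:Z, y) &
    all (fun c : column => (c.2 == y) && (x <= c.1 <= x + n%:Z)) ((x, y) :: t)].
Proof.
elim: n => [|n [t [pt lt at_]]].
  by exists [::]; rewrite /= !eqxx addr0 lexx.
exists (rcons t (x + n.+1%:Z, y)); split.
- by rewrite rcons_path pt lt /ladj /=; clear; lia.
- by rewrite last_rcons.
- rewrite -rcons_cons all_rcons; apply/andP; split; first by rewrite /= eqxx; clear; lia.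
  by apply: sub_all at_ => c; clear; lia.
Qed.

Lemma vline (n : nat) (x y : int) : exists t : seq column,
  [/\ path ladj (x, y) t, last (x, y) t = (x, y + n%:Z) &
    all (fun c : column => (c.1 == x) && (y <= c.2 <= y + n%:Z)) ((x, y) :: t)].
Proof.
elim: n => [|n [t [pt lt at_]]].
  by exists [::]; rewrite /= !eqxx addr0 lexx.
exists (rcons t (x, y + n.+1%:Z)); split.
- by rewrite rcons_path pt lt /ladj /=; clear; lia.
- by rewrite last_rcons.
- rewrite -rcons_cons all_rcons; apply/andP; split; first by rewrite /= eqxx; clear; lia.
  by apply: sub_all at_ => c; clear; lia.
Qed.

(* Both paths start on the bottom side, the one going right to the left of the one
   going left. They are forced to cross by running below and around the rectangle. *)
Lemma bottom_glue (B B' C : pred vertex) (w : cfg) (u u' v v' : vertex) (xl xr M : int) :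
  connected_in B w u u' -> connected_in B' w v v' ->
  (forall x, B x -> C x) -> (forall x, B' x -> C x) ->
  (forall x, C x -> rect xl xr 0 M x) ->
  u.1.2 = 0 -> v.1.2 = 0 -> u.1.1 <= v.1.1 -> u'.1.1 = xr -> v'.1.1 = xl ->
  connected_in C w u v.
Proof.
move=> [s [ps ls ws Bs]] [t [pt lt wt Bt]] BC B'C Cx u0 v0 uv u'x v'x.
have Cs x : x \in u :: s -> C x by move=> xs; apply: BC; exact: (allP Bs).
have Ct x : x \in v :: t -> C x by move=> xt; apply: B'C; exact: (allP Bt).
have := Cx _ (Cs _ (mem_head _ _)); rewrite /rect u0 => /andP[/andP[ux1 ux2] /andP[_ M0]].
have := Cx _ (Ct _ (mem_last _ _)); rewrite lt /rect => /andP[_ /andP[y0 yM]].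
have := Cx _ (Ct _ (mem_head _ _)); rewrite /rect => /andP[/andP[vx1 vx2] _].
have [r [pr lr ar]] := hline (absz (u.1.1 - (xl - 1))%R) (xl - 1) (-1).
have [z [pz lz az]] := vline (absz (M + 1 - v'.1.2)%R) (xl - 1) v'.1.2.
have lr' : last (xl - 1, -1) r = (u.1.1, -1).
  by rewrite lr; congr pair; move: ux1; clear; lia.
have lz' : last (xl - 1, v'.1.2) z = (xl - 1, M + 1).
  by rewrite lz; congr pair; move: yM; clear; lia.
(* [a] comes from the left along row -1 and follows the first path to the right side; [b] follows
   the second path to the left side and then climbs at abscissa xl - 1 to height M + 1. *)
pose a := r ++ u.1 :: map fst s.
pose b := v.1 :: map fst t ++ (xl - 1, v'.1.2) :: z.
have [||||||||c] := @planar_crossing (xl - 1, -1) a (v.1.1, -1) b (xl - 1) xr (-1) M.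
- rewrite cat_path pr lr' /= path_ladj // andbT.
  by case: u u0 {ps ls ws Bs uv Cs ux1 ux2 ar lr lr' a} => [[x y] e] /= ->; rewrite /ladj /= eqxx /=; clear; lia.
- rewrite /= cat_path last_map lt /= path_ladj //= pz andbT; apply/andP; split.
    by case: v v0 {pt lt wt Bt uv Ct vx1 vx2 b} => [[x y] e] /= ->; rewrite /ladj /= eqxx /=; clear; lia.
  by rewrite /ladj /= v'x eqxx /= subrK eqxx orbT.
- rewrite -cat_cons all_cat; apply/andP; split.
    by apply: sub_all ar => c; move: M0; clear; lia.
  rewrite -map_cons all_map; apply/allP => x /Cs /Cx; rewrite /rect /=; clear; lia.
- by [].
- by rewrite last_cat /= last_map ls u'x.
- rewrite -[b]/((v.1 :: map fst t) ++ _) -cat_cons all_cat /=; apply/and3P; split.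
  + have -> : xl - 1 <= v.1.1 <= xr by move: vx1 vx2; clear; lia.
    rewrite /= all_map; apply/allP => x xt; have := Cx _ (Ct x _).
    by rewrite inE xt orbT /rect /= => /(_ isT); clear; lia.
  + by move: ux1 ux2; clear; lia.
  + move: az => /= /andP[_]; apply: sub_all => c; move: ux1 ux2; clear; lia.
- by [].
- by rewrite /= last_cat /= lz' /=; clear; lia.
have fin x x' : x \in u :: s -> x' \in v :: t -> x.1 = x'.1 -> connected_in C w u v.
  move=> xs x't xx'.
  have ux' := cin_mono BC (fun _ _ h => h) (cin_mem ps ws Bs xs).
  have vx' := cin_mono B'C (fun _ _ h => h) (cin_mem pt wt Bt x't).
  apply: (cin_trans ux'); apply: (cin_trans _ (cin_sym vx')).
  have [_ _ ? ?] := cin_ends ux'; have [_ _ ? ?] := cin_ends vx'.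
  exact: cin_col.
(* The added pieces can meet only below the two starting points, which then lie in one column; any
   other common column is on both original paths. *)
rewrite -cat_cons mem_cat => /orP[cr|].
  have /andP[/eqP c2 /andP[_ c1]] := allP ar _ cr.
  rewrite inE => /orP[/eqP cv|].
    apply: (fin u v); rewrite ?mem_head //.
    have vu : v.1.1 <= u.1.1 by move: c1 ux1; rewrite cv /=; clear; lia.
    case: (u) (v) u0 v0 uv vu => [[x y] e] [[x' y'] e'] /= -> -> xx' x'x.
    by congr pair; apply/eqP; rewrite eq_le xx'.
  rewrite /b -cat_cons mem_cat => /orP[|cz].
    rewrite -map_cons => /mapP[x /Ct /Cx h cx]; move: h; rewrite /rect -cx c2.
    by clear; lia.
  by have := allP az _ cz; rewrite c2; move: y0; clear; lia.
rewrite -map_cons => /mapP[x xs cx]; have := Cx _ (Cs _ xs); rewrite /rect -cx => cC.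
rewrite inE => /orP[/eqP cv|]; first by move: cC; rewrite cv /=; clear; lia.
rewrite /b -cat_cons mem_cat => /orP[|cz].
  by rewrite -map_cons => /mapP[x' x't cx']; apply: (fin x x') => //; rewrite -cx.
by have := allP az _ cz; move: cC; clear; lia.
Qed.

(** * Assembly of the long crossing *)

Section Assembly.
Variables (R : realType) (p : R).
Hypothesis p01 : 0 <= p <= 1.

Section Half.
Variables (k h N : nat).
Hypotheses (h_gt0 : (0 < h)%N) (kN : (k + k < N)%N).

Let S := rect 0 (k + k)%N%:Z 0 h%:Z.

Definition left_start (w : cfg) : Prop :=
  exists v v' : vertex, [/\ v.1.2 = 0, v.1.1 <= k%:Z, v'.1.2 = h%:Z & connected_in S w v v'].

Lemma increasing_left_start : increasing left_start.
Proof.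
by move=> w w' ww' [v [v' [a b c h']]]; exists v, v'; split=> //; exact: increasing_cin ww' h'.
Qed.

Lemma depends_left_start : depends_on S left_start.
Proof.
apply: depends_Prop => w w' ww' [v [v' [a b c h']]]; exists v, v'; split=> //.
by rewrite -(depends_cin _ _ ww').
Qed.

(** Square root trick: a vertical crossing starts in the left half of the bottom side, or its
    reflection in the vertical axis does. *)
Lemma fail_left_start s : uniq s -> (forall v, S v -> v \in s) ->
  fail p s left_start ^+ 2 <= fH p h (k + k).
Proof.
move=> us Ss; pose T := (k + k)%N%:Z.
have ST v : S (flipx T v) = S v by rewrite /S /rect /T /=; clear; lia.
have e : fail p s (fun w => left_start (w \o flipx T)) = fail p s left_start.
  apply/esym/(@fail_sym _ _ S (flipx T) (flipx T)) => //; try exact: flipxK.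
  - exact: depends_left_start.
  - by move=> v; rewrite ST; exact: Ss.
rewrite expr2 -{2}e; apply: le_trans (fail_or p01 _ _ _) _.
- exact: increasing_left_start.
- by move=> w w' ww'; apply: increasing_left_start => v; exact: ww'.
rewrite -(@fail_vcross _ p p01 s 0 T 0 h%:Z h (k + k)) ?add0r //.
apply: fail_mono => // w [v [v' [v0 v'h vv']]].
have [vk|vk] := leP v.1.1 k%:Z; [left|right]; first by exists v, v'.
exists (flipx T v), (flipx T v'); split=> //; first by rewrite /= /T; move: vk; clear; lia.
apply: (@cin_map (flipx T) S); [exact: adj_flipx|by move=> x; rewrite ST|].
by congr (connected_in _ _ _ _): vv'; apply/funext => x /=; rewrite flipxK.
Qed.

Lemma left_start_blocks w : left_start w -> ~ explored k h w (target k).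
Proof.
move=> [v [v' [v0 vk v'h [s [ps ls ws Ss]]]]].
by apply: (crossing_blocks h_gt0 ps ws) => //; rewrite ls.
Qed.

Let big := rect 0 N%:Z 0 (h + h)%N%:Z.
Let s := sites 0 0 N (h + h).

Lemma fail_bottom_to_right j d : (1 - p ^+ 2) ^+ (2 ^ j) <= (1 - p) ^+ 2 -> 0 <= d ->
  fH p N (h + h) <= d ^+ (2 ^ j.+1) -> fH p h (k + k) <= d ^+ 2 ->
  fail p s (bottom_to_right k h N) <= 2 * d.
Proof.
move=> pj d0 fN fh.
have us : uniq s by exact: uniq_sites.
have Ss v : S v -> v \in s.
  by rewrite mem_sites !add0r /S /rect; move: kN; clear; lia.
have l1 : fail p s left_start <= d.
  rewrite -(@ler_pXn2r _ 2) ?nnegrE ?fail_ge0 //; exact: le_trans (fail_left_start us Ss) fh.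
have l2 := rsw_glue p01 h_gt0 kN pj d0 fN.
apply: (@le_trans _ _ (d + d)); last by lra.
apply: le_trans (lerD l1 l2); rewrite /fail -/s -ExD; apply: ler_Ex => // w.
apply: le_trans (indic_or _ _ _); apply: indic_mono => nb.
have [l|l] := pselect (left_start w); [right|by left].
by split=> //; exact: left_start_blocks.
Qed.

Lemma depends_bottom_to_right : depends_on big (bottom_to_right k h N).
Proof.
apply: depends_Prop => w w' ww' [v [v' [a b c h']]]; exists v, v'; split=> //.
by rewrite -(depends_cin _ _ ww').
Qed.

(** The connection starts at abscissa at most [k], its image under x -> 2 k - x at abscissa at least
    [k]. So [bottom_glue] joins them into a crossing from 2 k - N to N. *)
Lemma fH_bottom : fH p (N + N - (k + k)) (h + h) <= 2 * fail p s (bottom_to_right k h N).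
Proof.
pose T := (k + k)%N%:Z; pose s' := sites (T - N%:Z) 0 (N + N - (k + k)) (h + h).
have us' : uniq s' by exact: uniq_sites.
have bs' v : big v -> v \in s'.
  by rewrite mem_sites /big /rect /T; move: kN; clear; lia.
have us : uniq s by exact: uniq_sites.
have bs v : big v -> v \in s by rewrite mem_sites !add0r.
have e1 := fail_dep p depends_bottom_to_right us us' bs bs'.
have e2 : fail p s (bottom_to_right k h N) = fail p s' (fun w => bottom_to_right k h N (w \o flipx T)).
  apply: (@fail_sym _ _ big (flipx T) (flipx T)) => //; try exact: flipxK.
  - exact: depends_bottom_to_right.
  - by move=> v; rewrite mem_sites /big /rect /T /=; move: kN; clear; lia.
rewrite -(@fail_hcross _ p p01 s' (T - N%:Z) N%:Z 0 (h + h)%N%:Z) ?add0r //; first last.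
- by move=> v; rewrite mem_sites add0r /rect /T; move: kN; clear; lia.
- by rewrite /T; move: kN; clear; lia.
have -> : 2 * fail p s (bottom_to_right k h N) = fail p s' (bottom_to_right k h N) +
    fail p s' (fun w => bottom_to_right k h N (w \o flipx T)).
  by rewrite -e1 -e2; ring.
apply: le_trans (fail_and p01 _ _ _); apply: fail_mono => // w.
move=> [[u [u' [u0 /andP[_ uk] u'N uu']]] [v [v' [v0 /andP[_ vk] v'N vv']]]].
pose big' := rect (T - N%:Z) N%:Z 0 (h + h)%N%:Z.
have vv'' : connected_in big' w (flipx T v) (flipx T v').
  apply: (@cin_map (flipx T) big) vv'; first exact: adj_flipx.
  by move=> x; rewrite /big /big' /rect /T /=; move: kN; clear; lia.
have uu'' : connected_in big' w u u'.
  by apply: cin_mono uu' => // x; rewrite /big' /rect /T; move: kN; clear; lia.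
have g : connected_in big' w u (flipx T v).
  apply: (bottom_glue (xl := T - N%:Z) (xr := N%:Z) (M := (h + h)%N%:Z) uu'' vv'') => //=.
    by rewrite /T; move: uk vk; clear; lia.
  by rewrite v'N.
exists (flipx T v'), u'; split=> //; first by rewrite /= v'N.
exact: cin_trans (cin_sym vv'') (cin_trans (cin_sym g) uu'').
Qed.

End Half.

Lemma fH_rsw a j d : (0 < a)%N -> (1 - p ^+ 2) ^+ (2 ^ j) <= (1 - p) ^+ 2 -> 0 <= d ->
  fH p (47 * a) (48 * a) <= d ^+ (2 ^ j.+1) -> fH p (24 * a) (32 * a) <= d ^+ 2 ->
  fH p (60 * a) (48 * a) <= 4 * d.
Proof.
move=> a0 pj d0 fN fh.
(* With k = 16 a, h = 24 a and N = 47 a the long crossing has length 94 a - 32 a = 62 a, enough for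
   the ratio 5/4 at height 48 a. *)
have kN : (16 * a + 16 * a < 47 * a)%N by move: a0; clear; lia.
have h0 : (0 < 24 * a)%N by move: a0; clear; lia.
have hh : (24 * a + 24 * a = 48 * a)%N by clear; lia.
have kk : (16 * a + 16 * a = 32 * a)%N by clear; lia.
have := @fail_bottom_to_right _ _ _ h0 kN j d pj d0; rewrite hh kk => /(_ fN fh) f2.
have f1 := fH_bottom (24 * a) kN; rewrite hh kk in f1.
apply: le_trans (_ : fH p (47 * a + 47 * a - 32 * a) (48 * a) <= _).
  by apply: fH_mono => //; clear; lia.
by apply: le_trans f1 _; move: f2; clear; lra.
Qed.

(* The exponent 150 splits as 50 + 100: a factor [d] for the horizontal crossings of the
   dichotomy and [d ^ 2] for the vertical ones. *)
Lemma fH_seed N j d : (46 * 47 <= N)%N -> (1 - p ^+ 2) ^+ (2 ^ j) <= (1 - p) ^+ 2 ->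
  0 < d <= 1 -> fH p N N <= d ^+ (150 * 2 ^ j.+1) ->
  exists2 M, (2 <= M)%N & fH p (2 * M) M <= 28 * d.
Proof.
(* The quotient is at least 46, whence 47 a <= N <= 48 a. *)
move=> N46 pj /andP[d0 d1] fN; pose a := (N %/ 47)%N.
have a0 : (0 < a)%N by rewrite /a; lia.
have fN' : fH p (47 * a) (48 * a) <= d ^+ (150 * 2 ^ j.+1).
  by apply: le_trans fN; apply: fH_mono => //; rewrite /a; lia.
have e1 : d ^+ (150 * 2 ^ j.+1) <= d ^+ 150.
  by apply: (ler_wiXn2l (ltW d0) d1); rewrite leq_pmulr // expn_gt0.
have e2 : d ^+ (150 * 2 ^ j.+1) <= d ^+ (2 ^ j.+1).
  by apply: (ler_wiXn2l (ltW d0) d1); rewrite leq_pmull.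
have h54 b L M : (L = 5 * b)%N -> (M = 4 * b)%N -> fH p (2 * M) M <= 7 * fH p L M.
  by move=> -> ->; rewrite mulnA; exact: fH_54.
(* Either ratio 5/4 is already good; or the short way is, and [fH_rsw] gives ratio 5/4 with failure
   at most 4 d; or the dichotomy is contradicted. The factor 7 of [fH_54] makes 28 d. *)
have [hs|hl] := leP (fH p (30 * a) (24 * a)) d.
  exists (24 * a)%N; first by move: a0; clear; lia.
  have := h54 (6 * a)%N (30 * a)%N (24 * a)%N; rewrite !mulnA => /(_ erefl erefl) h.
  by apply: le_trans h _; move: hs d0; clear; lra.
have [vs|vl] := leP (fH p (24 * a) (32 * a)) (d ^+ 2).
  exists (48 * a)%N; first by move: a0; clear; lia.
  have := h54 (12 * a)%N (60 * a)%N (48 * a)%N; rewrite !mulnA => /(_ erefl erefl) h.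
  apply: le_trans h _; have := fH_rsw a0 pj (ltW d0) (le_trans fN' e2) vs.
  by move: d0; clear; lra.
exfalso; have := le_trans (fH_dichotomy p01 a0) (le_trans fN' e1).
rewrite leNgt => /negP; apply.
rewrite (_ : 150 = 50 + 2 * 50)%N // exprD exprM.
by apply: ltr_pM; rewrite ?exprn_ge0 ?ltW // ltrXn2r // ?exprn_ge0 // ltW.
Qed.

End Assembly.

(** * Renormalization *)

(** Self-avoiding paths of given length, rather than connections to a given distance, suit both the
    counting of paths and Koenig's lemma. *)
Definition arm (L : nat) (v : vertex) (w : cfg) : Prop :=
  exists t, [/\ path adj v t, uniq (v :: t), size t = L & all w (v :: t)].

Definition ball (L : nat) (v : vertex) : pred vertex :=
  rect (v.1.1 - L%:Z) (v.1.1 + L%:Z) (v.1.2 - L%:Z) (v.1.2 + L%:Z).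

Lemma path_ball v t x : path adj v t -> x \in v :: t -> ball (size t) v x.
Proof.
elim: t v => [|u t IH] v /=.
  by rewrite inE => _ /eqP ->; rewrite /ball /rect; clear; lia.
move=> /andP[/adj_ladj/ladjP vu pt]; rewrite inE => /orP[/eqP->|xt].
  by rewrite /ball /rect; clear; lia.
have := IH u pt xt; rewrite /ball /rect.
case: u v vu {pt xt} => [[a b] e] [[a' b'] e'] /= h.
have {h} [] : a' - 1 <= a <= a' + 1 /\ b' - 1 <= b <= b' + 1.
  by move: h => [[-> ->]|[[-> ->]|[[-> ->]|[[-> ->]|[-> ->]]]]]; clear; lia.
by clear; lia.
Qed.

Lemma ball_mono m n v x : (m <= n)%N -> ball m v x -> ball n v x.
Proof. by rewrite /ball /rect => mn /andP[/andP[a b] /andP[c d]]; move: mn a b c d; clear; lia. Qed.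

Lemma depends_arm L v : depends_on (ball L v) (arm L v).
Proof.
apply: depends_Prop => w w' ww' [t [pt ut st wt]]; exists t; split=> //.
apply/allP => x xt; rewrite -ww'; first exact: (allP wt).
by rewrite -st; exact: path_ball.
Qed.

Lemma arm_map (h : vertex -> vertex) L v w : {homo h : x y / adj x y} -> injective h ->
  arm L v (w \o h) -> arm L (h v) w.
Proof.
move=> ha hi [t [pt ut st wt]]; exists (map h t); split.
- exact: homo_path pt.
- by rewrite -map_cons map_inj_uniq.
- by rewrite size_map.
- by rewrite -map_cons all_map.
Qed.

(** With its loops removed, a path leaving the ball still has at least [L] steps; it is cut after
    [L] of them. *)
Lemma arm_of_path L v t w : path adj v t -> all w (v :: t) -> ~~ ball L v (last v t) -> arm L v w.
Proof.
move=> pt wt; case: (shortenP pt) => t' pt' ut' sub nb.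
have Lt : (L <= size t')%N.
  rewrite leqNgt; apply: contra nb => /ltnW tL.
  exact: ball_mono tL (path_ball pt' (mem_last v t')).
exists (take L t'); split.
- exact: take_path.
- by have := take_uniq L.+1 ut'.
- by rewrite size_take_min; apply/minn_idPl.
- apply/allP => x; rewrite inE => /orP[/eqP ->|/mem_take/sub xt].
    by apply: (allP wt); rewrite mem_head.
  by apply: (allP wt); rewrite inE xt orbT.
Qed.

(** A translation, combined with the exchange of the layers when [u] is in the upper one, so that
    every vertex can be carried to the origin. *)
Definition moveto (u v : vertex) : vertex := (v.1.1 - u.1.1, v.1.2 - u.1.2, v.2 (+) u.2).
Definition movefrom (u v : vertex) : vertex := (v.1.1 + u.1.1, v.1.2 + u.1.2, v.2 (+) u.2).

Lemma movetoK u : cancel (moveto u) (movefrom u).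
Proof. by case=> [[x y] b]; rewrite /moveto /movefrom /= !subrK addbK. Qed.
Lemma movefromK u : cancel (movefrom u) (moveto u).
Proof. by case=> [[x y] b]; rewrite /moveto /movefrom /= !addrK addbK. Qed.

Lemma adj_moveto u : {homo moveto u : x y / adj x y}.
Proof.
move=> x y; rewrite /adj /l1dist /= => /eqP <-; apply/eqP.
by case: x.2; case: y.2; case: u.2; clear; lia.
Qed.

Lemma adj_movefrom u : {homo movefrom u : x y / adj x y}.
Proof.
move=> x y; rewrite /adj /l1dist /= => /eqP <-; apply/eqP.
by case: x.2; case: y.2; case: u.2; clear; lia.
Qed.

Definition ball_sites (L : nat) : seq vertex := sites (- L%:Z) (- L%:Z) (L + L) (L + L).

Lemma mem_ball_sites L v : (v \in ball_sites L) = ball L origin v.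
Proof. by rewrite mem_sites /ball /rect /=; clear; lia. Qed.

Lemma arm_moveto L u w : arm L u (w \o moveto u) <-> arm L origin w.
Proof.
have u0 : moveto u u = origin by rewrite /moveto !subrr addbb.
split=> [h|h].
  by rewrite -u0; apply: arm_map h; [exact: adj_moveto|exact: (can_inj (movetoK u))].
have -> : u = movefrom u origin by rewrite -u0 movetoK.
apply: arm_map; [exact: adj_movefrom|exact: (can_inj (movefromK u))|].
by congr (arm _ _ _): h; apply/funext => x /=; rewrite -u0 movetoK movefromK.
Qed.

Section Arms.
Variables (R : realType) (p : R).
Hypothesis p01 : 0 <= p <= 1.

Definition arm_prob (L : nat) : R :=
  Ex p (ball_sites L) (fun w => Ind R (arm L origin w)) (fun=> false).

Lemma depends_Ind (X : pred vertex) Q : depends_on X Q -> depends_on X (fun w => Ind R (Q w)).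
Proof. by move=> h w w' /h ->. Qed.

Lemma Ex_arm L u s : uniq s -> (forall v, ball L u v -> v \in s) ->
  Ex p s (fun w => Ind R (arm L u w)) (fun=> false) = arm_prob L.
Proof.
move=> us bs; rewrite /arm_prob.
rewrite (@Ex_sym _ p (ball L u) (movefrom u) (moveto u) s (ball_sites L) _ _ (fun=> false)) //.
- by congr Ex; apply/funext => w; apply: eq_indic; exact: arm_moveto.
- exact: movefromK.
- exact: movetoK.
- exact/depends_Ind/depends_arm.
- exact: uniq_sites.
- by move=> v; rewrite mem_ball_sites /ball /rect /=; clear; lia.
Qed.

Lemma Ex_fail s Q : Ex p s (fun w => Ind R (Q w)) (fun=> false) = 1 - fail p s Q.
Proof.
apply/eqP; rewrite eq_sym subr_eq /fail -ExD -{1}(Ex_cst p s 1 (fun=> false)); apply/eqP.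
by apply: eq_Ex => w _; rewrite indic_not addrC subrK.
Qed.

Lemma Ex_has s (I : eqType) (r : seq I) (Q : I -> cfg -> Prop) w :
  Ex p s (fun w => Ind R (exists2 i, i \in r & Q i w)) w <= \sum_(i <- r) Ex p s (fun w => Ind R (Q i w)) w.
Proof.
rewrite -Ex_sum; apply: ler_Ex => // w'; elim: r => [|i r IH].
  by rewrite big_nil indic_F // => -[].
rewrite big_cons; apply: (@le_trans _ _ (Ind R (Q i w' \/ exists2 j, j \in r & Q j w'))).
  apply: indic_mono => -[j]; rewrite inE => /orP[/eqP -> h|jr h]; [by left|by right; exists j].
by apply: le_trans (indic_or _ _ _) _; rewrite lerD2l.
Qed.

Lemma fail_all s (A : nat -> cfg -> Prop) n :
  fail p s (fun w => forall i, (i < n)%N -> A i w) <= \sum_(i < n) fail p s (A i).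
Proof.
elim: n => [|n IH]; first by rewrite big_ord0 /fail (@eq_Ex _ _ _ _ (fun=> 0)) ?Ex_cst // => w _; apply: indic_F => h; apply: h.
rewrite big_ord_recr /=; apply: le_trans (lerD IH (lexx _)).
apply: le_trans (fail_and p01 _ _ _); apply: fail_mono => // w [h1 h2] i.
by rewrite ltnS leq_eqVlt => /orP[/eqP ->//|]; exact: h1.
Qed.

Section Renormalization.
Variable M : nat.
Hypotheses (M2 : (2 <= M)%N) (seed : fH p (2 * M) M <= 98^-1).

Definition scale (i : nat) : nat := iter i (fun m => (m + m).+1) M.

Lemma scaleS i : scale i.+1 = (scale i + scale i).+1. Proof. by []. Qed.

Lemma scale_ge i : (i + 2 <= scale i)%N.
Proof. by elim: i => [|i IH]; [exact: M2|rewrite scaleS; move: IH; clear; lia]. Qed.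

Lemma scale_mono i j : (i <= j)%N -> (scale i <= scale j)%N.
Proof.
move=> /subnKC <-; elim: (j - i)%N => [|n IH]; first by rewrite addn0.
by rewrite addnS scaleS; move: IH; clear; lia.
Qed.

(** As long as f <= 1/98, the bound 49 f^2 of [fH_double] is at most f / 2; the induction carries
    both estimates. *)
Lemma fH_scale i : fH p (2 * scale i) (scale i) <= 98^-1 * 2^-1 ^+ i.
Proof.
have small : fH p (2 * scale i) (scale i) <= 98^-1 /\ fH p (2 * scale i) (scale i) <= 98^-1 * 2^-1 ^+ i; last by case: small.
elim: i => [|i [IH1 IH2]]; first by rewrite expr0 mulr1.
have s2 : (2 <= scale i)%N by have := scale_ge i; clear; lia.
have := fH_double p01 s2; rewrite -scaleS => h.
have f0 : 0 <= fH p (2 * scale i) (scale i) by exact: fH_ge0.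
have h2 : fH p (2 * scale i.+1) (scale i.+1) <= 2^-1 * fH p (2 * scale i) (scale i).
  by apply: le_trans h _; move: IH1 f0; move: (fH _ _ _) => x IH1 f0; nra.
split; first by apply: le_trans h2 _; move: IH1 f0; lra.
apply: le_trans h2 _; rewrite exprS mulrCA ler_pM2l // invr_gt0 //.
Qed.

(** Horizontal at even scales, vertical at odd ones. Three times a scale exceeds the next scale, so
    consecutive crossings meet. *)
Definition long_crossing (i : nat) (w : cfg) (v v' : vertex) : Prop :=
  if odd i then [/\ v.1.2 = 0, v'.1.2 = (3 * scale i)%N%:Z &
    connected_in (rect 0 (scale i)%:Z 0 (3 * scale i)%N%:Z) w v v']
  else [/\ v.1.1 = 0, v'.1.1 = (3 * scale i)%N%:Z &
    connected_in (rect 0 (3 * scale i)%N%:Z 0 (scale i)%:Z) w v v'].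

Definition crossed (i : nat) (w : cfg) : Prop := exists v v', long_crossing i w v v'.

Lemma fail_crossed s i : uniq s ->
  (forall v, rect 0 (3 * scale i)%N%:Z 0 (3 * scale i)%N%:Z v -> v \in s) ->
  fail p s (crossed i) <= 3 * (98^-1 * 2^-1 ^+ i).
Proof.
move=> us bs; apply: (@le_trans _ _ (3 * fH p (2 * scale i) (scale i))); last first.
  by rewrite ler_pM2l //; exact: fH_scale.
have [h _] := fH_longer p01 (scale i); apply: le_trans h.
rewrite /crossed /long_crossing; case: (odd i).
  rewrite -(@fail_vcross _ p p01 s 0 (scale i)%:Z 0 (3 * scale i)%N%:Z) ?add0r //.
  by move=> v rv; apply: bs; move: rv; rewrite /rect; clear; lia.
rewrite -(@fail_hcross _ p p01 s 0 (3 * scale i)%N%:Z 0 (scale i)%:Z) ?add0r //.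
by move=> v rv; apply: bs; move: rv; rewrite /rect; clear; lia.
Qed.

Lemma long_crossing_cin i w v v' : long_crossing i w v v' -> connected_in predT w v v'.
Proof. by rewrite /long_crossing; case: ifP => _ [_ _]; apply: cin_mono. Qed.

Lemma consecutive_glue i w v v' x x' : long_crossing i w v v' -> long_crossing i.+1 w x x' ->
  connected_in predT w v x.
Proof.
have s2 := scale_ge i.
rewrite /long_crossing [odd i.+1]/=; case: (odd i) => /= -[v0 v1 vv'] [x0 x1 xx'].
  apply: cin_sym.
  apply: (crossing_glue (x1 := 0) (x2 := (scale i)%:Z) (y1 := 0) (y2 := (scale i.+1)%:Z) xx' vv') => //;
    rewrite ?x0 ?x1 ?v0 ?v1 ?scaleS //; try (by move=> y /andP[]); move: s2; clear; lia.
apply: (crossing_glue (x1 := 0) (x2 := (scale i.+1)%:Z) (y1 := 0) (y2 := (scale i)%:Z) vv' xx') => //;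
  rewrite ?x0 ?x1 ?v0 ?v1 ?scaleS //; try (by move=> y /andP[]); move: s2; clear; lia.
Qed.

Lemma crossed_chain n w : (forall i, (i < n.+1)%N -> crossed i w) ->
  exists u v v', [/\ u \in sites 0 0 (3 * M) M, connected_in predT w u v & long_crossing n w v v'].
Proof.
elim: n => [|n IH] cr.
  have [v [v' lc]] := cr 0%N isT.
  move: (lc) => [v0 _ vv']; have [wv rv _ _] := cin_ends vv'.
  by exists v, v, v'; split=> //; [rewrite mem_sites !add0r|exact: cin_refl].
have [|u [v [v' [us uv vv']]]] := IH; first by move=> i iN; apply: cr; rewrite ltnW.
have [x [x' xx']] := cr n.+1 (ltnSn _).
by exists u, x, x'; split=> //; exact: cin_trans uv (consecutive_glue vv' xx').
Qed.

(** The index 2 L is even, so the last crossing is horizontal. Its ends are more than 2 L apart, so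
    one of them is outside the ball. *)
Lemma crossed_arm L w : (forall i, (i < (L + L).+1)%N -> crossed i w) ->
  exists2 u, u \in sites 0 0 (3 * M) M & arm L u w.
Proof.
move=> /crossed_chain[u [v [v' [us uv vv']]]]; exists u => //.
have uv' := cin_trans uv (long_crossing_cin vv').
move: vv'; rewrite /long_crossing oddD addbb => -[v0 v1 _].
have s2 := scale_ge (L + L).
have [nb|] := boolP (~~ ball L u v).
  by move: uv nb => [t [pt <- wt _]]; exact: arm_of_path.
rewrite negbK => bv.
have nb : ~~ ball L u v'.
  by apply/negP; move: bv s2; rewrite /ball /rect v0 v1; clear; lia.
by move: uv' nb => [t [pt <- wt _]]; exact: arm_of_path.
Qed.

(** The failure probabilities of all scales sum to at most 6/98, whatever [L] is; the rest is a
    union bound over the starting vertices, which all have the same arm probability. *)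
Lemma arm_prob_ge L : 2^-1 <= (size (sites 0 0 (3 * M) M))%:R * arm_prob L.
Proof.
pose n := (L + L)%N; pose K := (3 * scale n + L)%N.
pose s := sites (- L%:Z) (- L%:Z) (K + K) (K + K).
have us : uniq s by exact: uniq_sites.
have M0 : (M <= scale n)%N by apply: (@scale_mono 0 n).
have armE u : u \in sites 0 0 (3 * M) M -> Ex p s (fun w => Ind R (arm L u w)) (fun=> false) = arm_prob L.
  move=> ub; apply: Ex_arm => // v; move: ub; rewrite !mem_sites /ball /rect /K; move: M0.
  by clear; lia.
have f : fail p s (fun w => forall i, (i < n.+1)%N -> crossed i w) <= 2^-1.
  apply: le_trans (fail_all s crossed n.+1) _.
  apply: (@le_trans _ _ (\sum_(i < n.+1) 3 * (98^-1 * 2^-1 ^+ i))).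
    apply: ler_sum => i _; apply: fail_crossed => // v.
    have := @scale_mono i n (ltn_ord i); rewrite mem_sites /rect /K.
    by move: (nat_of_ord i) => j; clear; lia.
  have geo m : \sum_(i < m) (3 * (98^-1 * 2^-1 ^+ i)) = 3 / 98 * (2 - 2 * 2^-1 ^+ m) :> R.
    elim: m => [|m IH]; first by rewrite big_ord0 expr0; ring.
    by rewrite big_ord_recr /= IH exprS; field.
  rewrite geo; have : 0 <= 2^-1 ^+ n.+1 :> R by rewrite exprn_ge0.
  by lra.
have : 2^-1 <= Ex p s (fun w => Ind R (exists2 u, u \in sites 0 0 (3 * M) M & arm L u w)) (fun=> false).
  apply: (@le_trans _ _ (1 - fail p s (fun w => forall i, (i < n.+1)%N -> crossed i w))).
    by move: f; lra.
  by rewrite -Ex_fail; apply: ler_Ex => // w; apply: indic_mono; exact: crossed_arm.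
move=> h; apply: (le_trans h); apply: le_trans (Ex_has _ _ _ _) _.
rewrite (eq_big_seq (fun=> arm_prob L)) //.
by rewrite big_const_seq count_predT iter_addr_0 mulr_natl.
Qed.

End Renormalization.

(** * Explicit bounds at small scales and small densities *)

Lemma Ex_prod_eq b t w : uniq t ->
  Ex p t (fun w => \prod_(v <- t) (w v == b)%:R) w = (if b then p else 1 - p) ^+ size t.
Proof.
elim: t w => [|v t IH] w; first by rewrite /= big_nil.
move=> /andP[vt ut].
have e c : Ex p t (fun w => \prod_(u <- v :: t) (w u == b)%:R) (upd w v c) =
    (c == b)%:R * (if b then p else 1 - p) ^+ size t.
  have -> : (fun w : cfg => \prod_(u <- v :: t) (w u == b)%:R) =
      (fun w => (w v == b)%:R * \prod_(u <- t) (w u == b)%:R :> R).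
    by apply/funext => w'; rewrite big_cons.
  rewrite (@Ex_pull _ _ (pred1 v)).
  - by rewrite IH // /upd eqxx.
  - by move=> w1 w2 ww; rewrite ww //= eqxx.
  - by move=> u ut'; apply: contraNN vt => /eqP <-.
by rewrite [LHS]/= !e; case: (b); rewrite /= exprS; ring.
Qed.

Lemma Ind_all b t (w : cfg) : Ind R (forall v, v \in t -> w v = b) = \prod_(v <- t) (w v == b)%:R.
Proof.
have [h|h] := pselect (forall v, v \in t -> w v = b).
  by rewrite indic_T // big_seq big1 // => v /h ->; rewrite eqxx.
rewrite indic_F //; apply/esym/eqP; rewrite prodf_seq_eq0.
apply: contra_notT h => /hasPn h v vt; apply/eqP.
by have := h v vt; rewrite pnatr_eq0 eqb0 negbK.
Qed.

Lemma Ex_all_eq b s t w : uniq s -> uniq t -> {subset t <= s} ->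
  Ex p s (fun w => Ind R (forall v, v \in t -> w v = b)) w = (if b then p else 1 - p) ^+ size t.
Proof.
move=> us ut ts; rewrite -(Ex_prod_eq b w ut).
rewrite (@Ex_dep _ p (mem t) s t _ w w) //; last first.
  by move=> w1 w2 ww; apply: eq_indic; split=> h v vt; [rewrite -ww|rewrite ww]; rewrite ?h.
by apply: eq_Ex => w' _; rewrite Ind_all.
Qed.

Lemma Ex_closed s v w : uniq s -> v \in s -> Ex p s (fun w => Ind R (w v = false)) w = 1 - p.
Proof.
move=> us vs; rewrite -[RHS]expr1 -(@Ex_all_eq false s [:: v] w) //; last by move=> u; rewrite inE => /eqP ->.
apply: eq_Ex => w' _; apply: eq_indic; split=> [wv u|]; first by rewrite inE => /eqP ->.
by apply; rewrite mem_head.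
Qed.

Lemma size_columns a c l m : size (columns a c l m) = (l.+1 * m.+1)%N.
Proof. by rewrite size_allpairs !size_iota. Qed.

Lemma size_sites a c l m : size (sites a c l m) = (l.+1 * m.+1 * 2)%N.
Proof. by rewrite size_allpairs size_columns. Qed.

(* A closed left side blocks every crossing. *)
Lemma fH_lower l m : (1 - p) ^+ (m.+1 * 2) <= fH p l m.
Proof.
have e : size (sites 0 0 0 m) = (m.+1 * 2)%N by rewrite size_sites mul1n.
rewrite -e -(@Ex_all_eq false (sites 0 0 l m) _ (fun=> false)) ?uniq_sites //; last first.
  by move=> v; rewrite !mem_sites /rect; clear; lia.
apply: ler_Ex => // w; apply: indic_mono => cl [v [v' [v0 _ vv']]].
have [wv rv _ _] := cin_ends vv'; move: wv; rewrite cl // mem_sites.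
by move: rv; rewrite /rect v0; clear; lia.
Qed.

(** Union bound over the 5 by 3 by 2 sites: if all are open, the bottom row is a crossing. *)
Lemma fH_4_2 : fH p 4 2 <= 30 * (1 - p).
Proof.
pose s := sites 0 0 4 2.
have us : uniq s by exact: uniq_sites.
apply: (@le_trans _ _ (Ex p s (fun w => Ind R (exists2 v, v \in s & w v = false)) (fun=> false))).
  apply: ler_Ex => // w; apply: indic_mono => nh; apply: contrapT => ncl; apply: nh.
  have op v : v \in s -> w v.
    by move=> vs; apply/negPn/negP => /negbTE wv; apply: ncl; exists v.
  pose row (i : nat) : vertex := (i%:Z, 0, false).
  exists (row 0%N), (row 4); split=> //.
  exists [:: row 1%N; row 2; row 3; row 4]; split=> //.
  by apply/allP => v vr; apply: op; rewrite mem_sites; apply: (allP (_ : all (rect 0 (0 + 4) 0 (0 + 2)) _)) vr.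
apply: le_trans (Ex_has _ _ _ _) _.
rewrite (eq_big_seq (fun=> 1 - p)); last first.
  by move=> v; exact: Ex_closed.
by rewrite big_const_seq count_predT iter_addr_0 size_sites mulr_natl.
Qed.

Definition nbrs (v : vertex) : seq vertex :=
  [:: (v.1.1 + 1, v.1.2, v.2); (v.1.1 - 1, v.1.2, v.2); (v.1.1, v.1.2 + 1, v.2);
      (v.1.1, v.1.2 - 1, v.2); (v.1, ~~ v.2)].

Lemma mem_nbrs v u : adj v u -> u \in nbrs v.
Proof.
case: v u => [[x y] b] [[x' y'] b']; rewrite adjE /= => /orP[/andP[/eqP[<- <-] bb']|].
  by rewrite !inE; move: bb'; case: b; case: b' => // _; rewrite eqxx !orbT.
move=> /andP[/andP[/eqP <- /ladjP h] n].
by move: h n => [[-> ->]|[[-> ->]|[[-> ->]|[[-> ->]|[-> ->]]]]];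
  rewrite ?eqxx // => _; rewrite !inE eqxx ?orbT.
Qed.

Fixpoint walks (L : nat) (v : vertex) : seq (seq vertex) :=
  if L is L'.+1 then flatten [seq [seq u :: t | t <- walks L' u] | u <- nbrs v] else [:: [::]].

Lemma size_walks L v : size (walks L v) = (5 ^ L)%N.
Proof.
elim: L v => //= L IH v; rewrite !size_cat !size_map !IH /= expnS; clear; lia.
Qed.

Lemma mem_walks t v : path adj v t -> t \in walks (size t) v.
Proof.
elim: t v => [//|u t IH] v /andP[/mem_nbrs vu pt].
by apply/flatten_mapP; exists u => //; apply: map_f; exact: IH.
Qed.

(** Union bound over the 5^L walks; a self-avoiding one has L + 1 distinct sites. *)
Lemma arm_prob_le L s v : uniq s -> (forall x, ball L v x -> x \in s) ->
  Ex p s (fun w => Ind R (arm L v w)) (fun=> false) <= (5 ^ L)%:R * p ^+ L.+1.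
Proof.
have /andP[p0 p1] := p01.
move=> us bs; pose good t := [&& path adj v t, uniq (v :: t) & size t == L].
apply: (@le_trans _ _ (Ex p s (fun w => Ind R (exists2 t, t \in walks L v & good t /\ forall x, x \in v :: t -> w x = true)) (fun=> false))).
  apply: ler_Ex => // w; apply: indic_mono => -[t [pt ut st wt]]; exists t.
    by rewrite -st mem_walks.
  split; first by rewrite /good pt ut st eqxx.
  by move=> x xt; exact: (allP wt).
apply: le_trans (Ex_has _ _ _ _) _.
rewrite -(size_walks L v) mulr_natl -iter_addr_0 -count_predT -big_const_seq.
apply: ler_sum => t _; have [g|ng] := boolP (good t); last first.
  by rewrite (@eq_Ex _ _ _ _ (fun=> 0)) ?Ex_cst ?exprn_ge0 // => w _; apply: indic_F => -[].
move: g => /and3P[pt ut /eqP st].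
rewrite -st -[(size t).+1]/(size (v :: t)) -(@Ex_all_eq true s (v :: t) (fun=> false)) //; last first.
  by move=> x xt; apply: bs; rewrite -st; exact: path_ball.
by apply: ler_Ex => // w; apply: indic_mono => -[].
Qed.

(** A crossing contains an arm of N - 1 steps from one of the 2 (N + 1) sites of the left side, so
    [arm_prob_le] bounds its probability by 2 (N + 1) 5^(N - 1) / 20^N. *)
Lemma fH_small_p N : p <= 20^-1 -> (1 <= N)%N -> 2^-1 <= fH p N N.
Proof.
move=> ps N1; have /andP[p0 p1] := p01.
pose s := sites (- N%:Z) (- N%:Z) (3 * N) (3 * N).
have us : uniq s by exact: uniq_sites.
rewrite -(@fail_hcross _ p p01 s 0 N%:Z 0 N%:Z) ?add0r //; last first.
  by move=> v; rewrite mem_sites /rect; clear; lia.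
suff : Ex p s (fun w => Ind R (hcross 0 N%:Z 0 N%:Z w)) (fun=> false) <= 2^-1.
  by rewrite Ex_fail; lra.
pose side := sites 0 0 0 N.
apply: (@le_trans _ _ (Ex p s (fun w => Ind R (exists2 v, v \in side & arm N.-1 v w)) (fun=> false))).
  apply: ler_Ex => // w; apply: indic_mono => -[v [v' [v0 v'N vv']]]; exists v.
    have [_ rv _ _] := cin_ends vv'; move: rv; rewrite mem_sites /rect v0; clear; lia.
  move: vv' => [t [pt lt wt _]]; apply: arm_of_path pt wt _.
  by apply/negP; rewrite lt /ball /rect v0 v'N; move: N1; clear; lia.
apply: le_trans (Ex_has _ _ _ _) _.
apply: (@le_trans _ _ (\sum_(v <- side) (5 ^ N.-1)%:R * 20^-1 ^+ N)).
  rewrite !big_seq; apply: ler_sum => v vs.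
  apply: (@le_trans _ _ ((5 ^ N.-1)%:R * p ^+ N)).
    have := @arm_prob_le N.-1 s v us; rewrite (prednK N1); apply => x; move: vs.
    by rewrite !mem_sites /ball /rect; move: N1; clear; lia.
  by rewrite ler_pM2l ?ltr0n ?expn_gt0 // lerXn2r // nnegrE.
rewrite big_const_seq count_predT iter_addr_0 size_sites.
case: N N1 {s us side} => // n _ /=.
have -> : (20^-1 : R) = 5^-1 * 4^-1 by field.
rewrite -[leLHS]mulr_natl natrX exprMn exprS.
have -> : (1 * n.+2 * 2)%N%:R * (5 ^+ n * (5^-1 * 5^-1 ^+ n * 4^-1 ^+ n.+1)) =
    5^-1 * (n.+2 * 2)%:R * 4^-1 ^+ n.+1 * (5 * 5^-1) ^+ n :> R.
  by rewrite mul1n exprMn; ring.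
rewrite divff // expr1n mulr1.
have h : (n.+2 * 2)%:R <= 4 ^+ n.+1 :> R.
  rewrite -natrX ler_nat; elim: n => // n IH; rewrite expnS; move: IH; clear; lia.
have x0 : 0 < 4 ^+ n.+1 :> R by rewrite exprn_gt0.
rewrite exprVn ler_pdivrMr //; move: h x0; move: (4 ^+ n.+1) => x; lra.
Qed.

End Arms.

(** * Choice of the threshold *)

Section Seed.
Variable R : realType.

Lemma bernoulli (x : R) n : 0 <= x -> 1 + n%:R * x <= (1 + x) ^+ n.
Proof.
move=> x0; elim: n => [|n IH]; first by rewrite mul0r addr0.
rewrite exprS -natr1; have n0 : 0 <= n%:R :> R by exact: ler0n.
apply: (@le_trans _ _ ((1 + x) * (1 + n%:R * x))).
  by move: x0 n0; move: (n%:R : R) => m; nra.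
by rewrite ler_pM2l // ltr_wpDr.
Qed.

(** For uniformity up to p = 1 a factor (1 - p^2)^2 = (1 - p)^2 (1 + p)^2 is set aside. The excess
    (1 + p)^2 <= 4 is absorbed by (1 - p^2)^m <= 1/4, which follows from (1 + p^2)^m >= 4. *)
Lemma glue_exponent (x : R) : 0 < x -> exists j, forall p, x <= p <= 1 -> (1 - p ^+ 2) ^+ (2 ^ j) <= (1 - p) ^+ 2.
Proof.
move=> x0.
have [m hm] : exists m, 3 <= m%:R * x ^+ 2.
  have [m hm] : exists m, 3 / x ^+ 2 <= m%:R by exists (Num.truncn (3 / x ^+ 2)).+1; apply/ltW/truncnS_gt.
  by exists m; rewrite -ler_pdivrMr ?exprn_gt0.
exists m.+2 => p /andP[xp p1].
have [k ek] : exists k, (2 ^ m.+2 = m + k + 2)%N.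
  exists (2 ^ m.+2 - m.+2)%N; have := ltn_expl m.+2 (isT : 1 < 2)%N; clear; lia.
have p2 : 0 <= 1 - p ^+ 2 by move: xp p1 x0; nra.
have p2' : 1 - p ^+ 2 <= 1 by rewrite gerBl sqr_ge0.
have xx : x ^+ 2 <= p ^+ 2 by move: xp x0; nra.
have h4 : 4 <= (1 + p ^+ 2) ^+ m.
  apply: le_trans (bernoulli m (sqr_ge0 p)).
  have : m%:R * x ^+ 2 <= m%:R * p ^+ 2 by rewrite ler_wpM2l.
  by move: hm; lra.
have h1 : (1 - p ^+ 2) ^+ m * (1 + p ^+ 2) ^+ m <= 1.
  rewrite -exprMn exprn_ile1 //; first by rewrite mulr_ge0 // addr_ge0 // sqr_ge0.
  by move: (sqr_ge0 (p ^+ 2)); lra.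
have a0 : 0 <= (1 - p ^+ 2) ^+ m by rewrite exprn_ge0.
have h2 : (1 - p ^+ 2) ^+ m * 4 <= 1.
  by apply: le_trans h1; rewrite ler_wpM2l.
have h3 : (1 - p ^+ 2) ^+ (m + k) <= (1 - p ^+ 2) ^+ m.
  by apply: (ler_wiXn2l p2 p2'); rewrite leq_addr.
have h5 : (1 + p) ^+ 2 <= 4 by move: xp p1 x0; nra.
rewrite ek exprD (_ : (1 - p ^+ 2) ^+ 2 = (1 - p) ^+ 2 * (1 + p) ^+ 2); last by ring.
rewrite mulrCA ler_piMr ?sqr_ge0 //.
by apply: le_trans h2; apply: ler_pM => //; [rewrite exprn_ge0|exact: sqr_ge0].
Qed.

(** Large squares fall under [fH_seed], unless p is at most 1/20, when crossings are unlikely. In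
    small squares a likely crossing forces p so close to 1 that M = 2 works. *)
Lemma crossing_seed : exists2 eps : R, 0 < eps &
  forall (p : R) (N : nat), 0 <= p <= 1 -> (1 <= N)%N -> fH p N N <= eps ->
    exists2 M, (2 <= M)%N & fH p (2 * M) M <= 98^-1.
Proof.
have i20 : 0 < 20^-1 :> R by rewrite invr_gt0.
have [j pj] := glue_exponent i20.
have [K eK] : exists K, K = (46 * 47)%N by eexists.
(* With d = 1/3600 both 28 d from [fH_seed] and 30 d from [fH_4_2] are at most 1/98. *)
have [d [d0 d1 dB]] : exists d : R, [/\ 0 < d, d <= 1 & 30 * d <= 98^-1].
  by exists (60^-1 * 60^-1); split; lra.
have mono m m' : (m <= m')%N -> d ^+ m' <= d ^+ m by move=> h; apply: (ler_wiXn2l (ltW d0) d1).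
(* The first summand of the exponent serves [fH_seed]; the second forces 1 - p <= d when N < K,
   through [fH_lower]. *)
exists (d ^+ (150 * 2 ^ j.+1 + K.+1 * 2)); first by rewrite exprn_gt0.
move=> p N p01 N1 fN.
have [NK|NK] := leqP K N.
  have [ps|pl] := leP p 20^-1.
    have := le_trans (fH_small_p p01 ps N1) fN.
    have := mono 1%N _ (leq_trans (isT : (1 <= K.+1 * 2)%N) (leq_addl (150 * 2 ^ j.+1) _)).
    by rewrite expr1; move: (d ^+ _) => x; lra.
  have p2 : 20^-1 <= p <= 1 by rewrite ltW //=; case/andP: p01.
  rewrite eK in NK.
  have [|M M2 hM] := fH_seed p01 NK (pj p p2) (_ : 0 < d <= 1) (le_trans fN (mono _ _ (leq_addr _ _))); first by rewrite d0.
  by exists M => //; apply: le_trans hM _; lra.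
exists 2%N => //; apply: le_trans (fH_4_2 p01) _.
suff : 1 - p <= d by lra.
have q0 : 0 <= 1 - p by rewrite subr_ge0; case/andP: p01.
rewrite -(@ler_pXn2r _ (N.+1 * 2)) ?nnegrE ?(ltW d0) //.
apply: le_trans (fH_lower p01 N N) _; apply: le_trans fN _; apply: mono.
by apply: leq_trans (leq_addl _ _); rewrite leq_mul2r /= ltnS ltnW.
Qed.

End Seed.

(** * Infinite paths under the product measure *)

Section ProductMeasure.
Variables (R : realType) (p : R) (P : probability config R).
Hypothesis prodP : is_product_measure p P.

Lemma measurable_coord v b : measurable [set w : config | w v = b].
Proof.
have m1 : measurable [set w : config | w v = true].
  by apply: sub_sigma_algebra; exists v.
case: b => //.
have -> : [set w : config | w v = false] = ~` [set w : config | w v = true].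
  by apply/seteqP; split=> w /=; case: (w v).
exact: measurableC.
Qed.

Lemma measurable_cylinder (u : seq vertex) (a : cfg) :
  measurable [set w : config | forall v, v \in u -> w v = a v].
Proof.
elim: u => [|v u IH].
  by rewrite (_ : [set w | _] = setT) //; apply/seteqP; split.
rewrite (_ : [set w | _] = [set w : config | w v = a v] `&` [set w : config | forall x, x \in u -> w x = a x]).
  by apply: measurableI => //; exact: measurable_coord.
apply/seteqP; split=> w /= => [h|[h1 h2] x].
  by split=> [|x xu]; apply: h; rewrite inE ?eqxx // xu orbT.
by rewrite inE => /orP[/eqP ->//|]; exact: h2.
Qed.

(** Induction moving one averaged site at a time into the prescribed sites [u]. Once [s] is empty,
    the event is a cylinder or empty. *)
Lemma local_event_cylinder (Q : cfg -> Prop) (s u : seq vertex) (a : cfg) : uniq (s ++ u) ->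
  depends_on (mem (s ++ u)) Q ->
  let A := [set w : config | Q w /\ forall v, v \in u -> w v = a v] in
  measurable A /\
  P A = (Ex p s (fun w => Ind R (Q w)) a * \prod_(v <- u) (if a v then p else 1 - p))%:E.
Proof.
elim: s u a => [|v s IH] u a /= us dQ.
  have [q|nq] := pselect (Q a).
    have -> : [set w : config | Q w /\ forall v, v \in u -> w v = a v] =
        [set w : config | forall v, v \in u -> w v = a v].
      apply/seteqP; split=> w /= => [[]//|h]; split=> //.
      by rewrite (dQ w a) // => v vu; exact: h.
    by split; [exact: measurable_cylinder|rewrite prodP // indic_T // mul1r].
  have -> : [set w : config | Q w /\ forall v, v \in u -> w v = a v] = set0.
    apply/seteqP; split=> w //= -[q h]; apply: nq.
    by rewrite -(dQ w a) // => v vu; exact: h.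
  by split; [exact: measurable0|rewrite measure0 indic_F // mul0r].
have pe : perm_eq (s ++ v :: u) (v :: s ++ u) by rewrite -cat1s perm_catCA.
have us' : uniq (s ++ v :: u) by rewrite (perm_uniq pe).
have dQ' : depends_on (mem (s ++ v :: u)) Q.
  by move=> w w' ww'; apply: dQ => x xs; apply: ww'; rewrite inE /= (perm_mem pe).
have vu : v \notin u.
  by move: us => /andP[+ _]; rewrite mem_cat negb_or => /andP[].
pose A b := [set w : config | Q w /\ forall x, x \in v :: u -> w x = upd a v b x].
have AE b w : A b w <-> [/\ Q w, w v = b & forall x, x \in u -> w x = a x].
  rewrite /A /=; split=> [[q h]|[q vb h]].
    split=> //; first by rewrite h ?mem_head // /upd eqxx.
    move=> x xu; rewrite h ?inE ?xu ?orbT // /upd; case: eqP => // xv.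
    by move: vu; rewrite -xv xu.
  split=> // x; rewrite inE /upd; case: eqP => [->//|_] /=; exact: h.
have pr b : \prod_(x <- v :: u) (if upd a v b x then p else 1 - p) =
    (if b then p else 1 - p) * \prod_(x <- u) (if a x then p else 1 - p).
  rewrite big_cons {1}/upd eqxx; congr (_ * _); apply: eq_big_seq => x xu.
  by rewrite /upd; case: eqP => // xv; move: vu; rewrite -xv xu.
have [mT PT] : measurable (A true) /\ P (A true) = (Ex p s (fun w => Ind R (Q w)) (upd a v true) * _)%:E :=
  IH (v :: u) (upd a v true) us' dQ'.
have [mF PF] : measurable (A false) /\ P (A false) = (Ex p s (fun w => Ind R (Q w)) (upd a v false) * _)%:E :=
  IH (v :: u) (upd a v false) us' dQ'.
have -> : [set w : config | Q w /\ forall x, x \in u -> w x = a x] = A true `|` A false.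
  apply/seteqP; split=> w; last by case=> /AE[].
  by move=> [q h]; case wv : (w v); [left|right]; apply/AE.
split; first exact: measurableU.
rewrite measureU //; last first.
  by apply/seteqP; split=> w // -[/AE[_ + _] /AE[_ + _]] => ->.
apply: (etrans (congr2 (fun x y => x + y)%E PT PF)).
by rewrite !pr -EFinD; congr (_%:E); ring.
Qed.

Lemma local_event (Q : cfg -> Prop) s w0 : uniq s -> depends_on (mem s) Q ->
  measurable [set w : config | Q w] /\ P [set w : config | Q w] = (Ex p s (fun w => Ind R (Q w)) w0)%:E.
Proof.
move=> us dQ; have := @local_event_cylinder Q s [::] w0; rewrite cats0 big_nil mulr1 => /(_ us dQ) /=.
by have -> : [set w : config | Q w /\ forall v, v \in [::] -> w v = w0 v] = [set w : config | Q w];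
  first by apply/seteqP; split=> w //= -[].
Qed.

End ProductMeasure.

(** * Koenig's lemma for open paths *)

Section Koenig.
Variable w : cfg.

Definition open_walk (t : seq vertex) : Prop :=
  [/\ path adj origin t, uniq (origin :: t) & all w (origin :: t)].

Definition extendible (t : seq vertex) : Prop :=
  forall L, exists2 t', (L <= size t')%N & open_walk (t ++ t').

(** Finite branching: otherwise the extensions through each neighbour of the last vertex would be
    bounded in length, hence all extensions. *)
Lemma extendible_step t : extendible t -> exists u, extendible (rcons t u).
Proof.
move=> ext; apply: contrapT => no.
have stop u : exists L, forall t', open_walk (rcons t u ++ t') -> (size t' < L)%N.
  apply: contrapT => h; apply: no; exists u => L; apply: contrapT => h'; apply: h; exists L => t' ot.
  by rewrite ltnNge; apply/negP => Lt; apply: h'; exists t'.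
have [F FP] := choice stop.
pose N := nbrs (last origin t).
have [[|u t'] Lt ow] := ext (\max_(u <- N) F u).+1 => //.
have uN : u \in N.
  by move: ow => [+ _ _]; rewrite cat_path => /and3P[_ /mem_nbrs].
have := FP u t'; rewrite cat_rcons => /(_ ow); rewrite ltnNge => /negP; apply.
apply: (@leq_trans (\max_(u <- N) F u)); last exact: Lt.
exact: leq_bigmax_seq.
Qed.

Lemma to_infinityE : to_infinity origin w <-> forall L, arm L origin w.
Proof.
split=> [[g [gi ga gw [k gk]]] L|arms].
  (* Only the part of the path after its visit [g k] to the origin is kept. *)
  exists [seq g i | i <- iota k.+1 L]; rewrite -gk -[g k :: _]/(map g (iota k L.+1)); split.
  - by elim: L k {gk} => //= L IH k; rewrite ga IH.
  - by rewrite map_inj_uniq // iota_uniq.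
  - by rewrite size_map size_iota.
  - by apply/allP => x /mapP[i _ ->].
have e0 : extendible [::].
  by move=> L; have [t [pt ut st wt]] := arms L; exists t; rewrite ?st //=.
(* Choice over the extendible walks, packed with their proofs, can be iterated and yields nested
   walks [tr n] of length [n]. *)
have [F FP] := choice (fun t : {t | extendible t} => extendible_step (projT2 t)).
pose T := fix T n : {t | extendible t} := if n is n'.+1 then exist _ _ (FP (T n')) else exist _ _ e0.
pose tr n := projT1 (T n).
have trS n : tr n.+1 = rcons (tr n) (F (T n)) by [].
have ow n : open_walk (tr n).
  have [t' _] := projT2 (T n) 0%N; rewrite -/(tr n) => -[+ + +].
  rewrite cat_path -cat_cons cat_uniq all_cat => /andP[a _] /andP[b _] /andP[c _]; by split.
have sz n : size (tr n) = n by elim: n => //= n IH; rewrite trS size_rcons IH.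
pose g n := last origin (tr n).
have gE n m : (n <= m)%N -> nth origin (origin :: tr m) n = g n.
  elim: m => [|m IH]; first by rewrite leqn0 => /eqP ->.
  rewrite leq_eqVlt => /orP[/eqP ->|nm]; first by have := nth_last origin (origin :: tr m.+1); rewrite [(size _).-1]/= sz.
  by rewrite trS -rcons_cons nth_rcons /= sz nm IH.
exists g; split.
- move=> i j gij; pose m := maxn i j.
  have [_ um _] := ow m.
  apply/eqP; rewrite -(nth_uniq origin _ _ um) /= ?sz ?ltnS ?leq_maxl ?leq_maxr //.
  by rewrite !gE ?leq_maxl ?leq_maxr // gij.
- move=> i; have [+ _ _] := ow i.+1; rewrite trS rcons_path => /andP[_].
  by rewrite /g trS last_rcons.
- by move=> i; have [_ _ h] := ow i; exact: (allP h) (mem_last _ _).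
- by exists 0%N.
Qed.

End Koenig.

Lemma crossing_hcross n w : crossing n n w <-> hcross (- n%:Z) n%:Z (- n%:Z) n%:Z w.
Proof.
split=> [[v [v' [[v0 _] [v'n _] h]]]|[v [v' [v0 v'n h]]]]; first by exists v, v'.
have [_ /andP[_ a] _ /andP[_ b]] := cin_ends h.
by exists v, v'.
Qed.

(** Continuity from above: the arm events decrease to [to_infinity origin]. *)
Lemma arm_lower (R : realType) (p : R) (P : probability config R) c :
  is_product_measure p P -> (forall L, c <= arm_prob p L) -> (c%:E <= theta P)%E.
Proof.
move=> prodP cL; pose A L := [set w : config | arm L origin w].
have dep L : depends_on (mem (ball_sites L)) (arm L origin).
  by move=> w w' ww'; apply: depends_arm => x bx; apply: ww'; rewrite -mem_ball_sites in bx.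
have loc L := local_event prodP (fun=> false) (uniq_sites _ _ _ _) (dep L).
have mA L : measurable (A L) by case: (loc L).
have PA L : P (A L) = (arm_prob p L)%:E by case: (loc L).
have e : to_infinity origin = \bigcap_L A L.
  apply/seteqP; split=> w; first by move=> /to_infinityE h L _; exact: h.
  by move=> h; apply/to_infinityE => L; exact: h.
have mI : measurable (\bigcap_L A L) by exact: bigcapT_measurable.
have dec : nonincreasing_seq A.
  apply/nonincreasing_seqP => L; apply/subsetPset => w [t [pt ut st wt]]; exists (take L t); split.
  - exact: take_path.
  - by have := take_uniq L.+1 ut.
  - by rewrite size_take st ltnSn.
  - apply/allP => x; rewrite inE => /orP[/eqP ->|/mem_take xt]; first by case/andP: wt.
    by apply: (allP wt); rewrite inE xt orbT.
have PA0 : (P (A 0%N) < +oo)%E by rewrite PA ltry.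
have cv := nonincreasing_cvg_mu PA0 mA mI dec.
rewrite /theta e -(cvg_lim (@ereal_hausdorff R) cv); apply: lime_ge; first exact: (cvgP _ cv).
by apply: nearW => L; rewrite /= PA lee_fin.
Qed.

Theorem theorem1p2 (R : realType) :
  exists eps : R, 0 < eps /\
    forall (n : nat) (p : R) (P : probability config R),
      (1 <= n)%N -> 0 <= p <= 1 -> is_product_measure p P ->
      ((1 - eps)%:E < P (crossing n n))%E -> (0 < theta P)%E.
Proof.
have [eps eps0 seed] := crossing_seed R; exists eps; split=> // n p P n1 p01 prodP big.
pose s := sites (- n%:Z) (- n%:Z) (n + n) (n + n).
have us : uniq s by exact: uniq_sites.
have bs v : rect (- n%:Z) n%:Z (- n%:Z) n%:Z v -> v \in s.
  by rewrite mem_sites /rect; clear; lia.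
have dep : depends_on (mem s) (hcross (- n%:Z) n%:Z (- n%:Z) n%:Z).
  by move=> w w' ww'; apply: depends_hcross => v /bs; exact: ww'.
have [_ PE] := local_event prodP (fun=> false) us dep.
have ce : crossing n n = [set w : config | hcross (- n%:Z) n%:Z (- n%:Z) n%:Z w].
  by apply/seteqP; split=> w /crossing_hcross.
move: big; rewrite ce PE lte_fin Ex_fail // (@fail_hcross _ _ p01 s _ _ _ _ (n + n) (n + n)) //; [|clear; lia|clear; lia].
move=> big; have N1 : (1 <= n + n)%N by move: n1; clear; lia.
have fN : fH p (n + n) (n + n) <= eps by move: big; lra.
have [M M2 hM] := seed p _ p01 N1 fN.
pose K : R := (size (sites 0 0 (3 * M) M))%:R.
have K0 : 0 < K by rewrite ltr0n size_sites.
(* By [arm_prob_ge] the constant 1 / (2 K) bounds every [arm_prob] from below, uniformly in the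
   length. *)
apply: (@lt_le_trans _ _ (2^-1 / K)%:E); first by rewrite lte_fin divr_gt0.
apply: arm_lower prodP _ => L; rewrite ler_pdivrMr // mulrC.
exact: arm_prob_ge.
Qed.
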